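(* Let $X$ be a spectrally negative Lévy process and let $A$ be a positive co-natural additive functional (PcNAF) of $X$. Then the Revuz measure $\nu_A$ of $A$ is a Radon measure on $\mathbb{R}$.
   Context: $X=\{X_t:t\ge 0\}$ is a real-valued Lévy process defined on $(\Omega,\mathcal{F})$ that is spectrally negative, meaning it has no positive jumps and is not the negative of a subordinator. $\mathbb{P}_x$ is the law of $X$ started at $x\in\mathbb{R}$ and $\mathbb{E}_x$ the corresponding expectation. $\theta_t:\Omega\to\Omega$ are the shift operators, $X_s\circ\theta_t=X_{s+t}$. A positive co-natural additive functional (PcNAF) $A=\{A_t:t\ge0\}$ of $X$ is an $[0,\infty)$-valued process, adapted to the (augmented) natural filtration of $X$, defined on a set $\Omega_A\in\mathcal{F}$ such that: (1) $\mathbb{P}_x(\Omega_A)=1$ for all $x\in\mathbb{R}$; (2) $\theta_t(\Omega_A)\subset\Omega_A$ for all $t>0$; (3) for every $\omega\in\Omega_A$, $t\mapsto A_t(\omega)$ is non-decreasing, right-continuous, finite-valued and $A_0(\omega)=0$; (4) there is a non-negative measurable function $f_A$ on $\mathbb{R}$ such that $A_t(\omega)-A_{t-}(\omega)=f_A(X_t(\omega))$ for all $\omega\in\Omega_A$, $t>0$; (5) $A_{s+t}(\omega)=A_t(\omega)+A_s(\theta_t(\omega))<\infty$ for all $\omega\in\Omega_A$, $s,t>0$. The Revuz measure of $A$ (with respect to Lebesgue measure) is $$\nu_A(B)=\lim_{t\downarrow0}\frac1t\int_{\mathbb{R}}\mathbb{E}_x\left[\int_{(0,t]}1_B(X_s)\,dA_s\right]dx,\qquad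 B\in\mathcal{B}(\mathbb{R}).$$ A Radon measure on $\mathbb{R}$ is a non-negative Borel measure that is finite on compact sets. *)

(* Defs.v *)
From HB Require Import structures.
From mathcomp Require Import all_boot all_order all_algebra.
From mathcomp Require Import all_classical all_reals all_analysis.

Set Implicit Arguments.
Unset Strict Implicit.
Unset Printing Implicit Defensive.
Import Order.TTheory GRing.Theory Num.Theory.
Import numFieldNormedType.Exports.

Local Open Scope classical_set_scope.
Local Open Scope ring_scope.

Section LevyProcess.
Context {d : measure_display} {Omega : measurableType d} {R : realType}.
Implicit Types (P : R -> probability Omega R) (X A : R -> Omega -> R).

(* A process indexed by t >= 0 is a function on R whose values at negative
   times are never used. *)

Definition cadlag (f : R -> R) : Prop :=
  (forall t, 0 <= t -> f @ t^'+ --> f t) /\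
  (forall t, 0 < t -> cvg (f @ t^'-)).

Definition left_lim (f : R -> R) (t : R) : R := lim (f @ t^'-).

Definition natural_filtration X (t : R) : set (set Omega) :=
  <<s [set E | exists (s : R) (B : set R),
    [/\ 0 <= s <= t, measurable B & E = X s @^-1` B]] >>.

Definition natural_sigma_algebra X : set (set Omega) :=
  <<s [set E | exists (s : R) (B : set R),
    [/\ 0 <= s, measurable B & E = X s @^-1` B]] >>.

Record levy_process (Q : probability Omega R) X (x : R) : Prop := {
  levy_measurable : forall t : R, 0 <= t -> measurable_fun setT (X t) ;
  levy_start : Q [set w | X 0 w = x] = 1%E ;
  levy_cadlag : {ae Q, forall w, cadlag (X ^~ w)} ;
  levy_indep_increments : forall (s t : R) E (B : set R), 0 <= s <= t ->
    natural_filtration X s E -> measurable B ->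
    Q (E `&` [set w | B (X t w - X s w)]) =
      (Q E * Q [set w | B (X t w - X s w)%R])%E ;
  levy_stationary_increments : forall (s t : R) (B : set R), 0 <= s <= t ->
    measurable B ->
    Q [set w | B (X t w - X s w)] = Q [set w | B (X (t - s) w - X 0 w)]
}.

(* [levy_family_law]: the finite-dimensional laws of X under P x are those of
   x + X under P 0. *)
Record levy_family P X : Prop := {
  levy_family_process : forall x, levy_process (P x) X x ;
  levy_family_law : forall x (n : nat) (t : nat -> R) (B : nat -> set R),
    (forall i, 0 <= t i) -> (forall i, measurable (B i)) ->
    P x [set w | forall i, (i < n)%N -> B i (X (t i) w)] =
    P 0 [set w | forall i, (i < n)%N -> B i (x + X (t i) w)]
}.

Definition no_positive_jumps (f : R -> R) : Prop :=
  forall t, 0 < t -> f t <= left_lim f t.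

(* X is the negative of a subordinator iff its paths started at 0 are almost
   surely non-increasing; this includes the zero process. *)
Definition negative_subordinator P X : Prop :=
  {ae P 0, forall w, forall s t : R, 0 <= s <= t -> X t w <= X s w}.

Record spectrally_negative_levy P X : Prop := {
  snlp_levy : levy_family P X ;
  snlp_jumps : forall x, {ae P x, forall w, no_positive_jumps (X ^~ w)} ;
  snlp_not_subordinator : ~ negative_subordinator P X
}.

Definition shift_operators X (theta : R -> Omega -> Omega) : Prop :=
  forall (s t : R) w, 0 <= s -> 0 <= t -> X s (theta t w) = X (s + t) w.

(* The augmentation customary for Markov processes: intersection over all
   initial laws mu of the P_mu-augmentations of the natural filtration, where
   P_mu = \int P_x mu(dx). *)
Definition augmented_filtration P X (t : R) : set (set Omega) :=
  [set E | forall mu : probability R R, exists E' N,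
    [/\ natural_filtration X t E', natural_sigma_algebra X N,
        (\int[mu]_x P x N = 0)%E & (E `\` E') `|` (E' `\` E) `<=` N]].

(* [pcnaf_adapted]: A is only defined on OmegaA, so A t is required to be
   measurable for the trace on OmegaA of the augmented filtration. *)
Record pcnaf P X (theta : R -> Omega -> Omega) (OmegaA : set Omega) A : Prop := {
  pcnaf_measurable : measurable OmegaA ;
  pcnaf_adapted : forall (t : R) (B : set R), 0 <= t -> measurable B ->
    exists2 E, augmented_filtration P X t E &
      OmegaA `&` A t @^-1` B = OmegaA `&` E ;
  pcnaf_ge0 : forall w (t : R), OmegaA w -> 0 <= t -> 0 <= A t w ;
  pcnaf_full : forall x, P x OmegaA = 1%E ;
  pcnaf_shift : forall t : R, 0 < t -> theta t @` OmegaA `<=` OmegaA ;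
  pcnaf_nondecreasing : forall w (s t : R), OmegaA w ->
    0 <= s <= t -> A s w <= A t w ;
  pcnaf_right_continuous : forall w (t : R), OmegaA w ->
    0 <= t -> (A ^~ w) @ t^'+ --> A t w ;
  pcnaf0 : forall w, OmegaA w -> A 0 w = 0 ;
  pcnaf_jump : exists fA : R -> R,
    [/\ measurable_fun setT fA, forall x, 0 <= fA x &
        forall w (t : R), OmegaA w -> 0 < t ->
          A t w - left_lim (A ^~ w) t = fA (X t w)] ;
  pcnaf_additive : forall w (s t : R), OmegaA w -> 0 < s -> 0 < t ->
    A (s + t) w = A t w + A s (theta t w)
}.

End LevyProcess.

Section Stieltjes.
Context {R : realType}.

Definition increasing_path (a : R -> R) : Prop :=
  (forall s t, 0 <= s <= t -> a s <= a t) /\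
  (forall t, 0 <= t -> a @ t^'+ --> a t).

(* Extension to R, constant on ]-oo, 0], of a non-decreasing right-continuous
   function on [0, +oo[; any other function is replaced by 0, in order to
   obtain a total map into [cumulative R R]. *)
Definition path_cumulative (a : R -> R) : R -> R :=
  if `[< increasing_path a >] then fun t => a (Num.max 0 t) else cst 0.

Lemma path_cumulative_nd (a : R -> R) : nondecreasing (path_cumulative a).
Proof.
move=> s t st; rewrite /path_cumulative; case: asboolP => [[nd _]|_] //=.
apply: nd; rewrite le_max lexx /= ge_max !le_max lexx st /= orbT //.
Qed.

Lemma path_cumulative_rc (a : R -> R) :
  forall t, path_cumulative a @ t^'+ --> path_cumulative a t.
Proof.
move=> t; rewrite /path_cumulative; case: asboolP => [[nd rc]|_]; last first.
  exact: cvg_cst.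
have [t0|t0] := leP 0 t.
  apply: cvg_trans (rc t t0).
  apply: near_eq_cvg; near=> u.
  by rewrite max_r// (le_trans t0).
apply: cvg_near_cst; near=> u.
rewrite max_l//; near: u; exact: nbhs_right_le.
Unshelve. all: by end_near. Qed.

HB.instance Definition _ (a : R -> R) := isCumulative.Build R _ R
  (path_cumulative a) (@path_cumulative_nd a) (@path_cumulative_rc a).

(* The measure da on ]0, +oo[. *)
Definition stieltjes (a : R -> R) :=
  lebesgue_stieltjes_measure (path_cumulative a).

End Stieltjes.

Section Revuz.
Context {d : measure_display} {Omega : measurableType d} {R : realType}.
Implicit Types (P : R -> probability Omega R) (X A : R -> Omega -> R).

(* The integrands in w and x are in general only measurable for completed
   sigma-algebras.  The integral of a nonnegative function is the supremum of
   the integrals of the simple functions below it, so these integrals agree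
   with those for the completed measures. *)
Definition revuz_approx P X (OmegaA : set Omega) A (B : set R) (t : R) : \bar R :=
  (t^-1%:E *
   \int[lebesgue_measure]_(x in [set: R])
     \int[P x]_(w in OmegaA)
       \int[stieltjes (A ^~ w)]_(s in `]0%R, t]) (\1_B (X s w))%:E)%E.

Definition revuz_measure P X (OmegaA : set Omega) A (B : set R) : \bar R :=
  lim (revuz_approx P X OmegaA A B t @[t --> 0^'+]).

Definition revuz_limit_exists P X (OmegaA : set Omega) A : Prop :=
  forall B : set R, measurable B ->
    cvg (revuz_approx P X OmegaA A B t @[t --> 0^'+]).

End Revuz.

Definition radon_measure {R : realType} (nu : set R -> \bar R) : Prop :=
  exists m : {measure set R -> \bar R},
    (forall B : set R, measurable B -> nu B = m B) /\
    (forall K : set R, compact K -> (m K < +oo)%E).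

(* Main.v *)
(* Let Q be the sigma-finite path measure [\int P_x dx], which every shift
   preserves because Lebesgue measure is invariant for X.  By additivity of A,
   [phi_B(t) = Q(\int_(0,t] 1_B(X_s) dA_s)] is additive and non-decreasing in t,
   hence [phi_B(t) = t phi_B(1)]: the limit defining the Revuz measure is that
   of a constant, and [nu(B) = phi_B(1)] is a measure in B.

   Finiteness on a compact K in ]a, b[: since X is not the negative of a
   subordinator, it climbs from a above b within some time T while A_(T+1) <= M,
   with positive probability.  Having no positive jumps, X then hits each level
   y of ]a, b[ exactly.  On the one hand, the jump f_A(y) of A at that time is at
   most M; on the other hand, the strong Markov property bounds from below, by
   some 2 c > 0, the probability [P_y(A_e <= M)] for e <= 1, and for e small X
   moves by at most 1 at any given time of [0, e] up to probability c.
   Discretise [0, e] and keep those increments of A which are at most M + 1.  By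
   the Markov property, c times the Q-integral of the sum of those increments
   after which X is in a neighbourhood K1 of K is at most the Q-integral of the
   sum of those after which moreover A grows by at most M in time e while X_e
   stays in a larger bounded set K2.  The first such increment is at most M + 1
   and the following ones add up to at most M, so that this last integral is at
   most (2 M + 1) |K2|.  Fatou's lemma concludes. *)

Require Import Defs.
From HB Require Import structures.
From mathcomp Require Import all_boot all_order all_algebra.
From mathcomp Require Import all_classical all_reals all_analysis.
From mathcomp Require Import measurable_realfun.
From mathcomp Require Import ring lra.

Set Implicit Arguments.
Unset Strict Implicit.
Unset Printing Implicit Defensive.
Import Order.TTheory GRing.Theory Num.Theory.
Import numFieldNormedType.Exports.

Local Open Scope classical_set_scope.
Local Open Scope ring_scope.

(** Each [A t] is measurable only for the augmented filtration, whose exceptional sets depend on the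
    initial law, while the Revuz measure integrates over all starting points. [Q] is therefore
    carried by path events altered on a path event null for Lebesgue-almost every starting point and
    off a shift-stable set of good paths; shifts preserve both exceptions, the first because [Q] is
    invariant. Adaptedness is tested against two kinds of initial law: a Gaussian one, with the null
    sets of Lebesgue measure, for statements under [Q], and a Dirac mass for the single starting
    point of the climb. Neither a bound on f_A nor finiteness of [Q] is given. For the former, one
    event under one law P_a controls all levels y between a and b, with the same M and the same 2 c.
    For the latter, increments are kept only when followed by a bounded X_e; as e is common to all
    grid times and X_e has Lebesgue law under [Q], the final bound is the length of K2. The level M
    + 1 leaves a margin: grid increments around a visit to K converge to a jump of at most M. *)

Section independence.
Context d d1 d2 {Omega : measurableType d} {T1 : measurableType d1}
  {T2 : measurableType d2} {R : realType}.
Variables (Q : probability Omega R) (U : Omega -> T1) (D : Omega -> T2).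
Hypotheses (mU : measurable_fun setT U) (mD : measurable_fun setT D).
Hypothesis UD : forall A B, measurable A -> measurable B ->
  Q (U @^-1` A `&` D @^-1` B) = (Q (U @^-1` A) * Q (D @^-1` B))%E.

(** Independence on rectangles determines the joint law of [(U, D)] as the product of the two
    marginal laws, and Tonelli splits the integral. *)
Lemma indep_integral (g : T1 * T2 -> \bar R) :
  measurable_fun setT g -> (forall z, 0 <= g z)%E ->
  (\int[Q]_w g (U w, D w) = \int[Q]_w \int[Q]_w' g (U w, D w'))%E.
Proof.
move=> mg g0.
pose Um := isMeasurableFun.Build _ _ _ _ _ mU.
pose U' : {mfun Omega >-> T1} := HB.pack U Um.
pose Dm := isMeasurableFun.Build _ _ _ _ _ mD.
pose D' : {mfun Omega >-> T2} := HB.pack D Dm.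
have mUD : measurable_fun setT (fun w => (U w, D w)).
  exact: measurable_fun_pair.
pose UDm := isMeasurableFun.Build _ _ _ _ _ mUD.
pose UD' : {mfun Omega >-> (T1 * T2)%type} := HB.pack (fun w => (U w, D w)) UDm.
have E X : measurable X ->
    (distribution Q U' \x distribution Q D')%E X = distribution Q UD' X.
  by apply: product_measure_unique => A B mA mB; exact: UD.
transitivity (\int[distribution Q UD']_z g z)%E.
  by rewrite ge0_integral_distribution.
transitivity (\int[(distribution Q U' \x distribution Q D')%E]_z g z)%E.
  by apply: eq_measure_integral => A mA _; apply/esym/E.
rewrite fubini_tonelli1// ge0_integral_distribution//=; last 2 first.
  - exact: measurable_fun_fubini_tonelli_F.
  - by move=> y; exact: integral_ge0.
apply: eq_integral => w _ /=.
rewrite /fubini_F ge0_integral_distribution//.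
by apply: measurableT_comp => //; exact: measurable_pair1.
Qed.

End independence.

(** * The Markov property *)

Section natural.
Context d {Omega : measurableType d} {R : realType}.
Implicit Type X : R -> Omega -> R.

Definition past_events X (t : R) : set (set Omega) :=
  [set E | exists (s : R) (B : set R),
    [/\ 0 <= s <= t, measurable B & E = X s @^-1` B]].

Definition path_events X : set (set Omega) :=
  [set E | exists (s : R) (B : set R),
    [/\ 0 <= s, measurable B & E = X s @^-1` B]].

(** Copies of [Omega] with a coarser sigma-algebra: adaptedness becomes measurability from such a
    type. Their generators repeat those of [natural_filtration] and [natural_sigma_algebra], so that
    the sigma-algebras are convertible. *)
Definition past_type X (t : R) := g_sigma_algebraType (past_events X t).
Definition path_type X := g_sigma_algebraType (path_events X).

HB.instance Definition _ X t := Measurable.on (past_type X t).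
HB.instance Definition _ X := Measurable.on (path_type X).

Lemma past_sub_past X (s t : R) : s <= t ->
  natural_filtration X s `<=` natural_filtration X t.
Proof.
move=> st; apply: smallest_sub; first exact: smallest_sigma_algebra.
move=> _ [u [B [/andP[u0 us] mB ->]]]; apply: sub_sigma_algebra.
by exists u, B; rewrite u0 (le_trans us).
Qed.

Lemma past_sub_path X (t : R) :
  natural_filtration X t `<=` natural_sigma_algebra X.
Proof.
apply: smallest_sub; first exact: smallest_sigma_algebra.
by move=> _ [u [B [/andP[u0 us] mB ->]]]; apply: sub_sigma_algebra; exists u, B.
Qed.

Lemma measurable_past_X X (s t : R) : 0 <= s <= t ->
  measurable_fun setT (X s : past_type X t -> R).
Proof.
move=> st _ B mB; rewrite setTI; apply: sub_sigma_algebra.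
by exists s, B.
Qed.

Lemma measurable_past_past X (s t : R) (V : Omega -> R) : s <= t ->
  measurable_fun setT (V : past_type X s -> R) ->
  measurable_fun setT (V : past_type X t -> R).
Proof.
move=> st mV _ B mB; have := mV measurableT B mB; rewrite !setTI.
exact: past_sub_past.
Qed.

End natural.

Section markov.
Context d {Omega : measurableType d} {R : realType}.
Variables (P : R -> probability Omega R) (X : R -> Omega -> R).
Hypothesis LF : levy_family P X.

Let mX t : 0 <= t -> measurable_fun setT (X t).
Proof. exact: (levy_measurable (levy_family_process LF 0)). Qed.

Lemma path_sub_measurable : natural_sigma_algebra X `<=` measurable.
Proof.
apply: smallest_sub; first exact: sigma_algebra_measurable.
by move=> _ [u [B [u0 mB ->]]]; rewrite -[X in measurable X]setTI; exact: mX.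
Qed.

Lemma past_sub_measurable t : natural_filtration X t `<=` measurable.
Proof. by move=> E /past_sub_path; exact: path_sub_measurable. Qed.

Lemma measurable_past d' (T : measurableType d') t (V : Omega -> T) :
  measurable_fun setT (V : past_type X t -> T) -> measurable_fun setT V.
Proof.
move=> mV _ B mB; have := mV measurableT B mB; rewrite !setTI.
exact: past_sub_measurable.
Qed.

Lemma measurable_path d' (T : measurableType d') (V : Omega -> T) :
  measurable_fun setT (V : path_type X -> T) -> measurable_fun setT V.
Proof.
move=> mV _ B mB; have := mV measurableT B mB; rewrite !setTI.
exact: path_sub_measurable.
Qed.

Lemma levy_law1 x t (B : set R) : 0 <= t -> measurable B ->
  P x (X t @^-1` B) = P 0 [set w | B (x + X t w)].
Proof.
move=> t0 mB.
have /= := levy_family_law LF x 1 (fun=> t0) (fun=> mB).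
by congr (P _ _ = P _ _); apply/seteqP; split => w /=;
  [move=> /(_ 0%N erefl)|move=> ? []|move=> /(_ 0%N erefl)|move=> ? []].
Qed.

Lemma ae_start x (E : set Omega) : measurable E ->
  P x E = P x (E `&` [set w | X 0 w = x]).
Proof.
move=> mE; have m0 : measurable [set w | X 0 w = x].
  by rewrite -[X in measurable X]setTI; exact: (mX (lexx 0) measurableT (measurable_set1 x)).
have P0 : P x (~` [set w | X 0 w = x]) = 0%E.
  by rewrite probability_setC// (levy_start (levy_family_process LF x)) subee.
rewrite -[in LHS](setIT E) -(setUv [set w | X 0 w = x]) setIUr measureU//.
- rewrite [X in (_ + X)%E](_ : _ = 0%E) ?adde0//.
  apply/eqP; rewrite eq_le measure_ge0 andbT -P0; apply: le_measure.
  + by rewrite inE; apply: measurableI => //; exact: measurableC.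
  + by rewrite inE; exact: measurableC.
  + exact: subIsetr.
- exact: measurableI.
- by apply: measurableI => //; exact: measurableC.
- by rewrite setIACA setICr setI0.
Qed.

Lemma measurable_increment s t : 0 <= s -> 0 <= t ->
  measurable_fun setT (fun w => X t w - X s w).
Proof. by move=> s0 t0; apply: measurable_funB; exact: mX. Qed.

(** Stationarity moves the increment to the interval from 0 to [t - s]; there [X 0 = a] almost
    surely, and [levy_law1] changes the starting point from [a] to 0. *)
Lemma increment_law a s t (B : set R) : 0 <= s <= t -> measurable B ->
  P a [set w | B (X t w - X s w)] = P 0 (X (t - s) @^-1` B).
Proof.
move=> /andP[s0 st] mB; have ts : 0 <= t - s by rewrite subr_ge0.
rewrite (levy_stationary_increments (levy_family_process LF a)) ?s0//.
rewrite ae_start; last first.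
  rewrite -[X in measurable X]setTI; exact: (measurable_increment (lexx 0) ts).
pose C := [set y : R | B (y - a)].
have mC : measurable C.
  rewrite -[X in measurable X]setTI.
  exact: (measurable_funB (@measurable_id _ R setT) (measurable_cst a)).
have -> : X (t - s) @^-1` B = [set w | C (a + X (t - s) w)].
  by apply/seteqP; split => w /=; rewrite /C/= addrAC subrr add0r.
rewrite -levy_law1// [RHS]ae_start; last first.
  by rewrite -[X in measurable X]setTI; exact: mX.
congr (P a _); apply/seteqP; split => w /= [] + X0; rewrite X0.
  by [].
by [].

Qed.

(* The state [V] carried along at time [s] is arbitrary: [V = X s] gives the
   Markov property, [V] constant the independence of the increments. *)
Lemma markov_step a s t (E : set Omega) (V : Omega -> R) (v : R -> \bar R) :
  0 <= s <= t -> natural_filtration X s E ->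
  measurable_fun setT (V : past_type X s -> R) ->
  measurable_fun setT v -> (forall y, 0 <= v y)%E ->
  (\int[P a]_w ((\1_E w)%:E * v (V w + (X t w - X s w))%R) =
   \int[P a]_w ((\1_E w)%:E * \int[P 0]_w' v (V w + X (t - s) w')%R))%E.
Proof.
move=> /andP[s0 st] FE mV mv v0; have ts : 0 <= t - s by rewrite subr_ge0.
have mE := past_sub_measurable FE.
have m1E : measurable_fun setT (\1_E : Omega -> R) by exact: measurable_indic.
have mV' := measurable_past mV.
have mU : measurable_fun setT (fun w => (V w, \1_E w : R)).
  exact: measurable_fun_pair.
have mU' : measurable_fun setT
    ((fun w => (V w, \1_E w : R)) : past_type X s -> (R * R)%type).
  apply: measurable_fun_pair => //; exact: measurable_indic.
have mD := measurable_increment s0 (le_trans s0 st).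
(* The indicator of [E] travels as a real coordinate of the past; the maximum with 0 makes [g']
   non-negative on the whole product, as [indep_integral] requires. *)
pose g' (z : (R * R) * R) : \bar R := ((Num.max 0 z.1.2)%:E * v (z.1.1 + z.2)%R)%E.
have mg' : measurable_fun setT g'.
  apply: emeasurable_funM.
    apply/measurable_EFinP; apply: measurable_maxr => //.
    by apply: measurableT_comp => //; exact: measurableT_comp.
  apply: measurableT_comp => //; apply: measurable_funD => //.
  by exact: measurableT_comp.
have g'0 z : (0 <= g' z)%E.
  by apply: mule_ge0 => //; rewrite lee_fin le_max lexx.
have gE w y : g' ((V w, \1_E w), y) = ((\1_E w)%:E * v (V w + y)%R)%E.
  by rewrite /g'/= max_r// indicE.
transitivity (\int[P a]_w g' ((V w, \1_E w), (X t w - X s w)%R))%E.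
  by apply: eq_integral => w _; rewrite gE.
rewrite (indep_integral mU mD) //; last first.
  move=> A B mA mB; apply: (levy_indep_increments (levy_family_process LF a)) => //.
    by rewrite s0.
  have := mU' measurableT A mA; by rewrite setTI.
apply: eq_integral => w _.
have mk : measurable_fun setT (fun w' => v (V w + X (t - s) w')).
  by apply: (measurableT_comp mv); apply: measurable_funD => //; exact: mX.
rewrite -(@ge0_integralZl _ _ _ (P 0) setT measurableT _ mk)//.
pose Dm := isMeasurableFun.Build _ _ _ _ _ mD.
pose D' : {mfun Omega >-> R} := HB.pack (fun w => X t w - X s w) Dm.
pose Xm := isMeasurableFun.Build _ _ _ _ _ (mX ts).
pose X' : {mfun Omega >-> R} := HB.pack (X (t - s)) Xm.
have mh : measurable_fun setT (fun y => g' ((V w, \1_E w), y)).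
  apply: measurableT_comp => //; exact: measurable_pair1.
transitivity (\int[distribution (P a) D']_y g' ((V w, \1_E w), y))%E.
  by rewrite ge0_integral_distribution.
transitivity (\int[distribution (P 0) X']_y g' ((V w, \1_E w), y))%E.
  apply: eq_measure_integral => A mA _.
  by apply: increment_law => //; rewrite s0.
rewrite ge0_integral_distribution//.
by apply: eq_integral => w' _ /=; rewrite gE.
Qed.

End markov.

Section cylinder.
Context d {Omega : measurableType d} {R : realType}.
Variables (P : R -> probability Omega R) (X : R -> Omega -> R).
Hypothesis LF : levy_family P X.

Let mX t : 0 <= t -> measurable_fun setT (X t).
Proof. exact: (levy_measurable (levy_family_process LF 0)). Qed.

Definition cylinder (l : seq (R * set R)) : set Omega :=
  [set w | all (fun p => `[< p.2 (X p.1 w) >]) l].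

(* For times t1 <= t2 <= ... after r, the probability that the path started
   from y at time r meets the constraints of l. *)
Fixpoint cylinder_prob (r : R) (l : seq (R * set R)) (y : R) : \bar R :=
  if l is p :: l' then
    (\int[P 0%R]_w ((\1_(p.2) (y + X (p.1 - r) w)%R)%:E *
                    cylinder_prob p.1 l' (y + X (p.1 - r) w)%R))%E
  else 1%E.

Lemma cylinder_prob_ge0 r l y : (0 <= cylinder_prob r l y)%E.
Proof.
elim: l r y => //= p l IH r y; apply: integral_ge0 => w _.
by apply: mule_ge0 => //; rewrite lee_fin indicE.
Qed.

Lemma measurable_shift_integral (u : R) (v : R -> \bar R) : 0 <= u ->
  measurable_fun setT v -> (forall y, 0 <= v y)%E ->
  measurable_fun setT (fun y : R => \int[P 0%R]_w v (y + X u w)%R)%E.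
Proof.
move=> u0 mv v0.
apply: (@measurable_fun_fubini_tonelli_F _ _ _ _ _ (P 0)
  (fun z : R * Omega => v (z.1 + X u z.2))) => //.
apply: measurableT_comp => //; apply: measurable_funD => //.
by apply: measurableT_comp => //; exact: mX.
Qed.

Lemma measurable_cylinder_prob r l : path <=%O r (map fst l) ->
  all (fun p => `[< measurable p.2 >]) l ->
  measurable_fun setT (cylinder_prob r l).
Proof.
elim: l r => [|p l IH] r /=; first by move=> _ _; exact: measurable_cst.
move=> /andP[rp pl] /andP[/asboolP mp ml].
apply: (measurable_shift_integral (v := fun z => ((\1_(p.2) z)%:E * cylinder_prob p.1 l z)%E)).
- by rewrite subr_ge0.
- apply: emeasurable_funM; last exact: IH.
  by apply/measurable_EFinP; exact: measurable_indic.
- move=> y; apply: mule_ge0; last exact: cylinder_prob_ge0.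
  by rewrite lee_fin indicE.
Qed.

(** Induction on the constraints: the next increment is added to the carried state [V], the
    constraint just met is absorbed into [E], and [markov_step] integrates that increment out. *)
Lemma markov_cylinder_sorted a s r l (E : set Omega) (V : Omega -> R) :
  0 <= s + r -> path <=%O r (map fst l) ->
  all (fun p => `[< measurable p.2 >]) l ->
  natural_filtration X (s + r) E ->
  measurable_fun setT (V : past_type X (s + r) -> R) ->
  P a (E `&` [set w | all (fun p =>
    `[< p.2 (V w + (X (s + p.1) w - X (s + r) w)) >]) l]) =
  (\int[P a]_w ((\1_E w)%:E * cylinder_prob r l (V w)))%E.
Proof.
elim: l r E V => [|p l IH] r E V sr0 /=.
  move=> _ _ FE mV; rewrite (_ : [set _ | _] = setT) ?setIT; last first.
    by apply/seteqP; split.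
  under eq_integral do rewrite mule1.
  rewrite integral_indic ?setIT//; exact: (past_sub_measurable LF FE).
move=> /andP[rp pl] /andP[/asboolP mp ml] FE mV.
have sp : s + r <= s + p.1 by rewrite lerD2l.
have srp : 0 <= s + r <= s + p.1 by rewrite sr0.
pose V1 w := V w + (X (s + p.1) w - X (s + r) w).
have mV1 : measurable_fun setT (V1 : past_type X (s + p.1) -> R).
  apply: measurable_funD; first exact: (measurable_past_past sp mV).
  apply: measurable_funB; apply: measurable_past_X; rewrite ?lexx ?andbT//.
  by rewrite (le_trans sr0).
pose E1 := E `&` V1 @^-1` p.2.
have FE1 : natural_filtration X (s + p.1) E1.
  apply: (@measurableI _ (past_type X (s + p.1))).
    exact: past_sub_past FE.
  by have := mV1 measurableT _ mp; rewrite setTI.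
pose v y := ((\1_(p.2) y)%:E * cylinder_prob p.1 l y)%E.
have mv : measurable_fun setT v.
  apply: emeasurable_funM; last exact: measurable_cylinder_prob.
  by apply/measurable_EFinP; exact: measurable_indic.
have v0 y : (0 <= v y)%E.
  apply: mule_ge0; last exact: cylinder_prob_ge0.
  by rewrite lee_fin indicE.
transitivity (P a (E1 `&` [set w | all (fun p0 =>
    `[< p0.2 (V1 w + (X (s + p0.1) w - X (s + p.1) w)) >]) l])).
  have V1E (q : R) w : V1 w + (X (s + q) w - X (s + p.1) w) =
      V w + (X (s + q) w - X (s + r) w) by rewrite /V1; ring.
  congr (P a _); apply/seteqP; split => w /=.
    move=> [Ew /andP[/asboolP pw lw]]; split; first by split.
    by apply: sub_all lw => q; rewrite V1E.
  move=> [[Ew pw] lw]; split => //; apply/andP; split; first exact/asboolP.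
  by apply: sub_all lw => q; rewrite V1E.
rewrite IH//; last exact: le_trans sp.
rewrite (_ : p.1 - r = (s + p.1) - (s + r)); last first.
  by rewrite opprD addrACA subrr add0r.
transitivity (\int[P a]_w ((\1_E w)%:E * v (V w + (X (s + p.1)%R w - X (s + r)%R w))%R))%E.
  apply: eq_integral => w _; rewrite /v/E1 indicI/= EFinM muleA.
  by congr (_ * _ * _)%E; rewrite !indicE.
by rewrite (markov_step LF a srp).
Qed.

Lemma integral_start y (v : R -> \bar R) : measurable_fun setT v ->
  (forall z, 0 <= v z)%E -> (\int[P y]_w v (X 0%R w) = v y)%E.
Proof.
move=> mv v0.
have m0 : measurable [set w | X 0 w = y].
  by rewrite -[X in measurable X]setTI; exact: (mX (lexx 0) measurableT (measurable_set1 y)).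
have P0 : P y (~` [set w | X 0 w = y]) = 0%E.
  by rewrite probability_setC// (levy_start (levy_family_process LF y)) subee.
rewrite (ge0_ae_eq_integral (g := cst (v y))) //.
- by rewrite integral_cst//= probability_setT mule1.
- apply: (measurableT_comp mv); exact: mX.
- by move=> x _; exact: v0.
- exists (~` [set w | X 0 w = y]); split.
  + exact: measurableC.
  + exact: P0.
  + by move=> w /= h X0; apply: h => _; rewrite X0.
Qed.

Section unsorted_cylinders.
Variable l : seq (R * set R).
Hypothesis l0 : all (fun p => 0 <= p.1) l.
Hypothesis ml : all (fun p => `[< measurable p.2 >]) l.

Let leT (p q : R * set R) := p.1 <= q.1.
Let l' := sort leT l.

Let l'path : path <=%O 0 (map fst l').
Proof.
rewrite path_sortedE; last exact: le_trans.
rewrite all_map all_sort l0/= sorted_map.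
by apply: sort_sorted => p q; exact: le_total.
Qed.

Let ml' : all (fun p => `[< measurable p.2 >]) l'.
Proof. by rewrite all_sort. Qed.

Let cylinder_law y : P y (cylinder l) = cylinder_prob 0 l' y.
Proof.
have := @markov_cylinder_sorted y 0 0 l' setT (X 0).
rewrite addr0 lexx => /(_ isT l'path ml').
have FT : natural_filtration X 0 setT by exact: (@measurableT _ (past_type X 0)).
have m0 : measurable_fun setT (X 0 : past_type X 0 -> R).
  by apply: measurable_past_X; rewrite lexx.
move=> /(_ FT m0) H.
transitivity (\int[P y]_w (cylinder_prob 0%R l' (X 0%R w)))%E; last first.
  apply: integral_start; first exact: measurable_cylinder_prob.
  exact: cylinder_prob_ge0.
transitivity (\int[P y]_w ((\1_[set: Omega] w)%:E * cylinder_prob 0%R l' (X 0%R w)))%E; last first.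
  by apply: eq_integral => w _; rewrite indicT mul1e.
rewrite -H; congr (P y _); rewrite setTI; apply/seteqP; split => w /=;
  rewrite /cylinder/= all_sort; apply: sub_all => p;
  by rewrite add0r subrKC.
Qed.

Lemma measurable_cylinder_law : measurable_fun setT (fun y => P y (cylinder l)).
Proof.
rewrite (_ : (fun _ => _) = cylinder_prob 0 l'); last first.
  by apply/funext => y; exact: cylinder_law.
exact: measurable_cylinder_prob.
Qed.

Lemma markov_cylinder a s (E : set Omega) (V : Omega -> R) : 0 <= s ->
  natural_filtration X s E -> measurable_fun setT (V : past_type X s -> R) ->
  P a (E `&` [set w | all (fun p =>
    `[< p.2 (V w + (X (s + p.1) w - X s w)) >]) l]) =
  (\int[P a]_w ((\1_E w)%:E * P (V w) (cylinder l)))%E.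
Proof.
move=> s0 FE mV.
have := @markov_cylinder_sorted a s 0 l' E V; rewrite addr0.
move=> /(_ s0 l'path ml' FE mV) H.
under eq_integral do rewrite cylinder_law.
rewrite -H; congr (P a (_ `&` _)); apply/seteqP; split => w /=; by rewrite all_sort.
Qed.

End unsorted_cylinders.

End cylinder.

Section mixture.
Context d d1 {T : measurableType d} {T1 : measurableType d1} {R : realType}.
Variables (mu : {measure set T1 -> \bar R}) (k : T1 -> {measure set T -> \bar R}).
Variable D : set T1.
Hypothesis mD : measurable D.
Hypothesis mk : forall G, measurable G -> measurable_fun D (fun x => k x G).

Definition mixture (G : set T) : \bar R := (\int[mu]_(x in D) k x G)%E.

Let mixture0 : mixture set0 = 0%E.
Proof. by rewrite /mixture integral0_eq// => x _; rewrite measure0. Qed.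

Let mixture_ge0 G : (0 <= mixture G)%E.
Proof. by apply: integral_ge0 => x _; exact: measure_ge0. Qed.

Let mixture_sigma_additive : semi_sigma_additive mixture.
Proof.
move=> F mF tF mUF.
rewrite [X in _ --> X](_ : _ = (\sum_(n <oo) mixture (F n))%E).
  by apply: is_cvg_nneseries => n _ _; exact: mixture_ge0.
rewrite /mixture -integral_nneseries//; last by move=> n; exact: mk.
apply: eq_integral => x _; apply/esym/cvg_lim => //.
exact: measure_semi_sigma_additive.
Qed.

(** Such mixtures recur: the right-hand side of the Markov property, the path measure with Lebesgue
    starting points, restrictions of [Q] (mixtures of Dirac masses), and the product of [Q] with the
    measures dA. *)
Lemma mixture_measure :
  exists m : {measure set T -> \bar R}, forall G, m G = mixture G.
Proof.
pose mm := isMeasure.Build _ _ _ mixture mixture0 mixture_ge0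
  mixture_sigma_additive.
pose m : {measure set T -> \bar R} := HB.pack mixture mm.
by exists m.
Qed.

End mixture.

Section markov.
Context d {Omega : measurableType d} {R : realType}.
Variables (P : R -> probability Omega R) (X : R -> Omega -> R).
Hypothesis LF : levy_family P X.
Implicit Types (G E : set Omega) (l : seq (R * set R)).

Let mX t : 0 <= t -> measurable_fun setT (X t).
Proof. exact: (levy_measurable (levy_family_process LF 0)). Qed.

Definition cylinders : set (set Omega) :=
  [set G | exists l, [/\ all (fun p => 0 <= p.1) l,
    all (fun p => `[< measurable p.2 >]) l & G = cylinder X l]].

Lemma cylinder_path G : cylinders G -> natural_sigma_algebra X G.
Proof.
move=> [l [+ + ->]]; elim: l => [|p l IH] /=.
  move=> _ _; rewrite (_ : cylinder _ _ = setT).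
    exact: (@measurableT _ (path_type X)).
  by apply/seteqP; split.
move=> /andP[p0 l0] /andP[/asboolP mp ml].
rewrite (_ : cylinder _ _ = X p.1 @^-1` p.2 `&` cylinder X l).
  apply: (@measurableI _ (path_type X)); last exact: IH.
  by apply: sub_sigma_algebra; exists p.1, p.2.
apply/seteqP; split => w /=.
  by move=> /andP[/asboolP].
by move=> [pw lw]; apply/andP; split => //; exact/asboolP.
Qed.

Lemma cylinders_generate : natural_sigma_algebra X = <<s cylinders >>.
Proof.
apply/seteqP; split; apply: smallest_sub;
  [exact: smallest_sigma_algebra| |exact: smallest_sigma_algebra|].
  move=> _ [s [B [s0 mB ->]]]; apply: sub_sigma_algebra.
  exists [:: (s, B)]; rewrite /= s0 asboolT//; split => //.
  by apply/seteqP; split => w /=; rewrite /cylinder/= andbT => /asboolP.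
exact: cylinder_path.
Qed.

Lemma cylindersI : setI_closed cylinders.
Proof.
move=> _ _ [l [l0 ml ->]] [l' [l'0 ml' ->]]; exists (l ++ l').
rewrite !all_cat l0 l'0 ml ml'; split => //.
by apply/seteqP; split => w /=; rewrite /cylinder/= all_cat => /andP.
Qed.

Lemma cylindersT : cylinders setT.
Proof. by exists [::]; split => //; apply/seteqP; split. Qed.

(** Dynkin's lemma from cylinders, whose probability is an iterated integral depending measurably on
    the starting point. *)
Lemma measurable_law G : natural_sigma_algebra X G ->
  measurable_fun setT (fun y => P y G).
Proof.
rewrite cylinders_generate.
apply: (@dynkin_induction _ (path_type X) cylinders
  (fun G => measurable_fun setT (fun y => P y G))).
- exact: cylinders_generate.
- exact: cylindersI.
- by under eq_fun do rewrite probability_setT; exact: measurable_cst.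
- by move=> _ [l [l0 ml ->]]; exact: measurable_cylinder_law.
- move=> S mS PS; under eq_fun do rewrite (probability_setC _ (path_sub_measurable LF mS)).
  by apply: emeasurable_funB => //; exact: measurable_cst.
- move=> F mF tF PF.
  rewrite (_ : (fun _ => _) = (fun y => \sum_(n <oo) P y (F n))%E); last first.
    apply/funext => y; rewrite measure_bigcup//.
      by apply: eq_eseriesl => n; rewrite in_setT.
    by move=> n _; exact: (path_sub_measurable LF (mF n)).
  by apply: ge0_emeasurable_sum => // n y _ _; exact: measure_ge0.
Qed.

Lemma measures_on_paths_unique (m1 m2 : {measure set (path_type X) -> \bar R}) :
  (m1 setT < +oo)%E -> (forall G, cylinders G -> m1 G = m2 G) ->
  forall G, natural_sigma_algebra X G -> m1 G = m2 G.
Proof.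
move=> m1oo m12 G; rewrite cylinders_generate.
apply: (@g_sigma_algebra_measure_unique _ R (path_type X) cylinders _ (fun=> setT)) => //.
- by move=> A; exact: cylinder_path.
- by move=> _; exact: cylindersT.
- by rewrite bigcup_const//; exists 0%N.
- exact: cylindersI.
Qed.

Variable theta : R -> Omega -> Omega.
Hypothesis shiftX : shift_operators X theta.

Lemma measurable_theta s : 0 <= s ->
  measurable_fun setT (theta s : path_type X -> path_type X).
Proof.
move=> s0; apply: (@measurability _ _ (path_type X) (path_type X) setT (theta s) (path_events X)) => //.
move=> _ [_ [t [B [t0 mB ->]] <-]]; rewrite setTI.
apply: sub_sigma_algebra; exists (t + s), B; split => //; first exact: addr_ge0.
by apply/seteqP; split => w /=; rewrite shiftX.
Qed.

Lemma theta_path s G : 0 <= s -> natural_sigma_algebra X G ->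
  natural_sigma_algebra X (theta s @^-1` G).
Proof.
move=> s0 nG; have := measurable_theta s0 measurableT nG; by rewrite setTI.
Qed.

(** Both sides are finite measures in [G], hence determined by cylinders, where the claim is
    [markov_cylinder] with [V = X s]. *)
Lemma markov a s E G : 0 <= s -> natural_filtration X s E ->
  natural_sigma_algebra X G ->
  P a (E `&` theta s @^-1` G) = (\int[P a]_(w in E) P (X s w) G)%E.
Proof.
move=> s0 FE; have mE := past_sub_measurable LF FE.
have mk G' : measurable (G' : set (path_type X)) ->
    measurable_fun E (fun w => P (X s w) G').
  move=> mG'; apply: measurable_funTS; apply: (measurableT_comp (measurable_law mG')).
  exact: mX.
(* The law of the identity map, seen as a map into [path_type X], restricts a probability on [Omega]
   to the path sigma-algebra. *)
have mid : measurable_fun setT (id : Omega -> path_type X).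
  by apply: (measurable_path LF); exact: (@measurable_id _ (path_type X)).
pose idm := isMeasurableFun.Build _ _ _ _ _ mid.
pose id' : {mfun Omega >-> path_type X} := HB.pack (id : Omega -> path_type X) idm.
have [m2 m2E] := @mixture_measure _ _ (path_type X) Omega R (P a)
  (fun w => distribution (P (X s w)) id') E mE mk.
have mth : measurable_fun setT (theta s : Omega -> path_type X).
  by apply: (measurable_path LF); exact: measurable_theta.
pose thm := isMeasurableFun.Build _ _ _ _ _ mth.
pose theta' : {mfun Omega >-> path_type X} := HB.pack (theta s : Omega -> path_type X) thm.
pose m1' : {measure set (path_type X) -> \bar R} := pushforward (mrestr (P a) mE) theta'.
pose m1 := m1' mth.
have m1E G' : m1 G' = P a (E `&` theta s @^-1` G').
  by rewrite /m1/= /pushforward/= /mrestr setIC.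
rewrite -m1E -[RHS]m2E; apply: measures_on_paths_unique.
  rewrite m1E; apply: (le_lt_trans (probability_le1 _ _)); last exact: ltry.
  by rewrite preimage_setT setIT.
move=> _ [l [l0 ml ->]]; rewrite m1E m2E /mixture.
have mXs : measurable_fun setT (X s : past_type X s -> R).
  by apply: measurable_past_X; rewrite s0 lexx.
rewrite integral_mkcond; have := markov_cylinder LF l0 ml a s0 FE mXs.
under [X in _ = X -> _]eq_integral do rewrite muleC.
rewrite -epatch_indic => <-.
congr (P a (_ `&` _)); apply/funext => w; congr is_true.
elim: l l0 {ml} => //= p l IH /andP[p0 l0].
by rewrite IH// shiftX// subrKC addrC.
Qed.

End markov.

(** * Invariance of Lebesgue measure *)

Section translation.
Context {R : realType}.

Lemma lebesgue_measure_translate (a : R) (B : set R) : measurable B ->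
  lebesgue_measure [set x | B (x + a)] = lebesgue_measure B.
Proof.
move=> mB.
have mf : measurable_fun setT ((fun x => x + a) : measurableTypeR R -> measurableTypeR R).
  exact: (measurable_funD (@measurable_id _ R setT) (measurable_cst a)).
pose fm := isMeasurableFun.Build _ _ _ _ _ mf.
pose f : {mfun measurableTypeR R >-> measurableTypeR R} :=
  HB.pack ((fun x => x + a) : measurableTypeR R -> measurableTypeR R) fm.
pose m' : {measure set (measurableTypeR R) -> \bar R} :=
  pushforward (@lebesgue_measure R) f.
pose m := m' mf.
apply/esym; apply: (@lebesgue_stieltjes_measure_unique R idfun m) => // _ [[x y] _ <-]/=.
rewrite /m/m'/pushforward/=.
rewrite (_ : _ @^-1` _ = [set` `]x - a, y - a]]); last first.
  by apply/seteqP; split => z /=; rewrite !in_itv/= lerBrDr ltrBlDr.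
change (lebesgue_measure [set` `]x, y]] = lebesgue_measure [set` `]x - a, y - a]]).
rewrite !lebesgue_measure_itv/= !lte_fin ltrD2r.
by case: ifP => // _; rewrite -!EFinD opprB addrA subrK.
Qed.

Lemma lebesgue_integral_translate (a : R) (v : R -> \bar R) :
  measurable_fun setT v -> (forall x, 0 <= v x)%E ->
  (\int[lebesgue_measure]_x v (x + a)%R = \int[lebesgue_measure]_x v x)%E.
Proof.
move=> mv v0.
have mf : measurable_fun setT ((fun x => x + a) : measurableTypeR R -> measurableTypeR R).
  exact: (measurable_funD (@measurable_id _ R setT) (measurable_cst a)).
pose fm := isMeasurableFun.Build _ _ _ _ _ mf.
pose f : {mfun measurableTypeR R >-> measurableTypeR R} :=
  HB.pack ((fun x => x + a) : measurableTypeR R -> measurableTypeR R) fm.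
pose m' : {measure set (measurableTypeR R) -> \bar R} :=
  pushforward (@lebesgue_measure R) f.
pose m := m' mf.
transitivity (\int[m]_x v x)%E.
  by rewrite ge0_integral_pushforward.
apply: eq_measure_integral => A mA _.
exact: lebesgue_measure_translate.
Qed.

End translation.

Section invariance.
Context d {Omega : measurableType d} {R : realType}.
Variables (P : R -> probability Omega R) (X : R -> Omega -> R).
Hypothesis LF : levy_family P X.

Let mX t : 0 <= t -> measurable_fun setT (X t).
Proof. exact: (levy_measurable (levy_family_process LF 0)). Qed.

Lemma integral_law1 x t (v : R -> \bar R) : 0 <= t ->
  measurable_fun setT v -> (forall y, 0 <= v y)%E ->
  (\int[P x]_w v (X t w) = \int[P 0%R]_w v (x + X t w)%R)%E.
Proof.
move=> t0 mv v0.
pose Xm := isMeasurableFun.Build _ _ _ _ _ (mX t0).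
pose X' : {mfun Omega >-> R} := HB.pack (X t) Xm.
have mY : measurable_fun setT (fun w => x + X t w).
  apply: measurable_funD => //; exact: mX.
pose Ym := isMeasurableFun.Build _ _ _ _ _ mY.
pose Y' : {mfun Omega >-> R} := HB.pack (fun w => x + X t w) Ym.
transitivity (\int[distribution (P x) X']_y v y)%E.
  by rewrite ge0_integral_distribution.
transitivity (\int[distribution (P 0) Y']_y v y)%E; last first.
  by rewrite ge0_integral_distribution.
by apply: eq_measure_integral => A mA _; exact: (levy_law1 LF x t0 mA).
Qed.

(** Under [P x] the variable [X t] is distributed as [x + X t] under [P 0]; integrating in [x] first
    leaves a translation of Lebesgue measure for each fixed path. *)
Lemma lebesgue_invariant t (v : R -> \bar R) : 0 <= t ->
  measurable_fun setT v -> (forall y, 0 <= v y)%E ->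
  (\int[lebesgue_measure]_x \int[P x]_w v (X t w) =
   \int[lebesgue_measure]_x v x)%E.
Proof.
move=> t0 mv v0; under eq_integral do rewrite integral_law1//.
rewrite (@fubini_tonelli _ _ _ _ _ lebesgue_measure (P 0)
  (fun z : R * Omega => v (z.1 + X t z.2)))//; last first.
  apply: (measurableT_comp mv); apply: measurable_funD => //.
  apply: measurableT_comp => //; exact: mX.
transitivity (\int[P 0%R]_w \int[lebesgue_measure]_x v x)%E.
  apply: eq_integral => w _; rewrite /=; 
  exact: (@lebesgue_integral_translate _ (X t w) v mv v0).
rewrite -[LHS]/(\int[P 0%R]_w (cst (\int[lebesgue_measure]_x v x) w))%E.
by rewrite integral_cst//= probability_setT mule1.
Qed.

Variable theta : R -> Omega -> Omega.
Hypothesis shiftX : shift_operators X theta.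

Lemma invariant_theta t G : 0 <= t -> natural_sigma_algebra X G ->
  (\int[lebesgue_measure]_x P x (theta t @^-1` G) =
   \int[lebesgue_measure]_x P x G)%E.
Proof.
move=> t0 nG; rewrite -[RHS](lebesgue_invariant t0 (measurable_law LF nG))//.
apply: eq_integral => x _; rewrite -[in LHS](setTI (theta t @^-1` G)).
by rewrite (markov LF shiftX)//; exact: (@measurableT _ (past_type X t)).
Qed.

End invariance.

(** * The stationary measure on the augmented sigma-algebra *)

Section augmentation.
Context d {Omega : measurableType d} {R : realType}.
Variables (P : R -> probability Omega R) (X : R -> Omega -> R).
Hypothesis LF : levy_family P X.
Implicit Types (E G N : set Omega).

Lemma path_measure_exists : exists m : {measure set (path_type X) -> \bar R},
  forall G, m G = (\int[lebesgue_measure]_x P x G)%E.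
Proof.
have mid : measurable_fun setT (id : Omega -> path_type X).
  by apply: (measurable_path LF); exact: (@measurable_id _ (path_type X)).
pose idm := isMeasurableFun.Build _ _ _ _ _ mid.
pose id' : {mfun Omega >-> path_type X} := HB.pack (id : Omega -> path_type X) idm.
apply: (@mixture_measure _ _ (path_type X) (measurableTypeR R) R lebesgue_measure
  (fun x => distribution (P x) id') setT measurableT).
by move=> G mG; exact: (measurable_law LF mG).
Qed.

Definition path_measure := sval (cid path_measure_exists).

Lemma path_measureE G : path_measure G = (\int[lebesgue_measure]_x P x G)%E.
Proof. by rewrite /path_measure; case: cid => m /= ->. Qed.

Definition null_event N :=
  natural_sigma_algebra X N /\ path_measure N = 0%E.

Lemma null_event0 : null_event set0.
Proof. by split; [exact: (@measurable0 _ (path_type X))|rewrite measure0]. Qed.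

Lemma null_event_bigcup (N : (set Omega)^nat) : (forall n, null_event (N n)) ->
  null_event (\bigcup_n N n).
Proof.
move=> N0; have mN : measurable (\bigcup_n N n : set (path_type X)).
  by apply: bigcupT_measurable => n; have [] := N0 n.
split => //; apply: measure_negligible => //.
by apply: negligible_bigcup => n; have [mNn N0n] := N0 n; apply/negligibleP.
Qed.

Lemma null_eventU N N' : null_event N -> null_event N' -> null_event (N `|` N').
Proof.
move=> nN nN'; rewrite -bigcup2E; apply: null_event_bigcup => -[|[|n]] //=.
exact: null_event0.
Qed.

Variable Om0 : set Omega.
Hypothesis Om0_full : forall x, (P x).-negligible (~` Om0).

Definition agree E G N := forall w, Om0 w -> ~ N w -> (E w <-> G w).

(* The exceptional set avoids a path event that is null for almost every
   starting point, and the complement of Om0, which need not be a path event. *)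
Definition augment (F : set (set Omega)) : set (set Omega) :=
  [set E | exists G N, [/\ F G, null_event N & agree E G N]].

Lemma augment_sigma_algebra F : sigma_algebra setT F ->
  sigma_algebra setT (augment F).
Proof.
move=> [F0 FC FU]; split.
- by exists set0, set0; split => //; exact: null_event0.
- move=> E [G [N [FG nN EG]]]; exists (setT `\` G), N; split => //; first exact: FC.
  by move=> w w0 wN; rewrite !setTD /=; have := EG w w0 wN; tauto.
- move=> E /choice [G] /choice [N] h.
  exists (\bigcup_n G n), (\bigcup_n N n); split.
  + by apply: FU => n; have [] := h n.
  + by apply: null_event_bigcup => n; have [] := h n.
  + move=> w w0 wN; split=> -[n _ nw]; exists n => //; have [_ _ /(_ w w0)] := h n;
    by case=> [wNn|]; [apply: wN; exists n|move=> h1 h2; auto].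
Qed.

(** Off [N], [N'] and the complement of [Om0], both [G] and [G'] coincide with [E]; so [G] is
    contained in the union of [G'], [N] and [N'] up to a set negligible under every [P x]. *)
Lemma agree_path_measure_le G G' N N' E :
  natural_sigma_algebra X G -> natural_sigma_algebra X G' ->
  null_event N -> null_event N' -> agree E G N -> agree E G' N' ->
  (path_measure G <= path_measure G')%E.
Proof.
move=> mG mG' nN nN' EG EG'; have [mU U0] := null_eventU nN nN'.
have mGU : natural_sigma_algebra X (G' `|` (N `|` N')).
  exact: (@measurableU _ (path_type X)).
apply: (@le_trans _ _ (path_measure (G' `|` (N `|` N')))); last first.
  apply: (le_trans (@measureU2 _ _ _ path_measure _ _ mG' mU)).
  by rewrite -[leRHS]adde0; apply: leeD => //; rewrite -U0.
rewrite !path_measureE; apply: ge0_le_integral => //.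
- exact: (measurable_law LF mG).
- exact: (measurable_law LF mGU).
move=> x _; have pm := path_sub_measurable LF.
have -> : P x G = P x (G `&` (G' `|` (N `|` N'))).
  rewrite -[in LHS](setIT G) -(setUv (G' `|` (N `|` N'))) setIUr measureU//.
  - rewrite [X in (_ + X)%E](_ : _ = 0%E) ?adde0//.
    apply: measure_negligible.
      by apply: measurableI; [exact: pm|apply: measurableC; exact: pm].
    apply: negligibleS (Om0_full x) => w [Gw /not_orP[G'w /not_orP[Nw N'w]]] w0.
    by have := EG w w0 Nw; have := EG' w w0 N'w; tauto.
  - by apply: measurableI; exact: pm.
  - by apply: measurableI; [exact: pm|apply: measurableC; exact: pm].
  - by rewrite setIACA setICr setI0.
by apply: le_measure; rewrite ?inE; [apply: measurableI| |exact: subIsetr]; exact: pm.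
Qed.

Definition aug_type := g_sigma_algebraType (augment (natural_sigma_algebra X)).
HB.instance Definition _ := Measurable.on aug_type.

Lemma path_sigma_algebra : sigma_algebra setT (natural_sigma_algebra X).
Proof. exact: smallest_sigma_algebra. Qed.

Lemma aug_measurableE : (measurable : set (set aug_type)) =
  augment (natural_sigma_algebra X).
Proof.
apply: sigma_algebra_id; apply: augment_sigma_algebra; exact: path_sigma_algebra.
Qed.

Lemma aug_measurable_agree E G N : natural_sigma_algebra X G -> null_event N ->
  agree E G N -> measurable (E : set aug_type).
Proof. by move=> nG nN EG; rewrite aug_measurableE; exists G, N. Qed.

(** A representative is picked by choice; by [agree_path_measure_le] the value does not depend on
    the pick. Sets outside the augmented sigma-algebra receive the default 0. *)
Definition aug_measure E : \bar R :=
  if pselect (augment (natural_sigma_algebra X) E) is left h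
  then path_measure (sval (cid h)) else 0%E.

Lemma aug_measure_agree E G N : natural_sigma_algebra X G -> null_event N ->
  agree E G N -> aug_measure E = path_measure G.
Proof.
move=> mG nN EG; rewrite /aug_measure; case: pselect => [h|]; last first.
  by move=> h; exfalso; apply: h; exists G, N.
case: cid => G' [N' [mG' nN' EG']] /=; apply/eqP; rewrite eq_le.
by rewrite (agree_path_measure_le mG' mG nN' nN EG' EG)
  (agree_path_measure_le mG mG' nN nN' EG EG').
Qed.

Lemma aug_measure_path G : natural_sigma_algebra X G ->
  aug_measure G = path_measure G.
Proof. by move=> mG; apply: (aug_measure_agree mG null_event0). Qed.

Let aug_measure0 : aug_measure set0 = 0%E.
Proof.
by rewrite aug_measure_path ?measure0//; exact: (@measurable0 _ (path_type X)).
Qed.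

Let aug_measure_ge0 E : (0 <= aug_measure E)%E.
Proof. by rewrite /aug_measure; case: pselect => // ?; exact: measure_ge0. Qed.

Let aug_measure_sigma_additive :
  semi_sigma_additive (aug_measure : set aug_type -> \bar R).
Proof.
move=> F mF tF _; have : forall n, augment (natural_sigma_algebra X) (F n).
  by move=> n; rewrite -aug_measurableE.
move=> /choice [G] /choice [N] h.
pose M := \bigcup_n N n.
have nM : null_event M by apply: null_event_bigcup => n; have [] := h n.
have mG n : measurable (G n : set (path_type X)) by have [] := h n.
(* The sets [F n] are disjoint but their representatives only up to null sets; [seqDU] makes these
   disjoint at the cost of the null event [M]. *)
have mD n : measurable (seqDU G n : set (path_type X)).
  apply: measurableD => //; exact: bigsetU_measurable.
have FG n w : Om0 w -> ~ M w -> (F n w <-> G n w).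
  move=> w0 Mw; have [_ _] := h n; apply => // Nw; apply: Mw; exists n => //.
have FD n : agree (F n) (seqDU G n) M.
  move=> w w0 Mw; rewrite /seqDU; split.
    move=> Fw; split; first exact/(FG _ _ w0 Mw).
    rewrite -bigcup_mkord => -[k /= kn] /(FG _ _ w0 Mw) Fkw.
    by move: kn; rewrite (tF k n Logic.I Logic.I) ?ltnn//; exists w.
  by move=> [Gw _]; exact/(FG _ _ w0 Mw).
have FU : agree (\bigcup_n F n) (\bigcup_n seqDU G n) M.
  by move=> w w0 Mw; split => -[n _ nw]; exists n => //; exact/(FD n w w0 Mw).
have mU : measurable (\bigcup_n seqDU G n : set (path_type X)).
  exact: bigcupT_measurable.
rewrite (aug_measure_agree mU nM FU).
rewrite (_ : (fun _ => _) = (fun n => \sum_(0 <= i < n) path_measure (seqDU G i))%E).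
  by apply: measure_semi_sigma_additive => //; exact: trivIset_seqDU.
by apply/funext => n; apply: eq_bigr => i _; exact: (aug_measure_agree (mD i) nM).
Qed.

Lemma aug_measure_exists : exists Q : {measure set aug_type -> \bar R},
  forall E G N, natural_sigma_algebra X G -> null_event N -> agree E G N ->
    Q E = path_measure G.
Proof.
pose mm := isMeasure.Build _ aug_type R aug_measure
  aug_measure0 aug_measure_ge0 aug_measure_sigma_additive.
pose Q : {measure set aug_type -> \bar R} := HB.pack aug_measure mm.
by exists Q => E G N; exact: aug_measure_agree.
Qed.

End augmentation.

(** * Integrals against mixtures, and lower integrals off null sets *)

Section mixture_integral.
Context d d1 {T : measurableType d} {T1 : measurableType d1} {R : realType}.
Variables (mu : {measure set T1 -> \bar R}) (k : T1 -> {measure set T -> \bar R}).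
Variable m : {measure set T -> \bar R}.
Variable D : set T1.
Hypothesis mD : measurable D.
Hypothesis mk : forall G, measurable G -> measurable_fun D (fun x => k x G).
Hypothesis mE : forall G, measurable G -> m G = (\int[mu]_(x in D) k x G)%E.

Import HBNNSimple.

Let integral_simple (n : {measure set T -> \bar R}) (g : {nnsfun T >-> R}) :
  (\int[n]_w (g w)%:E = \sum_(r \in range g) r%:E * n (g @^-1` [set r]))%E.
Proof. by rewrite integralT_nnsfun sintegralE. Qed.

Let measurable_integral_simple (g : {nnsfun T >-> R}) :
  measurable_fun D (fun x => \int[k x]_w (g w)%:E)%E.
Proof.
under eq_fun do rewrite integral_simple.
apply: emeasurable_fsum => // r.
by apply: measurable_funeM; apply: mk; exact: measurable_sfunP.
Qed.

Let mixture_simple (g : {nnsfun T >-> R}) :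
  (\int[m]_w (g w)%:E = \int[mu]_(x in D) \int[k x]_w (g w)%:E)%E.
Proof.
under [RHS]eq_integral do rewrite integral_simple.
rewrite ge0_integral_fsum//; last 2 first.
- by move=> r; apply: measurable_funeM; apply: mk; exact: measurable_sfunP.
- by move=> r x _; exact: nnsfun_mulemu_ge0.
rewrite integral_simple; apply: eq_fsbigr => r /set_mem[w _ <-].
rewrite ge0_integralZl//.
- by rewrite mE//; exact: measurable_sfunP.
- by apply: mk; exact: measurable_sfunP.
- by rewrite lee_fin.
Qed.

Lemma integral_mixture (f : T -> \bar R) : measurable_fun setT f ->
  (forall w, 0 <= f w)%E ->
  (\int[m]_w f w = \int[mu]_(x in D) \int[k x]_w f w)%E.
Proof.
move=> mf f0; pose g := nnsfun_approx measurableT mf.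
have mg n : measurable_fun setT (EFin \o g n) by exact/measurable_EFinP.
have g0 n w : (0 <= (g n w)%:E)%E by rewrite lee_fin.
have ndg w : {homo (fun n => (g n w)%:E) : a b / (a <= b)%N >-> (a <= b)%E}.
  by move=> a b ab; rewrite lee_fin; exact/lefP/nd_nnsfun_approx.
have gf w : f w = limn (fun n => (g n w)%:E).
  by apply/esym/cvg_lim => //; exact: cvg_nnsfun_approx.
have lim_int (n : {measure set T -> \bar R}) :
    (\int[n]_w f w = limn (fun i => \int[n]_w (g i w)%:E))%E.
  under eq_integral do rewrite gf.
  by rewrite monotone_convergence.
rewrite lim_int; under [in RHS]eq_integral do rewrite lim_int.
rewrite monotone_convergence//.
- by apply: congr_lim; apply/funext => n; exact: mixture_simple.
- by move=> n x _; exact: integral_ge0.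
- move=> x _ a b ab; apply: ge0_le_integral => //.
  + exact: mg.
  + exact: mg.
  + by move=> w _; rewrite lee_fin; exact/lefP/nd_nnsfun_approx.
Qed.

Lemma measurable_integral_mixture (f : T -> \bar R) : measurable_fun setT f ->
  (forall w, 0 <= f w)%E ->
  measurable_fun D (fun x => \int[k x]_w f w)%E.
Proof.
move=> mf f0; pose g := nnsfun_approx measurableT mf.
apply: (emeasurable_fun_cvg (fun n x => \int[k x]_w (g n w)%:E)%E).
  by move=> n; exact: measurable_integral_simple.
move=> x _.
rewrite (eq_integral (fun w => limn (fun n => (g n w)%:E))); last first.
  by move=> w _; apply/esym/cvg_lim => //; exact: cvg_nnsfun_approx.
apply: cvg_monotone_convergence => //.
- by move=> n; exact/measurable_EFinP.
- by move=> n w _; rewrite lee_fin.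
- by move=> w _ a b ab; rewrite lee_fin; exact/lefP/nd_nnsfun_approx.
Qed.

End mixture_integral.

Section integral_ae.
Context d {T : measurableType d} {R : realType}.

Import HBNNSimple.

(* No measurability is required of [f]: the integral of a nonnegative function
   is a lower integral, which is blind to null sets. *)
Lemma ge0_integral_off_null (mu : {measure set T -> \bar R}) (D N : set T)
    (f g : T -> \bar R) :
  measurable N -> mu N = 0%E -> measurable_fun setT g ->
  (forall w, D w -> 0 <= f w)%E -> (forall w, 0 <= g w)%E ->
  (forall w, ~ N w -> D w /\ f w = g w) ->
  (\int[mu]_(w in D) f w = \int[mu]_w g w)%E.
Proof.
move=> mN N0 mg f0 g0 fg; rewrite integral_mkcond.
have fD0 w : (0 <= (f \_ D) w)%E.
  by rewrite patchE; case: ifPn => // /set_mem; exact: f0.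
have fgN w : ~ N w -> (f \_ D) w = g w.
  by move=> /fg[Dw <-]; rewrite patchE mem_set.
apply/eqP; rewrite eq_le; apply/andP; split.
  rewrite (ge0_integralTE _ fD0); apply: ub_ereal_sup => _ [h /= hf <-].
  rewrite -integralT_nnsfun.
  have mh : measurable_fun setT (EFin \o h) by exact/measurable_EFinP.
  rewrite (ge0_negligible_integral mN)//; last by move=> w _; rewrite lee_fin.
  rewrite [leRHS](ge0_negligible_integral mN)//.
  apply: ge0_le_integral => //.
  - exact: measurableD.
  - by move=> w _; rewrite lee_fin.
  - exact: measurable_funTS.
  - exact: measurable_funTS.
  - by move=> w [_ /= Nw]; rewrite -fgN.
(* Cutting [g] to 0 on [N] places every simple function below it under [f] restricted to [D], at all
   points and not merely off [N]. *)
have -> : (\int[mu]_w g w = \int[mu]_w (g \_ (~` N)) w)%E.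
  by rewrite (ge0_negligible_integral mN)// -integral_mkcond setTD.
rewrite ge0_integralTE; last first.
  by move=> w; rewrite patchE; case: ifPn.
rewrite (ge0_integralTE _ fD0); apply: le_ereal_sup => _ [h /= hg <-].
exists h => // w; apply: (le_trans (hg w)); rewrite patchE.
by case: ifPn => // /set_mem /= /fgN ->.
Qed.

End integral_ae.

Section rationals.
Context {R : realType}.
Local Open Scope ereal_scope.

Lemma ereal_rat_between (y z : \bar R) : 0 <= y -> y < z ->
  exists2 q : rat, y < (ratr q)%:E & (ratr q)%:E < z.
Proof.
case: y => [y| |]//= y0; last by rewrite ltNge leey.
case: z => [z| |]//.
  rewrite lte_fin => /rat_in_itvoo[q]; rewrite inE/= => /andP[yq qz].
  by exists q; rewrite lte_fin.
move=> _; have /rat_in_itvoo[q] : (y < y + 1)%R by rewrite ltrDl.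
by rewrite inE/= => /andP[yq qz]; exists q; rewrite ?lte_fin// ltry.
Qed.

End rationals.

(** * Shift invariance of the stationary measure *)

Section stationary.
Context d {Omega : measurableType d} {R : realType}.
Variables (P : R -> probability Omega R) (X : R -> Omega -> R).
Hypothesis LF : levy_family P X.
Variable theta : R -> Omega -> Omega.
Hypothesis shiftX : shift_operators X theta.
Variable Om0 : set Omega.
Hypothesis Om0_shift : forall t w, 0 < t -> Om0 w -> Om0 (theta t w).
Implicit Types (E G N H : set Omega).

Local Notation lam := (path_measure LF).
Local Notation augT := (aug_type LF Om0).

Variable Q : {measure set augT -> \bar R}.
Hypothesis QE : forall E G N, natural_sigma_algebra X G ->
  null_event LF N -> agree Om0 E G N -> Q E = lam G.

Lemma path_aug G : natural_sigma_algebra X G -> measurable (G : set augT).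
Proof. by move=> nG; apply: (aug_measurable_agree nG (null_event0 LF)). Qed.

Lemma Q_path G : natural_sigma_algebra X G -> Q G = lam G.
Proof. by move=> nG; apply: (QE nG (null_event0 LF)). Qed.

Lemma measurable_agree E E' : (forall w, Om0 w -> (E w <-> E' w)) ->
  measurable (E : set augT) -> measurable (E' : set augT).
Proof.
move=> EE'; rewrite aug_measurableE => -[G [N [nG nN EG]]]; exists G, N.
by split => // w w0 Nw; rewrite -EE'//; exact: EG.
Qed.

Lemma measurable_Om0 : measurable (Om0 : set augT).
Proof. by apply: (@measurable_agree setT) => // w w0; split. Qed.

Lemma Q_Om0C : Q (~` Om0) = 0%E.
Proof.
rewrite (@QE _ set0 set0) ?measure0//.
- exact: (@measurable0 _ (path_type X)).
- exact: null_event0.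
Qed.

Lemma measurable_aug_path d' (T : measurableType d') (f : Omega -> T) :
  measurable_fun setT (f : path_type X -> T) ->
  measurable_fun setT (f : augT -> T).
Proof.
move=> mf _ B mB; have := mf measurableT B mB; rewrite !setTI.
exact: path_aug.
Qed.

Lemma theta_agree t E G N : 0 < t -> agree Om0 E G N ->
  agree Om0 (theta t @^-1` E) (theta t @^-1` G) (theta t @^-1` N).
Proof. by move=> t0 EG w w0 Nw; apply: EG => //; exact: Om0_shift. Qed.

Lemma theta_null t N : 0 < t -> null_event LF N ->
  null_event LF (theta t @^-1` N).
Proof.
move=> t0 [nN N0]; split; first exact: (theta_path shiftX (ltW t0)).
by rewrite path_measureE (invariant_theta LF shiftX (ltW t0))// -(path_measureE LF).
Qed.

Lemma measurable_theta_aug t : 0 < t ->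
  measurable_fun setT (theta t : augT -> augT).
Proof.
move=> t0 _ B; rewrite setTI aug_measurableE => -[G [N [nG nN BG]]].
exists (theta t @^-1` G), (theta t @^-1` N); split.
- exact: (theta_path shiftX (ltW t0)).
- exact: theta_null.
- exact: theta_agree.
Qed.

Lemma Q_theta t E : 0 < t -> measurable (E : set augT) ->
  Q (theta t @^-1` E) = Q E.
Proof.
move=> t0; rewrite aug_measurableE => -[G [N [nG nN EG]]].
rewrite (QE nG nN EG) (QE (theta_path shiftX (ltW t0) nG) (theta_null t0 nN)).
  by rewrite !path_measureE (invariant_theta LF shiftX (ltW t0)).
exact: theta_agree.
Qed.

Lemma integral_theta t (f : augT -> \bar R) : 0 < t -> measurable_fun setT f ->
  (forall w, 0 <= f w)%E ->
  (\int[Q]_w f (theta t w) = \int[Q]_w f w)%E.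
Proof.
move=> t0 mf f0; have mth := measurable_theta_aug t0.
pose thm := isMeasurableFun.Build _ _ _ _ _ mth.
pose theta' : {mfun augT >-> augT} := HB.pack (theta t : augT -> augT) thm.
pose m' : {measure set augT -> \bar R} := pushforward Q theta'.
pose m := m' mth.
transitivity (\int[m]_w f w)%E; first by
  rewrite (@ge0_integral_pushforward _ _ _ _ _ theta' mth Q setT f).
by apply: eq_measure_integral => E mE _; exact: Q_theta.
Qed.

Lemma Q_X t (B : set R) : 0 <= t -> measurable B ->
  Q (X t @^-1` B) = lebesgue_measure B.
Proof.
move=> t0 mB; have nB : natural_sigma_algebra X (X t @^-1` B).
  by apply: sub_sigma_algebra; exists t, B.
rewrite Q_path// path_measureE.
have mi : measurable_fun setT (EFin \o (\1_B : R -> R)).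
  exact/measurable_EFinP/measurable_indic.
have := lebesgue_invariant LF t0 mi; rewrite /= integral_indic// setIT => <-; last first.
  by move=> y; rewrite lee_fin indicE.
apply: eq_integral => x _.
under eq_integral => w _ do rewrite -[\1_B _]/(\1_(X t @^-1` B) w).
by rewrite integral_indic ?setIT//; exact: (path_sub_measurable LF nB).
Qed.

(** Each event of [f] exceeding a rational has a path event as representative, and countably many
    exceptional sets form one null event. The version is the supremum of the rationals over the
    representatives that contain the path. *)
Lemma path_version (f : augT -> \bar R) : measurable_fun setT f ->
  (forall w, 0 <= f w)%E ->
  exists (g : Omega -> \bar R) N, [/\ measurable_fun setT (g : path_type X -> \bar R),
    null_event LF N, forall w, (0 <= g w)%E &
    forall w, Om0 w -> ~ N w -> f w = g w].
Proof.
move=> mf f0; pose r n : R := ratr (odflt 0 (unpickle n : option rat)).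
have : forall n, augment LF Om0 (natural_sigma_algebra X) [set w | ((r n)%:E < f w)%E].
  move=> n; rewrite -aug_measurableE.
  rewrite (_ : [set _ | _] = f @^-1` `](r n)%:E, +oo[); last first.
    by apply/seteqP; split => w /=; rewrite in_itv/= andbT.
  by rewrite -[X in measurable X]setTI; apply: mf => //; exact: emeasurable_itv.
move=> /choice[G] /choice[N] h.
(* The enumeration gives 0 at integers that code no rational; negative rationals are raised to 0,
   which is harmless since [f] is non-negative. *)
pose g_ n (w : Omega) : \bar R := (Num.max 0 (r n) * \1_(G n) w)%:E.
exists (fun w => esups (g_ ^~ w) 0%N), (\bigcup_n N n); split.
- apply: (@measurable_fun_esups _ (path_type X)) => n.
  apply/measurable_EFinP; apply: measurable_funM; first exact: measurable_cst.
  by have [nG _ _] := h n; exact: (@measurable_indic _ (path_type X)).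
- by apply: null_event_bigcup => n; have [] := h n.
- move=> w; apply: (@le_trans _ _ (g_ 0%N w)).
    by rewrite lee_fin mulr_ge0// ?le_max ?lexx// indicE.
  by apply: ereal_sup_ubound; exists 0%N.
- move=> w w0 Nw; have GE n : G n w <-> ((r n)%:E < f w)%E.
    have [_ _ /(_ w w0) a] := h n; apply: iff_sym; apply: a => ?; apply: Nw.
    by exists n.
  apply/eqP; rewrite eq_le; apply/andP; split; last first.
    apply: ub_ereal_sup => _ [n _ <-]; rewrite /g_ indicE.
    have [/set_mem /GE /ltW rf|_] := boolP (w \in G n); last by rewrite mulr0.
    by rewrite mulr1; case: (leP 0 (r n)) => r0; rewrite ?max_r ?max_l// ltW.
  rewrite leNgt; apply/negP => sf.
  have s0 : (0 <= esups (g_ ^~ w) 0%N)%E.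
    apply: (@le_trans _ _ (g_ 0%N w)); last by apply: ereal_sup_ubound; exists 0%N.
    by rewrite lee_fin mulr_ge0// ?le_max ?lexx// indicE.
  have [q sq qf] : exists2 q : rat, (esups (g_ ^~ w) 0%N < (ratr q)%:E)%E & ((ratr q)%:E < f w)%E.
    exact: ereal_rat_between.
  pose n := pickle q; have rn : r n = ratr q by rewrite /r/n pickleK.
  have : (g_ n w <= esups (g_ ^~ w) 0%N)%E by apply: ereal_sup_ubound; exists n.
  apply/negP; rewrite -ltNge /g_ rn indicE mem_set; last by apply/GE; rewrite rn.
  by rewrite mulr1 max_r// -lee_fin; apply: (le_trans s0); exact: ltW.
Qed.

Lemma natural_integral (g : Omega -> \bar R) :
  measurable_fun setT (g : path_type X -> \bar R) -> (forall w, 0 <= g w)%E ->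
  (\int[lebesgue_measure]_x \int[P x]_w g w = \int[Q]_w g w)%E.
Proof.
move=> mg g0.
have mid : measurable_fun setT (id : Omega -> path_type X).
  by apply: (measurable_path LF); exact: (@measurable_id _ (path_type X)).
pose idm := isMeasurableFun.Build _ _ _ _ _ mid.
pose id' : {mfun Omega >-> path_type X} := HB.pack (id : Omega -> path_type X) idm.
have midQ : measurable_fun setT (id : augT -> path_type X).
  by apply: measurable_aug_path; exact: (@measurable_id _ (path_type X)).
pose idQm := isMeasurableFun.Build _ _ _ _ _ midQ.
pose idQ : {mfun augT >-> path_type X} := HB.pack (id : augT -> path_type X) idQm.
pose m' : {measure set (path_type X) -> \bar R} := pushforward Q idQ.
pose m := m' midQ.
transitivity (\int[lebesgue_measure]_x \int[distribution (P x) id']_w g w)%E.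
  by apply: eq_integral => x _; rewrite ge0_integral_distribution.
transitivity (\int[m]_w g w)%E; last by rewrite ge0_integral_pushforward.
rewrite (@integral_mixture _ _ (path_type X) (measurableTypeR R) R lebesgue_measure
  (fun x => distribution (P x) id') m setT measurableT)//.
- by move=> G mG; exact: (measurable_law LF mG).
- by move=> G mG; rewrite -[LHS]/(Q G) Q_path// path_measureE.
Qed.

End stationary.

(** * Transfer of integrals to the stationary measure; conditional lower bounds *)

Section conditional_lower_bound.
Context d {Omega : measurableType d} {R : realType}.
Variables (P : R -> probability Omega R) (X : R -> Omega -> R).
Hypothesis LF : levy_family P X.
Variable theta : R -> Omega -> Omega.
Hypothesis shiftX : shift_operators X theta.
Variable Om0 : set Omega.
Hypothesis Om0_full : forall x, (P x).-negligible (~` Om0).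
Hypothesis Om0_shift : forall t w, 0 < t -> Om0 w -> Om0 (theta t w).
Implicit Types (E G N H : set Omega).

Local Notation lam := (path_measure LF).
Local Notation augT := (aug_type LF Om0).

Variable Q : {measure set augT -> \bar R}.
Hypothesis QE : forall E G N, natural_sigma_algebra X G ->
  null_event LF N -> agree Om0 E G N -> Q E = lam G.

Let mX t : 0 <= t -> measurable_fun setT (X t).
Proof. exact: (levy_measurable (levy_family_process LF 0)). Qed.

Lemma null_event_ae N : null_event LF N ->
  exists D : set R, [/\ measurable D, lebesgue_measure D = 0%E &
    forall x, ~ D x -> P x N = 0%E].
Proof.
move=> [nN]; rewrite path_measureE => N0.
have mN := measurable_law LF nN.
have [+ _] := @ae_eq_integral_abs _ (measurableTypeR R) _ lebesgue_measure setT measurableT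
  (fun x => P x N) mN.
have -> : (\int[lebesgue_measure]_x `|P x N| = 0)%E.
  by rewrite -[RHS]N0; apply: eq_integral => x _; rewrite gee0_abs.
move=> /(_ erefl) [D [mD D0 h]].
exists D; split => // x /(subsetC h) /= /contrapT; exact.
Qed.

Lemma measurable_path_integral (g : Omega -> \bar R) :
  measurable_fun setT (g : path_type X -> \bar R) -> (forall w, 0 <= g w)%E ->
  measurable_fun setT (fun x : R => \int[P x]_w g w)%E.
Proof.
move=> mg g0.
have mid : measurable_fun setT (id : Omega -> path_type X).
  by apply: (measurable_path LF); exact: (@measurable_id _ (path_type X)).
pose idm := isMeasurableFun.Build _ _ _ _ _ mid.
pose id' : {mfun Omega >-> path_type X} := HB.pack (id : Omega -> path_type X) idm.
rewrite (_ : (fun _ => _) = (fun x => \int[distribution (P x) id']_w g w)%E).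
  apply: measurable_integral_mixture => // G mG; exact: (measurable_law LF mG).
by apply/funext => x; rewrite ge0_integral_distribution.
Qed.

(** Links the iterated lower integrals of [revuz_approx] to [Q]. A path version of [f] equals [f']
    off a set that is null under [P x] for almost every [x]; [ge0_integral_off_null] is then applied
    under [Q], under Lebesgue measure and under each such [P x]. *)
Lemma integral_transfer (OmegaA : set Omega) (f' : Omega -> \bar R)
    (f : augT -> \bar R) :
  measurable_fun setT f -> (forall w, 0 <= f w)%E -> Om0 `<=` OmegaA ->
  (forall w, Om0 w -> f' w = f w) -> (forall w, OmegaA w -> 0 <= f' w)%E ->
  (\int[lebesgue_measure]_(x in [set: R]) \int[P x]_(w in OmegaA) f' w =
   \int[Q]_w f w)%E.
Proof.
move=> mf f0 sub f'f f'0.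
have [g [N [mg nN g0 fg]]] := path_version mf f0.
have [D [mD D0 DN]] := null_event_ae nN.
transitivity (\int[Q]_w g w)%E; last first.
  apply/esym; apply: (@ge0_integral_off_null _ augT _ Q setT (N `|` ~` Om0)).
  - apply: measurableU; first by apply: path_aug; have [] := nN.
    by apply: measurableC; exact: measurable_Om0.
  - apply/eqP; rewrite -measure_le0; apply: (le_trans (measureU2 _ _ _)).
    + by apply: path_aug; have [] := nN.
    + by apply: measurableC; exact: measurable_Om0.
    rewrite -[leRHS]adde0; apply: leeD; last by rewrite -(Q_Om0C QE).
    by have [nN' N0] := nN; rewrite -N0 -(Q_path QE).
  - exact: measurable_aug_path.
  - by move=> w _; exact: f0.
  - exact: g0.
  - by move=> w /not_orP[Nw /contrapT w0]; split => //; exact: fg.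
rewrite -(natural_integral QE mg g0).
apply: (@ge0_integral_off_null _ (measurableTypeR R) _ lebesgue_measure setT D) => //.
- exact: measurable_path_integral.
- by move=> x _; apply: integral_ge0 => w; exact: f'0.
- by move=> x; apply: integral_ge0 => w _; exact: g0.
move=> x Dx; split => //.
have [M [mM M0 OM]] := Om0_full x.
have mN : measurable (N : set Omega).
  by apply: (path_sub_measurable LF); have [] := nN.
apply: (@ge0_integral_off_null _ Omega _ (P x) OmegaA (N `|` M)) => //.
- exact: measurableU.
- apply/eqP; rewrite -measure_le0; apply: (le_trans (measureU2 _ _ _)) => //.
  by rewrite -[leRHS]adde0; apply: leeD; [rewrite -(DN _ Dx)|rewrite -M0].
- exact: (measurable_path LF mg).
- move=> w /not_orP[Nw Mw]; have w0 : Om0 w.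
    by apply: contrapT => /OM.
  by split; [exact: sub|rewrite f'f// fg].
Qed.

(* The lower bound on the conditional probability of H is only required for
   almost every value of X_t, because the law of X_t under Q is the Lebesgue
   measure. *)
Lemma markov_lower_bound (t c : R) (K : set R) H E : 0 < t -> 0 <= c ->
  measurable K -> measurable (H : set augT) ->
  (exists G N, [/\ natural_sigma_algebra X G, null_event LF N, agree Om0 H G N &
     forall y, K y -> P y N = 0%E -> (c%:E <= P y G)%E]) ->
  augment LF Om0 (natural_filtration X t) E ->
  (c%:E * Q (E `&` X t @^-1` K) <= Q (E `&` theta t @^-1` H))%E.
Proof.
move=> t0 c0 mK mH [G [N [nG nN HG cG]]] [E' [N1 [FE' nN1 EE']]].
have [D [mD D0 DN]] := null_event_ae nN.
have nE' := past_sub_path FE'.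
have nXK B : measurable B -> natural_sigma_algebra X (X t @^-1` B).
  by move=> mB; apply: sub_sigma_algebra; exists t, B; rewrite (ltW t0).
have nth := theta_path shiftX (ltW t0) nG.
have -> : Q (E `&` theta t @^-1` H) = lam (E' `&` theta t @^-1` G).
  apply: (@QE _ _ (N1 `|` theta t @^-1` N)).
  - exact: (@measurableI _ (path_type X)).
  - by apply: null_eventU => //; exact: theta_null.
  - move=> w w0 /not_orP[N1w Nw]; have := EE' w w0 N1w.
    by have := theta_agree Om0_shift t0 HG w0 Nw; rewrite /=; tauto.
have nI : natural_sigma_algebra X (E' `&` X t @^-1` (K `\` D)).
  apply: (@measurableI _ (path_type X)) => //; apply: nXK; exact: measurableD.
have -> : Q (E `&` X t @^-1` K) = lam (E' `&` X t @^-1` (K `\` D)).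
  apply: (@QE _ _ (N1 `|` X t @^-1` D)) => //.
  - apply: null_eventU => //; split; first exact: nXK.
    rewrite -(Q_path QE); last exact: nXK.
    by rewrite (Q_X QE (ltW t0)).
  - move=> w w0 /not_orP[N1w Dw]; have := EE' w w0 N1w.
    by move: Dw; rewrite /=; tauto.
rewrite !path_measureE.
rewrite -(@ge0_integralZl _ (measurableTypeR R) _ lebesgue_measure setT measurableT _
  (measurable_law LF nI))//.
apply: ge0_le_integral => //.
- by move=> x _; apply: mule_ge0.
- by apply: measurable_funeM; exact: (measurable_law LF nI).
- by apply: (measurable_law LF); exact: (@measurableI _ (path_type X)).
move=> x _; rewrite (markov LF shiftX)//; last exact: ltW.
have pm := path_sub_measurable LF.
have mI := pm _ nI.
have mPG B : measurable_fun B (fun w => P (X t w) G).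
  apply: measurable_funTS; apply: (measurableT_comp (measurable_law LF nG)).
  exact: (mX (ltW t0)).
rewrite -integral_cst//.
apply: (@le_trans _ _ (\int[P x]_(w in E' `&` X t @^-1` (K `\` D)) P (X t w) G)%E).
  apply: ge0_le_integral => //.
  move=> w [_ [Kw Dw]]; apply: cG => //; exact: DN.
apply: ge0_subset_integral => //.
exact: pm.
Qed.

End conditional_lower_bound.

Section markov_fun.
Context d {Omega : measurableType d} {R : realType}.
Variables (P : R -> probability Omega R) (X : R -> Omega -> R).
Hypothesis LF : levy_family P X.
Variable theta : R -> Omega -> Omega.
Hypothesis shiftX : shift_operators X theta.
Variable Om0 : set Omega.
Hypothesis Om0_shift : forall t w, 0 < t -> Om0 w -> Om0 (theta t w).
Implicit Types (E G N H : set Omega).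

Local Notation lam := (path_measure LF).
Local Notation augT := (aug_type LF Om0).

Variable Q : {measure set augT -> \bar R}.
Hypothesis QE : forall E G N, natural_sigma_algebra X G ->
  null_event LF N -> agree Om0 E G N -> Q E = lam G.

Definition past_aug_type t :=
  g_sigma_algebraType (augment LF Om0 (natural_filtration X t)).
HB.instance Definition _ t := Measurable.on (past_aug_type t).

Lemma past_aug_measurableE t : (measurable : set (set (past_aug_type t))) =
  augment LF Om0 (natural_filtration X t).
Proof.
apply: sigma_algebra_id; apply: augment_sigma_algebra.
exact: smallest_sigma_algebra.
Qed.

Lemma past_aug_aug t E : measurable (E : set (past_aug_type t)) ->
  measurable (E : set augT).
Proof.
rewrite past_aug_measurableE aug_measurableE => -[G [N [FG nN EG]]].
by exists G, N; split => //; exact: past_sub_path FG.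
Qed.

Lemma measurable_past_aug d' (T : measurableType d') t (f : Omega -> T) :
  measurable_fun setT (f : past_aug_type t -> T) ->
  measurable_fun setT (f : augT -> T).
Proof.
move=> mf _ B mB; have := mf measurableT B mB; rewrite !setTI.
exact: past_aug_aug.
Qed.

Lemma past_aug_mono s t E : s <= t -> measurable (E : set (past_aug_type s)) ->
  measurable (E : set (past_aug_type t)).
Proof.
move=> st; rewrite !past_aug_measurableE => -[G [N [FG nN EG]]].
by exists G, N; split => //; exact: past_sub_past FG.
Qed.

(** An inequality between two restrictions of [Q] on past events extends to past-measurable
    integrands once both restrictions are measures on the past sigma-algebra. Written as a mixture
    of Dirac masses, a restriction has its integrals given by [integral_mixture]. *)
Lemma restricted_measure_exists t (D : set augT) : measurable D ->
  exists m : {measure set (past_aug_type t) -> \bar R},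
    (forall E, measurable (E : set (past_aug_type t)) -> m E = Q (E `&` D)) /\
    (forall Z : Omega -> \bar R,
      measurable_fun setT (Z : past_aug_type t -> \bar R) ->
      (forall w, 0 <= Z w)%E ->
      (\int[m]_w Z w = \int[Q]_(w in D) Z w)%E).
Proof.
move=> mD; pose k (w : augT) : {measure set (past_aug_type t) -> \bar R} :=
  \d_(w : past_aug_type t).
have mk (G : set (past_aug_type t)) : measurable G -> measurable_fun D (fun w => k w G).
  move=> mG; apply: measurable_funTS.
  apply: (@eq_measurable_fun _ _ augT _ _ (fun w => (\1_G w)%:E)) => //.
  apply/measurable_EFinP; apply: measurable_indic; exact: past_aug_aug mG.
have [m mE] := @mixture_measure _ _ (past_aug_type t) augT R Q k D mD mk.
exists m; split.
  move=> E mE'; rewrite mE /mixture.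
  by rewrite -(integral_indic Q mD)//; exact: past_aug_aug mE'.
move=> Z mZ Z0.
rewrite (@integral_mixture _ _ (past_aug_type t) augT R Q k m D mD mk)//.
by apply: eq_integral => w _; rewrite integral_dirac// diracT mul1e.
Qed.

Lemma markov_lower_bound_fun (t c : R) (K : set R) H (Z : Omega -> \bar R) :
  0 < t -> 0 <= c -> measurable K -> measurable (H : set augT) ->
  (exists G N, [/\ natural_sigma_algebra X G, null_event LF N, agree Om0 H G N &
     forall y, K y -> P y N = 0%E -> (c%:E <= P y G)%E]) ->
  measurable_fun setT (Z : past_aug_type t -> \bar R) ->
  (forall w, 0 <= Z w)%E ->
  (c%:E * \int[Q]_(w in X t @^-1` K) Z w <=
   \int[Q]_(w in theta t @^-1` H) Z w)%E.
Proof.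
move=> t0 c0 mK mH hH mZ Z0.
have mXK : measurable (X t @^-1` K : set augT).
  by apply: path_aug; apply: sub_sigma_algebra; exists t, K; rewrite (ltW t0).
have mtH : measurable (theta t @^-1` H : set augT).
  have mth := @measurable_theta_aug _ _ _ _ _ LF _ shiftX _ Om0_shift _ t0.
  by have := mth measurableT _ mH; rewrite setTI.
have [m1 [m1E <-//]] := restricted_measure_exists t mXK.
have [m2 [m2E <-//]] := restricted_measure_exists t mtH.
pose c' := NngNum c0.
rewrite -[c%:E]/(c'%:num%:E) -ge0_integral_mscale//.
apply: ge0_le_measure_integral => // E mE.
rewrite /= /mscale/= m1E// m2E//.
apply: (markov_lower_bound shiftX Om0_shift QE) => //.
by rewrite -past_aug_measurableE.
Qed.

End markov_fun.

(** * Increasing paths and their Stieltjes measures *)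

Section one_sided.
Context {R : realType}.
Implicit Types (f : R -> R) (u : R^nat).

(** The sequence may hit [t], a point that the filter [t^'+] excludes; there the value is the limit
    itself. *)
Lemma cvg_seq_right f (t : R) u : f @ t^'+ --> f t -> (forall n, t <= u n) ->
  u n @[n --> \oo] --> t -> f (u n) @[n --> \oo] --> f t.
Proof.
move=> ft tu ut; apply/cvgrPdist_lt => e e0.
move/cvgrPdist_lt : ft => /(_ _ e0) [r /= r0 h].
move/cvgrPdist_lt : ut => /(_ _ r0); apply: filterS => n unr.
have [<-|tn] := eqVneq t (u n); first by rewrite subrr normr0.
by apply: h => //=; rewrite lt_neqAle tn tu.
Qed.

Lemma cvg_seq_left f (t l : R) u : f @ t^'- --> l -> (forall n, u n < t) ->
  u n @[n --> \oo] --> t -> f (u n) @[n --> \oo] --> l.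
Proof. by move=> /cvg_at_leftP h ut utt; apply: h. Qed.

Lemma increasing_left_lim (a : R -> R) t : increasing_path a -> 0 < t ->
  a @ t^'- --> left_lim a t.
Proof.
move=> [nd _] t0; rewrite /left_lim.
suff : cvg (a @ t^'-) by [].
apply: nondecreasing_at_left_is_cvgr.
- near=> x => y z; rewrite !in_itv/= => /andP[xy _] /andP[xz _] yz.
  apply: nd; rewrite yz andbT; apply: le_trans (ltW xy); near: x.
  exact: nbhs_left_ge.
- near=> x; exists (a t) => _ /= [y + <-]; rewrite in_itv/= => /andP[xy yt].
  apply: nd; rewrite (ltW yt) andbT; apply: le_trans (ltW xy); near: x.
  exact: nbhs_left_ge.
Unshelve. all: by end_near. Qed.

Lemma left_lim_ge (a : R -> R) s t : increasing_path a -> 0 <= s < t ->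
  a s <= left_lim a t.
Proof.
move=> ia /andP[s0 st]; have t0 := le_lt_trans s0 st.
rewrite /left_lim; apply: limr_ge.
  by apply/cvg_ex; exists (left_lim a t); exact: increasing_left_lim.
near=> x; apply: (ia.1); rewrite s0/=; near: x.
exact: nbhs_left_ge.
Unshelve. all: by end_near. Qed.

End one_sided.

Section grid.
Context {R : realType}.
Implicit Types (h s : R).

(** For positive [h] and [s], the index of the right end of the grid cell containing [s]. Cells are
    open on the left and closed on the right, like the intervals whose Stieltjes measure is an
    increment. *)
Definition grid_index h s : nat := `|Num.ceil (s / h)|%N.

Lemma grid_indexP h s : 0 < h -> 0 < s ->
  exists k, grid_index h s = k.+1 /\ h * k%:R < s <= h * k.+1%:R.
Proof.
move=> h0 s0; have sh0 : 0 < s / h by rewrite divr_gt0.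
have := ceil_itv (s / h).
have : (0 < Num.ceil (s / h))%R by rewrite ceil_gt0.
rewrite /grid_index; case: (Num.ceil (s / h)) => [[|k]|k]// _.
rewrite intS addrAC subrr add0r -!pmulrn -intS => /andP[a b]; exists k; split => //.
by rewrite mulrC -ltr_pdivlMr// a mulrC -ler_pdivrMr.
Qed.

Lemma grid_index_eq h s k : 0 < h -> h * k%:R < s <= h * k.+1%:R ->
  grid_index h s = k.+1.
Proof.
move=> h0 /andP[ks sk]; rewrite /grid_index (@ceil_def _ _ k.+1)//.
rewrite intS addrAC subrr add0r -!pmulrn.
by rewrite ltr_pdivlMr// mulrC ks ler_pdivrMr// mulrC.
Qed.

Lemma grid_cvg (e s : R) : 0 < e -> 0 < s ->
  (e / n.+1%:R * (grid_index (e / n.+1%:R) s)%:R) @[n --> \oo] --> s.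
Proof.
move=> e0 s0; apply: (@squeeze_cvgr _ _ _ _ (fun=> s) (fun n => s + e / n.+1%:R)).
- near=> n; have : 0 < e / n.+1%:R by rewrite divr_gt0.
  move: (e / n.+1%:R) => h h0.
  have [k [-> /andP[a b]]] := grid_indexP h0 s0.
  rewrite b/= -natr1 mulrDr mulr1 lerD2r; exact: ltW.
- exact: cvg_cst.
- rewrite -[X in _ --> X]addr0; apply: cvgD; first exact: cvg_cst.
  rewrite -(mulr0 e); apply: cvgM; first exact: cvg_cst.
  exact: cvg_harmonic.
Unshelve. all: by end_near. Qed.

Lemma grid_cvg_left (e s : R) : 0 < e -> 0 < s ->
  (e / n.+1%:R * (grid_index (e / n.+1%:R) s).-1%:R) @[n --> \oo] --> s.
Proof.
move=> e0 s0; apply: (@squeeze_cvgr _ _ _ _ (fun n => s - e / n.+1%:R) (fun=> s)).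
- near=> n; have : 0 < e / n.+1%:R by rewrite divr_gt0.
  move: (e / n.+1%:R) => h h0.
  have [k [-> /andP[a b]]] := grid_indexP h0 s0 => /=.
  rewrite (ltW a) andbT lerBlDr; apply: (le_trans b).
  by rewrite -natr1 mulrDr mulr1.
- rewrite -[X in _ --> X]subr0; apply: cvgB; first exact: cvg_cst.
  rewrite -(mulr0 e); apply: cvgM; first exact: cvg_cst.
  exact: cvg_harmonic.
- exact: cvg_cst.
Unshelve. all: by end_near. Qed.

End grid.

Section stieltjes.
Context {R : realType}.
Implicit Types a : R -> R.

Lemma stieltjes_itv a (x y : R) : increasing_path a -> 0 <= x -> x <= y ->
  stieltjes a (`]x, y]%classic : set (measurableTypeR R)) = (a y - a x)%:E.
Proof.
move=> ia x0 xy.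
rewrite /stieltjes/= /lebesgue_stieltjes_measure/= /measure_extension/=.
rewrite measurable_mu_extE/=; last exact: is_ocitv.
rewrite wlength_itv_bnd// /path_cumulative asboolT//.
by rewrite !max_r// (le_trans x0).
Qed.

Lemma ocitv_measure_unique (m1 m2 : {measure set (measurableTypeR R) -> \bar R}) :
  (forall x y : R, x < y -> m1 `]x, y]%classic = m2 `]x, y]%classic) ->
  (forall x y : R, (m1 `]x, y]%classic < +oo)%E) ->
  forall B : set R, measurable B -> m1 B = m2 B.
Proof.
move=> m12 m1oo.
apply: (@measure_unique _ _ (measurableTypeR R) (@ocitv R)
  (fun n => `](- n%:R), n%:R]%classic)) => //.
- exact: ocitvI.
- by move=> n; exact: is_ocitv.
- apply/seteqP; split => // x _; exists (Num.truncn `|x|).+1 => //=.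
  rewrite in_itv/=; have := truncnS_gt `|x|.
  rewrite ltr_norml => /andP[-> /ltW]; exact.
- by move=> _ /ocitvP[->|[[x y] /= xy ->]]; rewrite ?measure0// m12.
Qed.

End stieltjes.

(** * The product of the stationary measure with dA *)

Section product.
Context d {Omega : measurableType d} {R : realType}.
Variables (P : R -> probability Omega R) (X : R -> Omega -> R).
Hypothesis LF : levy_family P X.
Variable Om0 : set Omega.
Hypothesis Om0_cadlag : forall w, Om0 w -> cadlag (X ^~ w).

Local Notation augT := (aug_type LF Om0).
Local Notation timeT := (measurableTypeR R).

Variable A : R -> Omega -> R.
Hypothesis Om0_A : forall w, Om0 w -> increasing_path (A ^~ w).
Hypothesis mA : forall t, 0 <= t ->
  measurable_fun setT (A t : past_aug_type LF Om0 t -> R).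

Let mOm0 : measurable (Om0 : set augT).
Proof. exact: measurable_Om0. Qed.

Let mA' t : 0 <= t -> measurable_fun setT (A t : augT -> R).
Proof. by move=> t0; apply: measurable_past_aug (mA t0). Qed.

(** By right-continuity [X s w] is the limit of the values at the right ends of the cells containing
    [s], and each approximation is constant in time on every cell. *)
Lemma measurable_joint_X :
  measurable_fun [set z : timeT * augT | 0 < z.1 /\ Om0 z.2]
    (fun z => X z.1 z.2).
Proof.
set D := [set z | _].
apply: (@measurable_fun_cvg _ _ _ D (fun n (z : timeT * augT) =>
  X (1 / n.+1%:R * (grid_index (1 / n.+1%:R) z.1)%:R) z.2)).
- move=> n mD B mB; have : (0 : R) < 1 / n.+1%:R by rewrite divr_gt0.
  move: (1 / n.+1%:R) => h h0.
  rewrite (_ : _ `&` _ = \bigcup_k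
    (`]h * k%:R, h * k.+1%:R]%classic `*` (Om0 `&` X (h * k.+1%:R) @^-1` B))).
    apply: bigcupT_measurable => k; apply: measurableX.
      exact: (measurable_itv `]h * k%:R, h * k.+1%:R]).
    apply: measurableI => //; apply: path_aug; apply: sub_sigma_algebra.
    by exists (h * k.+1%:R), B; rewrite mulr_ge0// ltW.
  apply/seteqP; split => -[s w] /=.
    move=> [[s0 w0]]; have [k [-> ks]] := grid_indexP h0 s0.
    by move=> Bs; exists k => //=; rewrite in_itv.
  move=> [k _ /= [+ [w0 Bk]]]; rewrite in_itv/= => ks.
  rewrite (grid_index_eq h0 ks); split => //; split => //.
  by case/andP: ks => + _; apply: le_lt_trans; rewrite mulr_ge0// ltW.
- move=> [s w] [/= s0 w0]; apply: (@cvg_seq_right _ (X ^~ w) s).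
  + by apply: (Om0_cadlag w0).1; exact: ltW.
  + move=> n; have h0 : (0 : R) < 1 / n.+1%:R by rewrite divr_gt0.
    by have [k [-> /andP[]]] := grid_indexP h0 s0.
  + exact: grid_cvg.
Qed.

Definition mass (t : R) (S : set R) (w : Omega) : \bar R :=
  lebesgue_stieltjes_measure (path_cumulative (A ^~ w)) (S `&` `]0, t] : set timeT).

Lemma massT (t : R) w : 0 <= t -> Om0 w ->
  mass t setT w = (A t w - A 0 w)%:E.
Proof. by move=> t0 w0; rewrite /mass setTI -/(stieltjes _) stieltjes_itv//; exact: Om0_A. Qed.

Section measurability.
Variable t : R.
Hypothesis t0 : 0 <= t.

(** Sections depending on [w] let the same closure properties serve two Dynkin arguments: for fixed
    Borel sets of times, then for measurable sets of times and paths. Complements rely on the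
    finiteness of [A t w]. *)
Let mble (S : Omega -> set R) :=
  (forall w, measurable (S w : set timeT)) /\
  measurable_fun (Om0 : set augT) (fun w => mass t (S w) w).

Let mbleT : mble (fun=> setT).
Proof.
split=> //; apply: (@eq_measurable_fun _ _ augT _ _ (fun w => (A t w - A 0 w)%:E)).
  by move=> w /set_mem w0; rewrite massT.
apply: measurable_funTS; apply/measurable_EFinP.
by apply: measurable_funB; exact: mA'.
Qed.

Let mbleC S : mble S -> mble (fun w => ~` S w).
Proof.
move=> [mS mfS]; split; first by move=> w; exact: measurableC.
apply: (@eq_measurable_fun _ _ augT _ _ (fun w => mass t setT w - mass t (S w) w)%E).
  move=> w /set_mem w0; rewrite /mass setTI.
  have <- : `]0%R, t] `\` (S w `&` `]0%R, t]) = ~` S w `&` `]0, t].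
    by rewrite setDIr setDv setU0 setDE setIC.
  have mI : measurable (S w `&` `]0, t] : set timeT) by exact: measurableI.
  rewrite measureD//; last first.
    have : (mass t setT w < +oo)%E by rewrite massT// ltry.
    by rewrite /mass setTI.
  have -> : `]0%R, t] `&` (S w `&` `]0%R, t]) = S w `&` `]0, t].
    by rewrite setICA setIid.
  by [].
by apply: emeasurable_funB => //; exact: mbleT.2.
Qed.

Let mbleU (S : nat -> Omega -> set R) : (forall n, mble (S n)) ->
  (forall w, trivIset setT (fun n => S n w)) ->
  mble (fun w => \bigcup_n S n w).
Proof.
move=> mS tS; split.
  by move=> w; apply: bigcupT_measurable => n; exact: (mS n).1.
rewrite (_ : (fun _ => _) = (fun w => \sum_(n <oo) mass t (S n w) w)%E).
  by apply: ge0_emeasurable_sum => // n _; exact: (mS n).2.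
apply/funext => w; rewrite /mass setI_bigcupl.
rewrite measure_bigcup//.
- by apply: eq_eseriesl => n; rewrite in_setT.
- by move=> n _; apply: measurableI => //; exact: (mS n).1.
- by apply: trivIset_setIr; exact: tS.
Qed.

Let mble_itv x y : mble (fun=> `]x, y]%classic).
Proof.
split; first by move=> w; exact: (measurable_itv `]x, y]).
have E : `]x, y] `&` `]0, t] = `]Num.max x 0, Num.min y t]%classic.
  apply/seteqP; split => s /=; rewrite !in_itv/= gt_max le_min.
    by move=> [/andP[-> ->] /andP[-> ->]].
  by move=> /andP[/andP[-> ->] /andP[-> ->]].
have [xy|xy] := leP (Num.max x 0) (Num.min y t); last first.
  apply: (@eq_measurable_fun _ _ augT _ _ (fun=> 0%E)) => // w _.
  by rewrite /mass E set_itv_ge ?measure0// bnd_simp -leNgt ltW.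
have m0 : 0 <= Num.max x 0 by rewrite le_max lexx orbT.
apply: (@eq_measurable_fun _ _ augT _ _ (fun w => (A (Num.min y t) w - A (Num.max x 0) w)%:E)).
  by move=> w /set_mem w0; rewrite /mass E -/(stieltjes _) stieltjes_itv//; exact: Om0_A.
apply: measurable_funTS; apply/measurable_EFinP.
by apply: measurable_funB; apply: mA' => //; exact: le_trans m0 xy.
Qed.

Let mble_borel (B : set timeT) : measurable B -> mble (fun=> B).
Proof.
apply: (@dynkin_induction _ timeT (@ocitv R) (fun B => mble (fun=> B))) => //.
- exact: ocitvI.
- move=> _ [[x y] _ <-]; exact: mble_itv.
- by move=> S _; exact: mbleC.
- by move=> F _ tF mF; exact: (@mbleU (fun n _ => F n)).
Qed.

Lemma measurable_mass (U : set (timeT * augT)) : measurable U ->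
  measurable_fun (Om0 : set augT) (fun w => mass t [set s | U (s, w)] w).
Proof.
rewrite measurable_prod_measurableType => mU.
suff [] : mble (fun w => [set s | U (s, w)]) by [].
apply: (@dynkin_induction _ (timeT * augT)%type
  [set B `*` E | B in measurable & E in measurable]
  (fun U => mble (fun w => [set s | U (s, w)]))) mU => //.
- exact: measurable_prod_measurableType.
- move=> _ _ [B mB [E mE <-]] [B' mB' [E' mE' <-]].
  exists (B `&` B'); first exact: measurableI.
  exists (E `&` E'); first exact: measurableI.
  by rewrite setXI.
- move=> _ [B mB [E mE <-]]; have [mB1 mB2] := mble_borel mB.
  split=> [w|].
    have [Ew|Ew] := pselect (E w).
      by rewrite (_ : [set _ | _] = B)//; apply/seteqP; split => s //= [].
    by rewrite (_ : [set _ | _] = set0)//; apply/seteqP; split => s //= [].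
  apply: (@eq_measurable_fun _ _ augT _ _ (fun w => (\1_E w)%:E * mass t B w)%E).
    move=> w _; rewrite indicE; have [/set_mem Ew|Ew] := boolP (w \in E).
      by rewrite mul1e; congr mass; apply/seteqP; split => s //= [].
    rewrite mul0e /mass (_ : [set _ | _] = set0) ?set0I ?measure0//.
    by apply/seteqP; split => s //= [_] /mem_set; rewrite (negbTE Ew).
  apply: emeasurable_funM => //.
  by apply: measurable_funTS; apply/measurable_EFinP; exact: measurable_indic.
- by move=> S _; exact: mbleC.
- move=> F _ tF mF.
  rewrite (_ : (fun w => _) = (fun w => \bigcup_n [set s | F n (s, w)])).
    apply: mbleU => // w; apply/trivIsetP => i j _ _ ij.
    apply/seteqP; split => // s [Fi Fj].
    have /seteqP[h _] := (trivIsetP.1 tF) i j Logic.I Logic.I ij.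
    exact: (h (s, w) (conj Fi Fj)).
  by apply/funext => w; apply/seteqP; split => s /= [n _ ?]; exists n.
Qed.

End measurability.

Variable Q : {measure set augT -> \bar R}.

(** On this measure [Q(dw) dA_s(w)], additivity of the Revuz measure in [B] and the final limit over
    grids both become properties of a single measure evaluated on sets of times and paths. *)
Lemma product_measure_exists (t : R) : 0 <= t ->
  exists M : {measure set (timeT * augT) -> \bar R}, forall U,
    M U = (\int[Q]_(w in Om0) mass t [set s | U (s, w)] w)%E.
Proof.
move=> t0.
have m0t : measurable (`]0, t]%classic : set timeT) by exact: (measurable_itv `]0, t]).
have mpair (w : augT) : measurable_fun setT (fun s : timeT => (s, w)).
  exact: measurable_pair2.
pose km (w : augT) := isMeasurableFun.Build _ _ _ _ _ (mpair w).
pose f (w : augT) : {mfun timeT >-> (timeT * augT)%type} :=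
  HB.pack (fun s : timeT => (s, w)) (km w).
pose k' (w : augT) : {measure set (timeT * augT) -> \bar R} :=
  pushforward (mrestr (stieltjes (A ^~ w)) m0t) (f w).
pose k := k' mpair.
have mk U : measurable U -> measurable_fun (Om0 : set augT) (fun w => k w U).
  exact: measurable_mass.
have [M ME] := @mixture_measure _ _ (timeT * augT)%type augT R Q k Om0 mOm0 mk.
by exists M => U; rewrite ME.
Qed.

End product.

(** * The Revuz measure *)

Section additive.
Context {R : realType}.
Local Open Scope ereal_scope.

(** Cauchy's equation with values up to infinity. Additivity and positivity give monotonicity, hence
    all values are finite or none is. In the finite case, enclosing [(k + 1) * t] between
    consecutive integers bounds [(k + 1) * |f t - t * f 1|] by [f 1] for every [k]. *)
Lemma additive_linear (f : R -> \bar R) :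
  (forall s t, (0 < s)%R -> (0 < t)%R -> f (s + t)%R = f s + f t) ->
  (forall t, 0 <= f t) -> forall t, (0 < t)%R -> f t = t%:E * f 1%R.
Proof.
move=> fD f0.
have fn t n : (0 < t)%R -> f (n.+1%:R * t)%R = n.+1%:R%:E * f t.
  move=> t0; elim: n => [|n IH]; first by rewrite mul1r mul1e.
  rewrite -[in LHS]natr1 mulrDl mul1r fD//; last by rewrite mulr_gt0.
  by rewrite IH -[in RHS]natr1 EFinD ge0_muleDl// ?mul1e// lee_fin.
have fle s t : (0 < s)%R -> (s <= t)%R -> f s <= f t.
  move=> s0; rewrite le_eqVlt => /predU1P[->//|st].
  by rewrite -(subrK s t) fD ?subr_gt0// leeDr.
have f1fin t : (0 < t)%R -> f t \is a fin_num <-> f 1%R \is a fin_num.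
  have H s u : (0 < s)%R -> (0 < u)%R -> f s \is a fin_num -> f u \is a fin_num.
    move=> s0 u0 fs; have := f0 u.
    rewrite ge0_fin_numE// => _.
    have [n un] : exists n : nat, (u <= n.+1%:R * s)%R.
      exists (Num.truncn (u / s)).
      by rewrite -ler_pdivrMr//; apply: ltW; exact: truncnS_gt.
    apply: (le_lt_trans (fle _ _ u0 un)); rewrite fn//.
    by rewrite lte_mul_pinfty// ?lee_fin// -ge0_fin_numE.
  by move=> t0; split; apply: H.
move=> t t0; have [ff|] := boolP (f 1%R \is a fin_num); last first.
  move=> ff; have : f t \isn't a fin_num by apply/negP => /(f1fin _ t0); apply/negP.
  move: ff; rewrite !ge0_fin_numE// !ltey !negbK => /eqP -> /eqP ->.
  by rewrite gt0_muley ?lte_fin.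
have ft := (f1fin _ t0).2 ff.
set a := fine (f 1%R); set b := fine (f t).
have fa : f 1%R = a%:E by rewrite fineK.
have fb : f t = b%:E by rewrite fineK.
rewrite fa fb -EFinM; congr EFin.
have a0 : (0 <= a)%R by rewrite -lee_fin -fa.
have b0 : (0 <= b)%R by rewrite -lee_fin -fb.
have E1 n : f n.+1%:R = (n.+1%:R * a)%:E by rewrite -[X in f X]mulr1 fn// fa.
have E2 n : f (n.+1%:R * t)%R = (n.+1%:R * b)%:E by rewrite fn// fb.
have key k : (`|k.+1%:R * (b - t * a)| <= a)%R.
  set m := Num.truncn (k.+1%:R * t).
  have /andP[m1 m2] : (m%:R <= k.+1%:R * t < m.+1%:R)%R.
    by apply: truncn_itv; rewrite mulr_ge0// ltW.
  have kt0 : (0 < k.+1%:R * t)%R by rewrite mulr_gt0.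
  have up : (k.+1%:R * b <= m.+1%:R * a)%R.
    by have := fle _ _ kt0 (ltW m2); rewrite E1 E2 lee_fin.
  have lo : (m%:R * a <= k.+1%:R * b)%R.
    move: m1; case: m {m2 up} => [|m] m1.
      by rewrite mul0r mulr_ge0.
    by have := fle m.+1%:R _ (ltr0Sn _ _) m1; rewrite E1 E2 lee_fin.
  rewrite ler_norml; apply/andP; split.
    have : (k.+1%:R * t * a <= m.+1%:R * a)%R by apply: ler_wpM2r => //; exact: ltW.
    rewrite -natr1; move: lo; lra.
  have : (m%:R * a <= k.+1%:R * t * a)%R by exact: ler_wpM2r.
  move: up; rewrite -natr1; lra.
apply/eqP; rewrite -subr_eq0; apply/negP => /negP n0.
have n1 : (0 < `|b - t * a|)%R by rewrite normr_gt0.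
have := key (Num.truncn (a / `|b - t * a|)%R).
apply/negP; rewrite -ltNge normrM normr_nat -ltr_pdivrMr//.
exact: truncnS_gt.
Qed.

End additive.

Section occupation.
Context d {Omega : measurableType d} {R : realType}.
Variables (P : R -> probability Omega R) (X : R -> Omega -> R).
Hypothesis LF : levy_family P X.
Variable theta : R -> Omega -> Omega.
Hypothesis shiftX : shift_operators X theta.
Variable Om0 : set Omega.
Hypothesis Om0_full : forall x, (P x).-negligible (~` Om0).
Hypothesis Om0_shift : forall t w, 0 < t -> Om0 w -> Om0 (theta t w).
Hypothesis Om0_cadlag : forall w, Om0 w -> cadlag (X ^~ w).

Local Notation lam := (path_measure LF).
Local Notation augT := (aug_type LF Om0).
Local Notation timeT := (measurableTypeR R).

Variable Q : {measure set augT -> \bar R}.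
Hypothesis QE : forall (E G N : set Omega), natural_sigma_algebra X G ->
  null_event LF N -> agree Om0 E G N -> Q E = lam G.

Variable A : R -> Omega -> R.
Hypothesis Om0_A : forall w, Om0 w -> increasing_path (A ^~ w).
Hypothesis mA : forall t, 0 <= t ->
  measurable_fun setT (A t : past_aug_type LF Om0 t -> R).
Hypothesis A0 : forall w, Om0 w -> A 0 w = 0.
Hypothesis A_add : forall w (s t : R), Om0 w -> 0 < s -> 0 < t ->
  A (s + t) w = A t w + A s (theta t w).

Let mOm0 : measurable (Om0 : set augT).
Proof. exact: measurable_Om0. Qed.

Definition visits (B : set R) w : set R := [set s | 0 < s /\ B (X s w)].

Definition visits_graph (B : set R) : set (timeT * augT) :=
  [set z | (0 < z.1 /\ Om0 z.2) /\ B (X z.1 z.2)].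

Lemma measurable_visits_graph B : measurable B -> measurable (visits_graph B).
Proof.
move=> mB; apply: (measurable_joint_X Om0_cadlag) => //.
rewrite (_ : [set _ | _] = `]0, +oo[%classic `*` Om0).
  by apply: measurableX => //; exact: (measurable_itv `]0, +oo[).
by apply/seteqP; split => -[s w] /=; rewrite in_itv/= andbT.
Qed.

Lemma visits_graphE B w : Om0 w -> [set s | visits_graph B (s, w)] = visits B w.
Proof.
by move=> w0; apply/seteqP; split => s /=; rewrite /visits_graph/visits/=; tauto.
Qed.

Lemma measurable_visits B w : measurable B -> Om0 w ->
  measurable (visits B w : set timeT).
Proof.
move=> mB w0; rewrite -visits_graphE//.
rewrite (_ : [set _ | _] = (pair^~ w) @^-1` (visits_graph B))//.
rewrite -[X in measurable X]setTI.
by apply: (@measurable_pair2 _ _ timeT augT w) => //; exact: measurable_visits_graph.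
Qed.

Definition occupation (B : set R) t w := mass A t (visits B w) w.

Lemma measurable_occupation B t : 0 <= t -> measurable B ->
  measurable_fun (Om0 : set augT) (occupation B t).
Proof.
move=> t0 mB.
apply: (@eq_measurable_fun _ _ augT _ _
  (fun w => mass A t [set s | visits_graph B (s, w)] w)).
  by move=> w /set_mem w0; rewrite visits_graphE.
by apply: (measurable_mass Om0_A mA t0); exact: measurable_visits_graph.
Qed.

Lemma occupation_ge0 B t w : (0 <= occupation B t w)%E.
Proof. exact: measure_ge0. Qed.

(** Additivity of [A] says that both measures give the same increments to half-open intervals, and
    these determine them. *)
Lemma mass_shift (s t : R) (S : set R) w : Om0 w -> 0 < s -> 0 < t ->
  measurable (S : set timeT) ->
  lebesgue_stieltjes_measure (path_cumulative (A ^~ w))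
    ([set u | S (u - t)] `&` `]t, t + s] : set timeT) =
  mass A s S (theta t w).
Proof.
move=> w0 s0 t0 mS.
have w1 : Om0 (theta t w) by exact: Om0_shift.
have mI (x y : R) : measurable (`]x, y]%classic : set timeT) by exact: (measurable_itv `]x, y]).
have mf : measurable_fun setT ((fun u => u - t) : timeT -> timeT).
  exact: (measurable_funB (@measurable_id _ R setT) (measurable_cst t)).
pose fm := isMeasurableFun.Build _ _ _ _ _ mf.
pose f : {mfun timeT >-> timeT} := HB.pack ((fun u => u - t) : timeT -> timeT) fm.
pose m1' : {measure set timeT -> \bar R} :=
  pushforward (mrestr (lebesgue_stieltjes_measure (path_cumulative (A ^~ w))) (mI t (t + s))) f.
pose m1 := m1' mf.
pose m2 : {measure set timeT -> \bar R} :=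
  mrestr (lebesgue_stieltjes_measure (path_cumulative (A ^~ (theta t w)))) (mI 0 s).
have E0 (x y : R) : `]x, y] `&` `]0, s] = `]Num.max x 0, Num.min y s]%classic.
  apply/seteqP; split => u /=; rewrite !in_itv/= gt_max le_min.
    by move=> [/andP[-> ->] /andP[-> ->]].
  by move=> /andP[/andP[-> ->] /andP[-> ->]].
have E1 (x y : R) : [set u | `]x, y]%classic (u - t)] `&` `]t, t + s] =
    `]t + Num.max x 0, t + Num.min y s]%classic.
  have L u : (t + Num.max x 0 < u) = (x < u - t) && (t < u).
    by rewrite -ltrBrDl gt_max subr_gt0.
  have U u : (u <= t + Num.min y s) = (u - t <= y) && (u <= t + s).
    by rewrite -lerBlDl le_min; congr andb; rewrite lerBlDl.
  apply/seteqP; split => u /=; rewrite !in_itv/= L U.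
    by move=> [/andP[-> ->] /andP[-> ->]].
  by move=> /andP[/andP[-> ->] /andP[-> ->]].
(* Additivity is given at positive times; [A0] supplies the case [u = 0], reached when an interval
   is cut at 0. *)
have At u : 0 <= u -> A (t + u) w = A t w + A u (theta t w).
  rewrite le_eqVlt => /predU1P[<-|u0]; first by rewrite A0// !addr0.
  by rewrite addrC A_add.
have m12 (x y : R) : m1 `]x, y]%classic = m2 `]x, y]%classic /\
    (m1 `]x, y]%classic < +oo)%E.
  have -> : m2 `]x, y]%classic = stieltjes (A ^~ (theta t w)) `]Num.max x 0, Num.min y s]%classic.
    by rewrite -E0.
  have -> : m1 `]x, y]%classic = stieltjes (A ^~ w) `]t + Num.max x 0, t + Num.min y s]%classic.
    by rewrite -E1.
  have [xy|xy] := leP (Num.max x 0) (Num.min y s); last first.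
    rewrite set_itv_ge; last by rewrite bnd_simp -leNgt ltW// ltrD2l.
    rewrite set_itv_ge; last by rewrite bnd_simp -leNgt ltW.
    by rewrite /stieltjes !measure0 ltry.
  have m0 : 0 <= Num.max x 0 by rewrite le_max lexx orbT.
  have m0' := le_trans m0 xy.
  rewrite (stieltjes_itv (Om0_A w0)) ?lerD2l ?addr_ge0 ?(ltW t0)//.
  rewrite (stieltjes_itv (Om0_A w1))//.
  by rewrite !At// ltry; split => //; congr EFin; ring.
have e2 : m2 S = mass A s S (theta t w) by rewrite /m2/mass.
have e1 : m1 S = lebesgue_stieltjes_measure (path_cumulative (A ^~ w))
    ([set u | S (u - t)] `&` `]t, t + s] : set timeT) by rewrite /m1/m1'.
rewrite -e2 -e1; apply: ocitv_measure_unique mS.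
- by move=> x y _; exact: (m12 x y).1.
- by move=> x y; exact: (m12 x y).2.
Qed.

Lemma occupation_add B s t w : measurable B -> Om0 w -> 0 < s -> 0 < t ->
  occupation B (s + t) w = (occupation B t w + occupation B s (theta t w))%E.
Proof.
move=> mB w0 s0 t0; rewrite /occupation.
have mV := measurable_visits mB w0.
have mV' := measurable_visits mB (Om0_shift t0 w0).
rewrite -(mass_shift w0 s0 t0 mV') /mass.
have mI (x y : R) : measurable (`]x, y]%classic : set timeT) by exact: (measurable_itv `]x, y]).
have -> : [set u | visits B (theta t w) (u - t)] `&` `]t, t + s] =
    visits B w `&` `]t, t + s].
  apply/seteqP; split => u /=; rewrite /visits/= in_itv/=.
    move=> [[ut]]; rewrite shiftX ?(ltW ut) ?(ltW t0)// subrK => Bu /andP[tu us].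
    by split; [split => //; exact: lt_trans tu|rewrite tu us].
  move=> [[u0 Bu] /andP[tu us]]; rewrite tu us subr_gt0 tu; split => //; split => //.
  by rewrite shiftX ?(ltW t0) ?subr_ge0 ?(ltW tu)// subrK.
rewrite -measureU//; last 3 first.
- exact: measurableI.
- exact: measurableI.
- rewrite setIACA setIid; apply/seteqP; split => // u [_ []] /=.
  by rewrite !in_itv/= => /andP[_ ut] /andP[tu _]; have := le_lt_trans ut tu; rewrite ltxx.
congr lebesgue_stieltjes_measure.
rewrite -setIUr; congr (_ `&` _); apply/seteqP; split => u /=; rewrite !in_itv/=.
  move=> /andP[u0 ust]; rewrite u0/=; case: (leP u t) => ut; [left|right] => //.
  by rewrite addrC ust.
move=> [/andP[u0 ut]|/andP[tu ust]].
  by rewrite u0 (le_trans ut)// lerDr ltW.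
by rewrite (lt_trans t0 tu) addrC.
Qed.

Definition revuz_mass B t := (\int[Q]_(w in Om0) occupation B t w)%E.

Lemma revuz_mass_add B s t : measurable B -> 0 < s -> 0 < t ->
  revuz_mass B (s + t) = (revuz_mass B s + revuz_mass B t)%E.
Proof.
move=> mB s0 t0; rewrite /revuz_mass addeC.
pose g := (occupation B s \_ Om0)%E.
have mg : measurable_fun setT (g : augT -> \bar R).
  have [h _] := @measurable_restrictT _ _ augT _ Om0 (occupation B s) mOm0.
  exact: h (measurable_occupation (ltW s0) mB).
have g0 w : (0 <= g w)%E by apply: erestrict_ge0 => *; exact: occupation_ge0.
have mgt : measurable_fun setT (fun w : augT => g (theta t w)).
  apply: (measurableT_comp mg).
  exact: (@measurable_theta_aug _ _ _ _ _ LF _ shiftX _ Om0_shift _ t0).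
have -> : (\int[Q]_(w in Om0) occupation B s w = \int[Q]_(w in Om0) g (theta t w))%E.
  (* A path outside [Om0] may be shifted into it, but such paths form a [Q]-null set. *)
  rewrite integral_mkcond -/g -(integral_theta shiftX Om0_shift QE t0 mg g0).
  rewrite (@ge0_negligible_integral _ augT R Q setT (~` Om0) (fun w => g (theta t w)))//.
  - by rewrite setTD setCK.
  - exact: measurableC.
  - exact: Q_Om0C QE.
rewrite -ge0_integralD//.
- apply: eq_integral => w /set_mem w0.
  by rewrite occupation_add// /g patchE mem_set//; exact: Om0_shift.
- exact: measurable_occupation (ltW t0) mB.
- exact: measurable_funTS.
Qed.

Lemma revuz_mass_linear B t : measurable B -> 0 < t ->
  revuz_mass B t = (t%:E * revuz_mass B 1%R)%E.
Proof.
move=> mB; apply: additive_linear.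
- by move=> s u; exact: revuz_mass_add.
- by move=> s; apply: integral_ge0 => w _; exact: occupation_ge0.
Qed.

Lemma revuz_approx_eq (OmegaA : set Omega) B t : Om0 `<=` OmegaA ->
  measurable B -> 0 < t -> revuz_approx P X OmegaA A B t = revuz_mass B 1%R.
Proof.
move=> sub mB t0; rewrite /revuz_approx.
rewrite (@integral_transfer _ _ _ _ _ LF Om0 Om0_full Q QE OmegaA _
  (occupation B t \_ Om0)%E) //.
- rewrite -integral_mkcond -/(revuz_mass B t) revuz_mass_linear//.
  by rewrite muleA -EFinM mulVf ?gt_eqF// mul1e.
- have [h _] := @measurable_restrictT _ _ augT _ Om0 (occupation B t) mOm0.
  exact: h (measurable_occupation (ltW t0) mB).
- by move=> w; apply: erestrict_ge0 => *; exact: occupation_ge0.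
- move=> w w0; rewrite patchE mem_set// /occupation /mass.
  have m0t : measurable (`]0, t]%classic : set timeT) by exact: (measurable_itv `]0, t]).
  rewrite -(@integral_indic _ timeT R (lebesgue_stieltjes_measure (path_cumulative (A ^~ w))) _ m0t _ (measurable_visits mB w0)).
  apply: eq_integral => s /set_mem /=; rewrite in_itv/= => /andP[s0 _].
  by congr EFin; rewrite !indicE; congr (nat_of_bool _)%:R; apply/idP/idP;
    [move=> /set_mem ?; exact/mem_set|move=> /set_mem[? ?]; exact/mem_set].
- move=> w _; apply: integral_ge0 => s _; by rewrite lee_fin indicE.
Qed.

(** The image of the product measure up to time 1 under the evaluation of [X]. Off [D] the
    evaluation takes a default value, which the restriction to [D] discards. *)
Lemma revuz_measure_exists : exists nu : {measure set R -> \bar R},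
  forall B, measurable B -> nu B = revuz_mass B 1%R.
Proof.
have [M ME] := product_measure_exists Om0_A mA Q (@ler01 R).
set D := [set z : timeT * augT | 0 < z.1 /\ Om0 z.2].
have mD : measurable D.
  rewrite (_ : D = visits_graph setT); first exact: measurable_visits_graph.
  by apply/seteqP; split => z //= [].
have mX : measurable_fun setT ((fun z : timeT * augT => X z.1 z.2) \_ D).
  have [h _] := @measurable_restrictT _ _ (timeT * augT)%type _ D (fun z => X z.1 z.2) mD.
  exact: h (measurable_joint_X Om0_cadlag).
pose Xm := isMeasurableFun.Build _ _ _ _ _ mX.
pose X' : {mfun (timeT * augT)%type >-> R} :=
  HB.pack ((fun z : timeT * augT => X z.1 z.2) \_ D) Xm.
pose nu' : {measure set R -> \bar R} := pushforward (mrestr M mD) X'.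
exists (nu' mX) => B mB; rewrite /nu'/= /pushforward/= /mrestr/=.
rewrite (_ : _ `&` _ = visits_graph B); last first.
  apply/seteqP; split => z /=.
    by rewrite patchE => -[+ Dz]; rewrite mem_set//.
  by move=> [Dz Bz]; split => //; rewrite patchE mem_set.
rewrite ME; apply: eq_integral => w /set_mem w0.
by rewrite visits_graphE.
Qed.

End occupation.

Section eventually.
Context d {T : measurableType d} {R : realType}.

(** Fatou's lemma for sets: the intersections of the [F k] with [k >= n] increase with [n], and
    continuity from below holds for infinite measures as well. *)
Lemma measure_liminf_le (mu : {measure set T -> \bar R}) (E : set T)
    (F : (set T)^nat) (c : \bar R) :
  measurable E -> (forall n, measurable (F n)) ->
  (forall w, E w -> \forall n \near \oo, F n w) ->
  (forall n, mu (F n) <= c)%E -> (mu E <= c)%E.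
Proof.
move=> mE mF EF Fc; pose G n := \bigcap_(k in [set k | (n <= k)%N]) F k.
have mG n : measurable (G n).
  by apply: bigcap_measurable => //; exists n => /=.
have ndG : nondecreasing_seq G.
  move=> m n mn; apply/subsetPset => w Gw k /= nk; apply: Gw => /=.
  exact: leq_trans nk.
have cG : mu (G n) @[n --> \oo] --> mu (\bigcup_n G n).
  by apply: nondecreasing_cvg_mu => //; exact: bigcupT_measurable.
apply: (@le_trans _ _ (mu (\bigcup_n G n))).
  have EG : E `<=` \bigcup_n G n.
    by move=> w /EF[n _ h]; exists n => // k /= nk; exact: h.
  by apply: le_measure; rewrite ?inE//; exact: bigcupT_measurable.
rewrite -(cvg_lim _ cG)//; apply: lime_le; first by apply/cvg_ex; eexists; exact: cG.
apply: nearW => n; apply: le_trans (Fc n); apply: le_measure; rewrite ?inE//.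
by move=> w; apply => /=.
Qed.

End eventually.

(** * The strong Markov property at first passage times *)

Section passage.
Context {R : realType}.
Variables (f : R -> R) (y T t0 : R).
Hypotheses (cf : cadlag f) (jf : no_positive_jumps f) (f0 : f 0 < y).
Hypotheses (t00 : 0 <= t0) (t0T : t0 <= T) (ft0 : y < f t0).

Definition passage_time (f : R -> R) (y : R) : R := inf [set t | 0 <= t /\ y < f t].

Local Notation tau := (passage_time f y).
Let S := [set t | 0 <= t /\ y < f t].

Let hS : has_inf S.
Proof. by split; [exists t0|exists 0 => t []]. Qed.

Let tau_le t : 0 <= t -> y < f t -> tau <= t.
Proof. by move=> t1 yt; apply: ge_inf => //; exact: hS.2. Qed.

Let before t : 0 <= t -> t < tau -> f t <= y.
Proof. by move=> t1 tt; rewrite leNgt; apply/negP => /(tau_le t1); rewrite leNgt tt. Qed.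

Let tau_ge0 : 0 <= tau.
Proof. by apply: lb_le_inf; [exact: hS.1|move=> t []]. Qed.

Let tau_ge : y <= f tau.
Proof.
rewrite leNgt; apply/negP => fy; have /cvgr_lt /(_ _ fy)[e /= e0 h] := cf.1 _ tau_ge0.
have [t [t1 yt] tt] := inf_adherent e0 hS.
have := tau_le t1 yt; rewrite le_eqVlt => /predU1P[tE|tau_t].
  by move: fy; rewrite tE ltNge (ltW yt).
have : f t < y.
  by apply: h => //=; rewrite ltr0_norm ?subr_lt0// opprB ltrBlDl.
by rewrite ltNge (ltW yt).
Qed.

Lemma passage_time_gt0 : 0 < tau.
Proof.
rewrite lt_neqAle tau_ge0 andbT; apply/eqP => tE.
by move: tau_ge; rewrite -tE leNgt f0.
Qed.

(** Times above [y] accumulate at [tau] from the right, so right-continuity gives a value at least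
    [y]. Before [tau] the path is at most [y], hence so is its left limit, and it cannot jump
    upwards. *)
Lemma passage_value : f tau = y.
Proof.
apply/eqP; rewrite eq_le tau_ge andbT.
apply: (le_trans (jf passage_time_gt0)); rewrite /left_lim.
apply: limr_le; first exact: cf.2 passage_time_gt0.
near=> t; apply: before; near: t; first exact: nbhs_left_ge passage_time_gt0.
exact: nbhs_left_lt.
Unshelve. all: by end_near. Qed.

Lemma passage_time_lt : tau < T.
Proof.
apply: lt_le_trans t0T; rewrite lt_neqAle tau_le// andbT.
by apply/eqP => tE; move: ft0; rewrite -tE passage_value ltxx.
Qed.

(** With [h = T / (n + 1)] the tested times run from 0 to [T] inclusive; the value [n.+2] means that
    the path is above [y] at none of them. *)
Definition passage_index (f : R -> R) (y h : R) (n : nat) : nat :=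
  find (fun k => y < f (h * k%:R)) (iota 0 n.+2).

Local Notation h n := (T / n.+1%:R).
Local Notation sigma n := (h n * (passage_index f y (h n) n)%:R).

Let T0 : 0 < T.
Proof. exact: lt_trans passage_time_gt0 passage_time_lt. Qed.

(** A passage at index [k] is decided by the grid values up to [k], which makes the grid passage
    time a stopping time. *)
Lemma passage_indexP (h0 : R) n k : (passage_index f y h0 n == k) && (k < n.+2)%N =
  [&& (k < n.+2)%N, y < f (h0 * k%:R) & all (fun j => f (h0 * j%:R) <= y) (iota 0 k)].
Proof.
rewrite /passage_index; set p := (fun k => y < f (h0 * k%:R)).
apply/idP/idP.
  move=> /andP[/eqP pk kn]; rewrite kn andTb.
  have hs : has p (iota 0 n.+2) by rewrite has_find pk size_iota.
  have := nth_find 0%N hs; rewrite pk nth_iota// add0n => pyk.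
  apply/andP; split => //; apply/allP => j; rewrite mem_iota add0n => /andP[_ jk].
  have jf' : (j < find p (iota 0 n.+2))%N by rewrite pk.
  have := before_find 0%N jf'; rewrite nth_iota ?add0n; last exact: ltn_trans kn.
  by move=> /negbT; rewrite -leNgt.
move=> /and3P[kn yk /allP ak]; rewrite kn andbT.
have hs : has p (iota 0 n.+2).
  by apply/hasP; exists k => //; rewrite mem_iota add0n.
have fn : (find p (iota 0 n.+2) < n.+2)%N by rewrite -[X in (_ < X)%N](size_iota 0) -has_find.
rewrite eqn_leq; apply/andP; split; rewrite leqNgt; apply/negP => H.
  by have := before_find 0%N H; rewrite nth_iota// add0n /p yk.
have := nth_find 0%N hs; rewrite nth_iota// add0n /p ltNge ak//.
by rewrite mem_iota add0n.
Qed.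

Lemma passage_approx_ge n : tau <= sigma n.
Proof.
have h0 : 0 < h n by rewrite divr_gt0.
have [kn|kn] := ltnP (passage_index f y (h n) n) n.+2.
  have := passage_indexP (h n) n (passage_index f y (h n) n).
  rewrite eqxx kn/= => /esym/andP[yk _]; apply: tau_le => //.
  by rewrite mulr_ge0// ltW.
(* Without a grid passage the default index [n.+2] puts [sigma n] beyond [T], hence beyond [tau]. *)
apply: (le_trans (ltW passage_time_lt)); rewrite mulrAC -mulrA ler_pMr//.
by rewrite ler_pdivlMr// mul1r ler_nat ltnW.
Qed.

(** Choose [t] just after [tau] with [f t] above [y]. By right-continuity at [t] the next grid point
    is above [y] too once the grid is fine, and it bounds [sigma n]. *)
Let approx e : 0 < e -> \forall n \near \oo, sigma n < tau + e /\
  (passage_index f y (h n) n < n.+2)%N.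
Proof.
move=> e0; pose e' := Num.min e (T - tau).
have e'0 : 0 < e' by rewrite lt_min e0 subr_gt0 passage_time_lt.
have [t [t1 yt] tt] := inf_adherent e'0 hS.
have te : t < tau + e by apply: (lt_le_trans tt); rewrite lerD2l ge_min lexx.
have tT : t <= T.
  apply: (le_trans (ltW tt)); rewrite -lerBrDl ge_min lexx orbT//.
have tpos : 0 < t by apply: lt_le_trans passage_time_gt0 (tau_le t1 yt).
have gc := grid_cvg T0 tpos.
have gge n : t <= h n * (grid_index (h n) t)%:R.
  have h0 : 0 < h n by rewrite divr_gt0.
  by have [k [-> /andP[]]] := grid_indexP h0 tpos.
have fc := cvg_seq_right (cf.1 _ t1) gge gc.
near=> n.
have h0 : 0 < h n by rewrite divr_gt0.
have gn : (grid_index (h n) t < n.+2)%N.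
  have [k [-> /andP[kt _]]] := grid_indexP h0 tpos.
  rewrite ltnS -(ltr_nat R) -(ltr_pM2l h0).
  by apply: (lt_le_trans kt); rewrite divfK// (le_trans tT).
have yg : y < f (h n * (grid_index (h n) t)%:R).
  by near: n; apply: (cvgr_gt _ fc).
have ig : (passage_index f y (h n) n <= grid_index (h n) t)%N.
  rewrite leqNgt; apply/negP => H.
  by have := before_find 0%N H; rewrite nth_iota// add0n yg.
split; last exact: leq_ltn_trans gn.
apply: (@le_lt_trans _ _ (h n * (grid_index (h n) t)%:R)).
  by rewrite ler_pM2l// ler_nat.
by near: n; apply: (cvgr_lt _ gc).
Unshelve. all: by end_near. Qed.

Lemma passage_approx_cvg : sigma n @[n --> \oo] --> tau.
Proof.
apply/cvgrPdist_lt => e e0; have := approx e0; apply: filterS => n [se _].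
by rewrite distrC ger0_norm ?subr_ge0 ?passage_approx_ge// ltrBlDl.
Qed.

Lemma passage_index_near : \forall n \near \oo, (passage_index f y (h n) n < n.+2)%N.
Proof. by have := approx ltr01; apply: filterS => n []. Qed.

End passage.

Section half_lines.
Context d {Omega : measurableType d} {R : realType}.
Variables (P : R -> probability Omega R) (X : R -> Omega -> R).
Implicit Types (G E : set Omega) (l : seq (R * R)).

(** Half-lines replace Borel sets here because the strong Markov property is a limit over grids:
    convergence of values carries information about open and closed constraints, and open half-lines
    already generate. *)
Definition open_cylinder l : set Omega :=
  [set w | all (fun p => X p.1 w < p.2) l].

Definition closed_cylinder l : set Omega :=
  [set w | all (fun p => X p.1 w <= p.2) l].

Definition open_cylinders : set (set Omega) :=
  [set G | exists l, all (fun p => 0 <= p.1) l /\ G = open_cylinder l].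

Definition open_constraints l := [seq (p.1, `]-oo, p.2[%classic) | p <- l].
Definition closed_constraints l := [seq (p.1, `]-oo, p.2]%classic) | p <- l].

Lemma open_cylinderE l : open_cylinder l = cylinder X (open_constraints l).
Proof.
apply/funext => w; congr is_true; rewrite all_map; apply: eq_all => p /=.
by rewrite in_itv/= asboolb.
Qed.

Lemma closed_cylinderE l : closed_cylinder l = cylinder X (closed_constraints l).
Proof.
apply/funext => w; congr is_true; rewrite all_map; apply: eq_all => p /=.
by rewrite in_itv/= asboolb.
Qed.

Lemma open_constraints_measurable l :
  all (fun p => `[< measurable p.2 >]) (open_constraints l).
Proof.
by rewrite all_map; apply/allT => p /=; apply/asboolP; exact: measurable_itv.
Qed.

Lemma closed_constraints_measurable l :
  all (fun p => `[< measurable p.2 >]) (closed_constraints l).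
Proof.
by rewrite all_map; apply/allT => p /=; apply/asboolP; exact: measurable_itv.
Qed.

Lemma open_cylinder_path l : all (fun p => 0 <= p.1) l ->
  natural_sigma_algebra X (open_cylinder l).
Proof.
move=> l0; rewrite open_cylinderE; apply: cylinder_path.
exists (open_constraints l); rewrite all_map; split => //.
exact: open_constraints_measurable.
Qed.

Lemma closed_cylinder_path l : all (fun p => 0 <= p.1) l ->
  natural_sigma_algebra X (closed_cylinder l).
Proof.
move=> l0; rewrite closed_cylinderE; apply: cylinder_path.
exists (closed_constraints l); rewrite all_map; split => //.
exact: closed_constraints_measurable.
Qed.

Lemma open_cylinders_generate : natural_sigma_algebra X = <<s open_cylinders >>.
Proof.
apply/seteqP; split; apply: smallest_sub;
  [exact: smallest_sigma_algebra| |exact: smallest_sigma_algebra|].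
  move=> _ [s [B [s0 mB ->]]].
  suff h : measurable_fun setT (X s : g_sigma_algebraType open_cylinders -> R).
    by have := h measurableT B mB; rewrite setTI.
  apply: (measurability _ (RGenInftyO.measurableE R)).
  move=> _ [_ [c ->] <-]; rewrite setTI; apply: sub_sigma_algebra.
  exists [:: (s, c)]; rewrite /= s0; split => //.
  by apply/seteqP; split => w /=; rewrite /open_cylinder/= in_itv/= andbT.
by move=> _ [l [l0 ->]]; exact: open_cylinder_path.
Qed.

Lemma open_cylinders_measure_unique (m1 m2 : {measure set (path_type X) -> \bar R}) :
  (m1 setT < +oo)%E -> (forall G, open_cylinders G -> m1 G = m2 G) ->
  forall G, natural_sigma_algebra X G -> m1 G = m2 G.
Proof.
move=> m1oo m12 G; rewrite open_cylinders_generate.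
apply: (@g_sigma_algebra_measure_unique _ R (path_type X) open_cylinders _ (fun=> setT)) => //.
- by move=> _ [l [l0 ->]]; exact: open_cylinder_path.
- by move=> _; exists [::]; split => //; apply/seteqP; split.
- by rewrite bigcup_const//; exists 0%N.
- move=> _ _ [l [l0 ->]] [l' [l'0 ->]]; exists (l ++ l'); rewrite all_cat l0 l'0.
  by split => //; apply/seteqP; split => w /=; rewrite /open_cylinder/= all_cat => /andP.
Qed.

End half_lines.

Section strong_markov.
Context d {Omega : measurableType d} {R : realType}.
Variables (P : R -> probability Omega R) (X : R -> Omega -> R).
Hypothesis LF : levy_family P X.
Variable theta : R -> Omega -> Omega.
Hypothesis shiftX : shift_operators X theta.
Variables (a y T : R) (Om1 : set Omega).
Hypotheses (ay : a < y) (T0 : 0 < T).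
Hypotheses (mOm1 : measurable Om1) (Om1_full : P a (~` Om1) = 0%E).
Hypothesis Om1P : forall w, Om1 w ->
  [/\ cadlag (X ^~ w), no_positive_jumps (X ^~ w) & X 0 w = a].
Implicit Types (G E : set Omega).

Let mX t : 0 <= t -> measurable_fun setT (X t).
Proof. exact: (levy_measurable (levy_family_process LF 0)). Qed.

Local Notation h n := (T / n.+1%:R).
Let h0 n : 0 < h n. Proof. by rewrite divr_gt0. Qed.
Let hk0 n k : 0 <= h n * k%:R. Proof. by rewrite mulr_ge0// ltW. Qed.

Let pi n w := passage_index (X ^~ w) y (h n) n.
Let tau w := passage_time (X ^~ w) y.

Let first n k : set Omega := [set w | (pi n w == k) && (k < n.+2)%N].

Let first_past n k : natural_filtration X (h n * k%:R) (first n k).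
Proof.
pose FT := past_type X (h n * k%:R).
have mall l : all (fun j => (j <= k)%N) l ->
    measurable ([set w | all (fun j => X (h n * j%:R) w <= y) l] : set FT).
  elim: l => [_|j l IH /= /andP[jk lk]].
    by rewrite (_ : [set _ | _] = setT)//; apply/seteqP; split.
  rewrite (_ : [set _ | _] = X (h n * j%:R) @^-1` `]-oo, y] `&`
      [set w | all (fun j => X (h n * j%:R) w <= y) l]); last first.
    by apply/seteqP; split => w /=; rewrite in_itv/= => /andP.
  apply: measurableI; last exact: IH.
  apply: sub_sigma_algebra; exists (h n * j%:R), (`]-oo, y]%classic).
  by split => //; rewrite hk0 ler_pM2l// ler_nat.
rewrite (_ : first n k = if (k < n.+2)%N then X (h n * k%:R) @^-1` `]y, +oo[ `&`
   [set w | all (fun j => X (h n * j%:R) w <= y) (iota 0 k)] else set0).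
  case: ifP => kn; last exact: (@measurable0 _ FT).
  apply: (@measurableI _ FT).
    apply: sub_sigma_algebra; exists (h n * k%:R), (`]y, +oo[%classic).
    by split => //; rewrite hk0 lexx.
  by apply: mall; apply/allP => j; rewrite mem_iota add0n => /andP[_ /ltnW].
apply/funext => w; rewrite /first/pi/= passage_indexP.
case: ifP => kn /=; last by apply/propext; split.
by apply/propext; rewrite in_itv/= andbT; split => /andP.
Qed.

(** Countable form of the event that the path exceeds [y] within time [T]: some grid detects it. *)
Definition passes : set Omega :=
  \bigcup_n [set w | (passage_index (X ^~ w) y (T / n.+1%:R) n < n.+2)%N].

Definition passage_event := Om1 `&` passes.

Let passes_n n : [set w | (pi n w < n.+2)%N] = \bigcup_k first n k.
Proof.
apply/seteqP; split => w /=; first by move=> wn; exists (pi n w); rewrite /first/= ?eqxx.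
by move=> [k _] /andP[/eqP ->].
Qed.

Let mfirst n k : measurable (first n k).
Proof. by move: (@first_past n k); exact: (past_sub_measurable LF). Qed.

Let mpasses_n n : measurable [set w | (pi n w < n.+2)%N].
Proof. by rewrite passes_n; apply: bigcupT_measurable => k; exact: mfirst. Qed.

Lemma measurable_passes : measurable passes.
Proof. by apply: bigcupT_measurable => n; exact: mpasses_n. Qed.

Lemma measurable_passage_event : measurable passage_event.
Proof. by apply: measurableI => //; exact: measurable_passes. Qed.

Lemma passage_event_prob : P a passage_event = P a passes.
Proof.
rewrite -[in RHS](setIT passes) -(setUv Om1) setIUr measureU.
- rewrite [X in (_ + X)%E](_ : _ = 0%E) ?adde0; first by rewrite setIC.
  apply/eqP; rewrite -measure_le0 -Om1_full.
  by apply: le_measure; rewrite ?inE//; [apply: measurableI => //; [exact: measurable_passes|exact: measurableC]|exact: measurableC].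
- by apply: measurableI => //; exact: measurable_passes.
- by apply: measurableI; [exact: measurable_passes|exact: measurableC].
- by rewrite setIACA setICr setI0.
Qed.

Let passage_hyp w : passage_event w -> exists t0,
  [/\ 0 <= t0, t0 <= T & y < X t0 w].
Proof.
move=> [w1 [n _ /= pn]]; exists (h n * (pi n w)%:R); split => //.
  by rewrite -mulrA ler_piMr ?(ltW T0)// mulrC ler_pdivrMr// mul1r ler_nat -ltnS.
have := passage_indexP (X ^~ w) y (h n) n (pi n w).
by rewrite eqxx pn/= => /esym/andP[].
Qed.

Let passage_facts w : passage_event w ->
  [/\ 0 < tau w < T, X (tau w) w = y,
     (forall n, tau w <= h n * (pi n w)%:R),
     (h n * (pi n w)%:R @[n --> \oo] --> tau w) &
     \forall n \near \oo, (pi n w < n.+2)%N].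
Proof.
move=> Dw; have [t0 [t00 t0T yt]] := passage_hyp Dw.
have [cf jf f0] := Om1P Dw.1.
have f0y : X 0 w < y by rewrite f0.
split.
- by rewrite (passage_time_gt0 cf f0y t00 yt) (passage_time_lt cf jf f0y t00 t0T yt).
- exact: (passage_value cf jf f0y t00 yt).
- by move=> n; exact: (passage_approx_ge cf jf f0y t00 t0T yt).
- exact: (passage_approx_cvg cf jf f0y t00 t0T yt).
- exact: (passage_index_near cf jf f0y t00 t0T yt).
Qed.

Lemma passage_eventP w : passage_event w ->
  0 < tau w < T /\ X (tau w) w = y.
Proof. by move=> /passage_facts[]. Qed.

Let after w : Omega := theta (tau w) w.

Let X_after_cvg t w : 0 <= t -> passage_event w ->
  X (h n * (pi n w)%:R + t) w @[n --> \oo] --> X t (after w).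
Proof.
move=> t0 Dw; have [/andP[tau0 _] _ ge cv _] := passage_facts Dw.
have [cf _ _] := Om1P Dw.1.
rewrite /after shiftX ?(ltW tau0)// (addrC t).
apply: (@cvg_seq_right _ (X ^~ w) (tau w + t)).
- by apply: cf.1; rewrite addr_ge0// ltW.
- by move=> n; rewrite lerD2r.
- by apply: cvgD => //; exact: cvg_cst.
Qed.

Let measurable_X_after t : 0 <= t ->
  measurable_fun passage_event (fun w => X t (after w)).
Proof.
move=> t0; apply: (@measurable_fun_cvg _ _ _ _ (fun n w => X (h n * (pi n w)%:R + t) w)).
- move=> n; apply: measurable_funTS => _ B mB; rewrite setTI.
  rewrite (_ : _ @^-1` _ = \bigcup_k ([set w | pi n w = k] `&`
      X (h n * k%:R + t) @^-1` B)); last first.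
    apply/seteqP; split => w /=; first by move=> Bw; exists (pi n w).
    by move=> [k _ /= [->]].
  have mk k : measurable [set w | pi n w = k].
    have [kn|kn] := ltnP k n.+2.
      rewrite (_ : [set _ | _] = first n k); first exact: mfirst.
      by apply/seteqP; split => w /=; rewrite /first/= kn andbT => /eqP.
    (* The index [n.+2] records the absence of a grid passage, and no larger index occurs. *)
    have [kn2|kn2] := eqVneq k n.+2.
      rewrite (_ : [set _ | _] = ~` [set w | (pi n w < n.+2)%N]); first exact: measurableC.
      apply/seteqP; split => w /=; first by rewrite kn2 => ->; rewrite ltnn.
      move=> /negP; rewrite -leqNgt => h1; apply/eqP; rewrite kn2 eqn_leq h1 andbT.
      by rewrite /pi/passage_index (leq_trans (find_size _ _))// size_iota.
    rewrite (_ : [set _ | _] = set0)//; apply/seteqP; split => // w /= pk.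
    have : (pi n w <= n.+2)%N by rewrite /pi/passage_index (leq_trans (find_size _ _))// size_iota.
    by rewrite pk => h1; move: kn2; rewrite eqn_leq h1 kn.
  apply: bigcupT_measurable => k; apply: measurableI => //.
  rewrite -[X in measurable X]setTI; apply: mX => //.
  by rewrite addr_ge0.
- by move=> w Dw; exact: X_after_cvg.
Qed.

Lemma measurable_after : measurable_fun passage_event (after : Omega -> path_type X).
Proof.
apply: (@measurability _ _ Omega (path_type X) passage_event after (path_events X)) => //.
move=> _ [_ [t [B [t0 mB ->]]] <-].
exact: (measurable_X_after t0 measurable_passage_event).
Qed.

(** Constraints on the path after a grid time, translated to start at [y] exactly. The path itself
    is only near [y] at that time; the translated one is independent of the past with law [P y], and
    [X_now_cvg] makes the difference vanish in the limit. *)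
Let shifted n k (l : seq (R * set R)) : set Omega :=
  [set w | all (fun p => `[< p.2 (y + (X (h n * k%:R + p.1) w - X (h n * k%:R) w)) >]) l].

Let measurable_shifted n k l : all (fun p => 0 <= p.1) l ->
  all (fun p => `[< measurable p.2 >]) l -> measurable (shifted n k l).
Proof.
elim: l => [_ _|p l IH /= /andP[p0 l0] /andP[/asboolP mp ml]].
  by rewrite (_ : shifted n k [::] = setT)//; apply/seteqP; split.
rewrite (_ : shifted n k _ =
   (fun w => y + (X (h n * k%:R + p.1) w - X (h n * k%:R) w)) @^-1` p.2 `&` shifted n k l).
  apply: measurableI; last exact: IH.
  rewrite -[X in measurable X]setTI; apply: (measurable_funD (measurable_cst y)) => //.
  by apply: measurable_funB; apply: mX => //; exact: addr_ge0.
apply/seteqP; split => w /=; first by move=> /andP[/asboolP].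
by move=> [pw lw]; apply/andP; split => //; exact/asboolP.
Qed.

Let shifted_law n k l : all (fun p => 0 <= p.1) l ->
  all (fun p => `[< measurable p.2 >]) l ->
  P a (first n k `&` shifted n k l) = (P a (first n k) * P y (cylinder X l))%E.
Proof.
move=> l0 ml.
rewrite (markov_cylinder LF l0 ml a (hk0 n k) (@first_past n k) (V := fun=> y)).
  have m1 : measurable_fun setT (fun w => (\1_(first n k) w : R)%:E).
    by apply/measurable_EFinP; exact: measurable_indic.
  rewrite ge0_integralZr// integral_indic ?setIT//; exact: mfirst.
exact: measurable_cst.
Qed.

Let shiftedC_law n k l : all (fun p => 0 <= p.1) l ->
  all (fun p => `[< measurable p.2 >]) l ->
  P a (first n k `&` ~` shifted n k l) =
    (P a (first n k) * P y (~` cylinder X l))%E.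
Proof.
move=> l0 ml; have ms := measurable_shifted n k l0 ml.
have mc : measurable (cylinder X l).
  by apply: (path_sub_measurable LF); apply: cylinder_path; exists l.
have mf := mfirst n k.
transitivity (P a (first n k) - P a (first n k `&` shifted n k l))%E.
  rewrite -setDE measureD//.
  by rewrite -ge0_fin_numE// fin_num_measure.
rewrite shifted_law// probability_setC// muleBr ?fin_num_measure// ?mule1//.
Qed.

(** The events [first n k] are disjoint, their union over [k] lies in [passes], and what follows has
    the same conditional probability [p] for each [k]. *)
Let union_law n (F : nat -> set Omega) (p : R) : 0 <= p ->
  (forall k, measurable (F k)) ->
  (forall k, P a (first n k `&` F k) = (P a (first n k) * p%:E)%E) ->
  (P a (\bigcup_k (first n k `&` F k)) <= p%:E * P a passage_event)%E.
Proof.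
move=> p0 mF Fp.
have tf : trivIset setT (first n).
  apply/trivIsetP => i j _ _ ij; apply/seteqP.
  split => // w [/andP[/eqP pni _] /andP[/eqP pnj _]].
  by move: ij; rewrite -pni pnj eqxx.
rewrite measure_bigcup//; last 2 first.
- by move=> k _; apply: measurableI => //; exact: mfirst.
- by apply: trivIset_setIr.
rewrite (@eq_eseriesr _ _ (fun k => p%:E * P a (first n k))%E); last first.
  by move=> k _; apply: etrans (Fp k) _; exact: muleC.
rewrite nneseriesZl//; apply: lee_wpmul2l => //.
rewrite passage_event_prob -measure_bigcup// -passes_n.
by apply: le_measure; rewrite ?inE//; [exact: measurable_passes|move=> w pw; exists n].
Qed.

Let X_now_cvg w : passage_event w ->
  X (h n * (pi n w)%:R) w @[n --> \oo] --> y.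
Proof.
move=> Dw; have [/andP[tau0 _] <- ge cv _] := passage_facts Dw.
have [cf _ _] := Om1P Dw.1.
by apply: (@cvg_seq_right _ (X ^~ w) (tau w)) => //; apply: cf.1; exact: ltW.
Qed.

Let X_shifted_cvg t w : 0 <= t -> passage_event w ->
  y + (X (h n * (pi n w)%:R + t) w - X (h n * (pi n w)%:R) w) @[n --> \oo]
    --> X t (after w).
Proof.
move=> t0 Dw; rewrite -[X in _ --> X](subrKC y).
apply: cvgD; first exact: cvg_cst.
by apply: cvgB; [exact: X_after_cvg|exact: X_now_cvg].
Qed.

Let open_near w (l : seq (R * R)) : passage_event w ->
  all (fun p => 0 <= p.1) l -> open_cylinder X l (after w) ->
  \forall n \near \oo, shifted n (pi n w) (open_constraints l) w.
Proof.
move=> Dw; elim: l => [_ _|p l IH /andP[p0 l0] /andP[pw lw]].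
  exact: nearW.
near=> n; apply/andP; split; last by near: n; exact: IH.
apply/asboolP; rewrite /= in_itv/=; near: n.
exact: (cvgr_lt _ (X_shifted_cvg p0 Dw)).
Unshelve. all: by end_near. Qed.

Let closed_near w (l : seq (R * R)) : passage_event w ->
  all (fun p => 0 <= p.1) l -> ~ closed_cylinder X l (after w) ->
  \forall n \near \oo, ~ shifted n (pi n w) (closed_constraints l) w.
Proof.
move=> Dw; elim: l => [_ //|p l IH /andP[p0 l0] /negP].
rewrite negb_and => /orP[|/negP lw].
  rewrite -ltNge => pw; near=> n; move=> /andP[/asboolP + _]; apply/negP.
  rewrite /= in_itv/= -ltNge; near: n.
  exact: (cvgr_gt _ (X_shifted_cvg p0 Dw)).
near=> n; move=> /andP[_]; near: n; exact: IH.
Unshelve. all: by end_near. Qed.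

Let measurable_D_after G : natural_sigma_algebra X G ->
  measurable (passage_event `&` after @^-1` G).
Proof. by move=> nG; exact: (measurable_after measurable_passage_event). Qed.

Let fineP G : (fine (P y G))%:E = P y G -> 0 <= fine (P y G).
Proof. by move=> e; rewrite -lee_fin e. Qed.

(* Grid times decrease to the passage time, so right-continuity of the paths only
   transfers strict inequalities to the grid.  Applied to an open cylinder this
   bounds the probability of the strong Markov property from above, and applied
   to the complement of a closed cylinder, from below. *)
Let strong_le (S : nat -> nat -> set Omega) G :
  natural_sigma_algebra X G ->
  (forall n k, measurable (S n k)) ->
  (forall n k, P a (first n k `&` S n k) = (P a (first n k) * P y G)%E) ->
  (forall w, passage_event w -> G (after w) -> \forall n \near \oo, S n (pi n w) w) ->
  (P a (passage_event `&` after @^-1` G) <= P a passage_event * P y G)%E.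
Proof.
move=> nG mS SG near_S.
have mG : measurable G by exact: (path_sub_measurable LF).
have yG : P y G = (fine (P y G))%:E by rewrite fineK// fin_num_measure.
apply: (@measure_liminf_le _ _ _ (P a) _ (fun n => \bigcup_k (first n k `&` S n k))).
- exact: measurable_D_after.
- by move=> n; apply: bigcupT_measurable => k; apply: measurableI => //; exact: mfirst.
- move=> w [Dw Gw]; have [_ _ _ _ pn] := passage_facts Dw.
  near=> n; exists (pi n w) => //; split; last by near: n; exact: near_S.
  by rewrite /first/= eqxx/=; near: n.
- move=> n; rewrite muleC yG; apply: union_law => //.
    by apply: fineP; rewrite -yG.
  by move=> k; rewrite -yG.
Unshelve. all: by end_near. Qed.

Let strong_open l : all (fun p => 0 <= p.1) l ->
  (P a (passage_event `&` after @^-1` (open_cylinder X l)) <=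
   P a passage_event * P y (open_cylinder X l))%E.
Proof.
move=> l0; have l0' : all (fun p => 0 <= p.1) (open_constraints l) by rewrite all_map.
have ml := open_constraints_measurable l.
apply: (@strong_le (fun n k => shifted n k (open_constraints l))).
- exact: open_cylinder_path.
- by move=> n k; exact: measurable_shifted.
- by move=> n k; rewrite open_cylinderE; exact: shifted_law.
- by move=> w Dw Gw; exact: open_near.
Qed.

Let strong_closed l : all (fun p => 0 <= p.1) l ->
  (P a passage_event * P y (closed_cylinder X l) <=
   P a (passage_event `&` after @^-1` (closed_cylinder X l)))%E.
Proof.
move=> l0; have l0' : all (fun p => 0 <= p.1) (closed_constraints l) by rewrite all_map.
have ml := closed_constraints_measurable l.
have nK := closed_cylinder_path (X := X) l0.
have mK : measurable (closed_cylinder X l) by exact: (path_sub_measurable LF).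
have mD := measurable_passage_event.
have := @strong_le (fun n k => ~` shifted n k (closed_constraints l))
  (~` closed_cylinder X l).
have mDK := measurable_D_after nK.
have -> : passage_event `&` after @^-1` (~` closed_cylinder X l) =
    passage_event `\` (passage_event `&` after @^-1` (closed_cylinder X l)).
  by rewrite preimage_setC setDIr setDv set0U setDE.
rewrite measureD//; last by rewrite -ge0_fin_numE// fin_num_measure.
rewrite setIA setIid probability_setC// muleBr ?fin_num_measure//.
rewrite mule1 => H.
have : (P a passage_event - P a (passage_event `&` after @^-1` closed_cylinder X l) <=
  P a passage_event - P a passage_event * P y (closed_cylinder X l))%E.
  apply: H.
  - exact: (@measurableC _ (path_type X)).
  - by move=> n k; apply: measurableC; exact: measurable_shifted.
  - by move=> n k; rewrite [LHS]shiftedC_law// -closed_cylinderE probability_setC.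
  - by move=> w Dw Gw; exact: closed_near.
by rewrite leeD2lE ?fin_num_measure// leeN2.
Qed.

(** Both sides are finite measures in [G], compared on open cylinders. One inequality is
    [strong_open]; the other comes from [strong_closed], as the closed cylinders with levels lowered
    by [1 / (j + 1)] exhaust the open one. *)
Lemma strong_markov G : natural_sigma_algebra X G ->
  P a (passage_event `&` after @^-1` G) = (P a passage_event * P y G)%E.
Proof.
have mD := measurable_passage_event.
(* The map [after] is measurable on the passage event only; elsewhere it is replaced by a default
   path, which [mrestr] ignores. *)
have [mA _] := @measurable_restrictT _ _ Omega (path_type X) passage_event after mD.
pose f := (after : Omega -> path_type X) \_ passage_event.
have mf : measurable_fun setT f by apply: mA; exact: measurable_after.
pose fm := isMeasurableFun.Build _ _ _ _ _ mf.
pose f' : {mfun Omega >-> path_type X} := HB.pack f fm.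
pose m1' : {measure set (path_type X) -> \bar R} := pushforward (mrestr (P a) mD) f'.
pose m1 := m1' mf.
have mid : measurable_fun setT (id : Omega -> path_type X).
  by apply: (measurable_path LF); exact: (@measurable_id _ (path_type X)).
pose idm := isMeasurableFun.Build _ _ _ _ _ mid.
pose id' : {mfun Omega >-> path_type X} := HB.pack (id : Omega -> path_type X) idm.
have c0 : 0 <= fine (P a passage_event) by apply: fine_ge0.
pose m2 : {measure set (path_type X) -> \bar R} :=
  mscale (NngNum c0) (distribution (P y) id').
have m1E G' : m1 G' = P a (passage_event `&` after @^-1` G').
  rewrite /m1/m1'/= /pushforward/mrestr/=; congr (P a _).
  apply/seteqP; split => w /=.
    by move=> [+ Dw]; rewrite /f patchE mem_set.
  by move=> [Dw]; rewrite /f patchE mem_set.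
have m2E G' : m2 G' = (P a passage_event * P y G')%E.
  by rewrite /m2/= /mscale/= fineK// fin_num_measure.
move=> nG; rewrite -m1E -m2E; apply: open_cylinders_measure_unique nG => //.
  by rewrite m1E -ge0_fin_numE// fin_num_measure// preimage_setT setIT.
move=> _ [l [l0 ->]]; apply/eqP; rewrite eq_le m1E m2E strong_open//=.
pose K j := closed_cylinder X [seq (p.1, p.2 - j.+1%:R^-1) | p <- l].
have nK j : natural_sigma_algebra X (K j).
  by apply: closed_cylinder_path; rewrite all_map.
rewrite -m2E; apply: (@measure_liminf_le _ _ _ m2 _ K).
- exact: open_cylinder_path.
- exact: nK.
- move=> w; rewrite /K /open_cylinder/closed_cylinder/=.
  elim: l l0 {K nK} => [_ _|p l IH /andP[p0 l0] /= /andP[pw lw]]; first exact: nearW.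
  near=> n; apply/andP; split; last by near: n; exact: IH.
  near: n; have e0 : 0 < p.2 - X p.1 w by rewrite subr_gt0.
  have := @cvg_harmonic R; move=> /cvgr0Pnorm_lt /(_ _ e0).
  apply: filterS => n; rewrite /= ger0_norm ?invr_ge0// => h'.
  by rewrite lerBrDr -lerBrDl ltW.
- move=> j; rewrite m2E; apply: (le_trans (strong_closed _)); first by rewrite all_map.
  apply: le_measure; rewrite ?inE; [exact: (measurable_D_after (nK j))|
    exact: (measurable_D_after (open_cylinder_path l0))|].
  apply: setIS => w /= /allP Kw; apply/allP => p pl.
  have := Kw (p.1, p.2 - j.+1%:R^-1); rewrite /= map_f// => /(_ isT) /le_lt_trans; apply.
  by rewrite ltrBlDr ltrDl invr_gt0.
Unshelve. all: by end_near. Qed.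

End strong_markov.

(** * Finiteness on compact sets *)

Section levy_estimates.
Context d {Omega : measurableType d} {R : realType}.
Variables (P : R -> probability Omega R) (X : R -> Omega -> R).
Hypothesis LF : levy_family P X.

Let mX t : 0 <= t -> measurable_fun setT (X t).
Proof. exact: (levy_measurable (levy_family_process LF 0)). Qed.

Let mXpre t (B : set R) : 0 <= t -> measurable B -> measurable (X t @^-1` B).
Proof. by move=> t0 mB; rewrite -[X in measurable X]setTI; exact: mX. Qed.

(** A single null set serves all pairs of rational times. If [X s w < X t w] with [s < t],
    right-continuity yields a rational just after [s] and one just after [t] whose values lie on
    either side of the midpoint [m]. *)
Lemma negligible_increments_subordinator :
  (forall s t, 0 <= s -> s <= t -> P 0 [set w | 0 < X t w - X s w] = 0%E) ->
  negative_subordinator P X.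
Proof.
move=> h; have [M [mM M0 hM]] := levy_cadlag (levy_family_process LF 0).
pose r n : rat := odflt 0 (unpickle n).
pose N i j : set Omega := if (0 <= (ratr (r i) : R)) && ((ratr (r i) : R) <= ratr (r j))
  then [set w | 0 < X (ratr (r j)) w - X (ratr (r i)) w] else set0.
have N0 i j : (P 0).-negligible (N i j).
  rewrite /N; case: ifP => [/andP[i0 ij]|_]; last exact: negligible_set0.
  apply/negligibleP; last exact: h.
  have := measurable_increment LF i0 (le_trans i0 ij).
  move=> /(_ measurableT _ (measurable_itv `]0, +oo[)); rewrite setTI.
  by congr measurable; apply/seteqP; split => w /=; rewrite in_itv/= andbT.
have : (P 0).-negligible (M `|` \bigcup_i \bigcup_j N i j).
  apply: negligibleU; first by apply/negligibleP.
  by apply: negligible_bigcup => i; apply: negligible_bigcup => j.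
apply: negligibleS => w hw; apply: contrapT => /not_orP[Mw Nw].
apply: hw => s t /andP[s0].
rewrite le_eqVlt => /predU1P[->//|st]; rewrite leNgt; apply/negP => lt_X.
have cf : cadlag (X ^~ w) by apply: contrapT => /hM.
have t0 : 0 <= t by rewrite (le_trans s0)// ltW.
pose m := (X s w + X t w) / 2.
have sm : X s w < m by rewrite midf_lt.
have mt : m < X t w by rewrite midf_lt.
have [q [sq qt qm]] : exists q : rat, [/\ s < ratr q, ratr q < t & X (ratr q) w < m].
  have /cvgr_lt /(_ _ sm)[e /= e0 he] := cf.1 _ s0.
  have /rat_in_itvoo[q] : s < Num.min (s + e) t by rewrite lt_min st ltrDl e0.
  rewrite in_itv/= lt_min => /andP[sq /andP[qe qt]]; exists q; split => //.
  by apply: he => //=; rewrite ltr0_norm ?subr_lt0// opprB ltrBlDl.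
have [q' [tq' q'm]] : exists q' : rat, t < ratr q' /\ m < X (ratr q') w.
  have /cvgr_gt /(_ _ mt)[e /= e0 he] := cf.1 _ t0.
  have /rat_in_itvoo[q'] : t < t + e by rewrite ltrDl e0.
  rewrite inE/= => /andP[tq' q'e]; exists q'; split => //.
  by apply: he => //=; rewrite ltr0_norm ?subr_lt0// opprB ltrBlDl.
apply: Nw; exists (pickle q) => //; exists (pickle q') => //.
rewrite /N /r !pickleK/= (le_trans s0 (ltW sq)) (ltW (lt_trans qt tq'))/=.
by rewrite subr_gt0 (lt_trans qm).
Qed.

(** Some increment over a time [u] exceeds some [e > 0] with positive probability; by independence
    and stationarity, so do [n] of them in a row, and [e *+ n] passes [c]. *)
Lemma reaches_high (c : R) : ~ negative_subordinator P X ->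
  exists2 T, 0 < T & (0 < P 0 [set w | (c < X T w)%R])%E.
Proof.
move=> hns.
have [u u0 Pu] : exists2 u, 0 < u & (0 < P 0 [set w | (0 < X u w)%R])%E.
  apply: contrapT => hu; apply: hns; apply: negligible_increments_subordinator => s t s0.
  rewrite le_eqVlt => /predU1P[->|st].
    by rewrite (_ : [set _ | _] = set0) ?measure0//;
       apply/seteqP; split => // w /=; rewrite subrr ltxx.
  rewrite -[LHS]/(P 0 [set w | [set z | 0 < z] (X t w - X s w)]).
  have mp : measurable [set z : R | 0 < z].
    rewrite (_ : [set _ | _] = `]0, +oo[%classic); first exact: measurable_itv.
    by apply/seteqP; split => w /=; rewrite in_itv/= andbT.
  rewrite (increment_law LF) ?s0 ?(ltW st)//.
  apply/eqP; rewrite -measure_le0 leNgt; apply/negP => Pts.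
  by apply: hu; exists (t - s) => //; rewrite subr_gt0.
have mgt (t z : R) : 0 <= t -> measurable [set w | z < X t w].
  move=> t0; rewrite (_ : [set _ | _] = X t @^-1` `]z, +oo[).
    by apply: mXpre => //; exact: measurable_itv.
  by apply/seteqP; split => w /=; rewrite in_itv/= andbT.
have [e e0 Pe] : exists2 e, 0 < e & (0 < P 0 [set w | (e < X u w)%R])%E.
  apply: contrapT => he; move: Pu; apply/negP; rewrite -leNgt measure_le0.
  apply/eqP; apply: measure_negligible; first exact: mgt (ltW u0).
  have sub : [set w | 0 < X u w] `<=` \bigcup_n [set w | n.+1%:R^-1 < X u w].
    move=> w /= Xw; exists (Num.truncn (X u w)^-1) => //=.
    by rewrite -[ltRHS]invrK ltf_pV2 ?posrE ?invr_gt0//; exact: truncnS_gt.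
  apply: (negligibleS sub).
  apply: negligible_bigcup => n; apply/negligibleP; first exact: mgt (ltW u0).
  apply/eqP; rewrite -measure_le0 leNgt; apply/negP => Pn.
  by apply: he; exists (n.+1%:R^-1).
(* The half-line is closed so that [E 0] contains every path started at 0. *)
pose E n : set Omega := X (u *+ n) @^-1` `[e *+ n, +oo[.
have un0 n : 0 <= u *+ n by rewrite mulrn_wge0// ltW.
have PE n : (0 < P 0 (E n))%E.
  elim: n => [|n IH].
    apply: (@lt_le_trans _ _ 1%E) => //.
    rewrite -(levy_start (levy_family_process LF 0)).
    apply: le_measure; rewrite ?inE; [|apply: mXpre => //; exact: measurable_itv|].
      exact: (mXpre (lexx 0) (measurable_set1 0)).
    by move=> w /= X0; rewrite /E/= !mulr0n X0 in_itv/= lexx.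
  pose F := E n `&` [set w | `]e, +oo[%classic (X (u *+ n.+1) w - X (u *+ n) w)].
  have mE k : measurable (E k) by apply: mXpre => //; exact: measurable_itv.
  have mF : measurable F.
    apply: measurableI => //; rewrite -[X in measurable X]setTI.
    apply: (measurable_increment LF (un0 n) (un0 n.+1)) => //; exact: measurable_itv.
  apply: (@lt_le_trans _ _ (P 0 F)); last first.
    apply: le_measure; rewrite ?inE// => w []; rewrite /E/= !in_itv/= !andbT => En.
    rewrite ltrBrDl => /ltW; apply: le_trans; by rewrite [leLHS]mulrSr lerD2r.
  have un : 0 <= u *+ n <= u *+ n.+1.
    by rewrite un0 mulrSr lerDl ltW.
  have FE : natural_filtration X (u *+ n) (E n).
    apply: sub_sigma_algebra; exists (u *+ n), (`[e *+ n, +oo[%classic).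
    by split => //; rewrite un0 lexx.
  have mI : measurable (`]e, +oo[%classic : set R) by exact: measurable_itv.
  rewrite /F (levy_indep_increments (levy_family_process LF 0) un FE mI).
  rewrite (increment_law LF)//; apply: mule_gt0 => //.
  rewrite mulrSr addrAC subrr add0r.
  rewrite (_ : _ @^-1` _ = [set w | e < X u w])//.
  by apply/seteqP; split => w /=; rewrite in_itv/= andbT.
pose n := (Num.truncn (`|c| / e)).+1.
have cn : c < e *+ n.
  apply: (le_lt_trans (ler_norm c)); rewrite -mulr_natl -ltr_pdivrMr//.
  exact: truncnS_gt.
exists (u *+ n); first by rewrite mulrn_wgt0.
apply: (lt_le_trans (PE n)); apply: le_measure; rewrite ?inE.
- by apply: mXpre => //; exact: measurable_itv.
- exact: mgt.
- by move=> w; rewrite /E/= in_itv/= andbT; exact: lt_le_trans.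
Qed.

(** Otherwise times tending to 0 would carry moves larger than 1 with probability above [c]. By
    right-continuity at 0 almost every path eventually avoids such moves, and Fatou's lemma would
    give [1 <= 1 - c]. *)
Lemma small_time_small_move (c : R) : 0 < c ->
  exists e, [/\ 0 < e, e <= 1 & forall u, 0 <= u <= e ->
    (P 0 [set w | (1 < `|X u w|)%R] <= c%:E)%E].
Proof.
move=> c0; apply: contrapT => hn.
have : forall n, exists u, 0 <= u <= n.+1%:R^-1 /\ (c%:E < P 0 [set w | (1 < `|X u w|)%R])%E.
  move=> n; apply: contrapT => hu; apply: hn; exists n.+1%:R^-1; split => //.
  - by rewrite invf_le1// ler1n.
  - by move=> u u01; rewrite leNgt; apply/negP => hc; apply: hu; exists u.
move=> /choice[u hu].
have u0 n : 0 <= u n by have [/andP[]] := hu n.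
have ucv : u n @[n --> \oo] --> 0.
  apply: (@squeeze_cvgr _ _ _ _ (fun=> 0) (fun n => n.+1%:R^-1)).
  - by apply: nearW => n; have [] := hu n.
  - exact: cvg_cst.
  - exact: cvg_harmonic.
have [M [mM M0 hM]] := levy_cadlag (levy_family_process LF 0).
have mstart : measurable [set w | X 0 w = 0].
  exact: (mXpre (lexx 0) (measurable_set1 0)).
have mbig n : measurable [set w | 1 < `|X (u n) w|].
  rewrite -[X in measurable X]setTI.
  have mn := @normr_measurable R setT.
  have := measurableT_comp mn (mX (u0 n)).
  move=> /(_ measurableT _ (measurable_itv `]1, +oo[)).
  by congr measurable; apply/seteqP; split => w /=; rewrite in_itv/= andbT.
pose F n := ~` [set w | 1 < `|X (u n) w|].
pose S0 := [set w | X 0 w = 0].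
have : (P 0%R (S0 `\` M) <= (1 - c)%:E)%E.
  apply: (@measure_liminf_le _ _ _ (P 0) _ F).
  - exact: measurableD.
  - by move=> n; exact: measurableC.
  - move=> w [/= X0 Mw]; have cf : cadlag (X ^~ w) by apply: contrapT => /hM.
    have cv := cvg_seq_right (cf.1 _ (lexx 0)) u0 ucv.
    move: cv; rewrite X0 => /cvgr0Pnorm_lt /(_ _ ltr01).
    by apply: filterS => n Xn /=; rewrite /F/= ltNge (ltW Xn).
  - move=> n; have FE : P 0 (F n) = (1 - P 0 [set w | (1 < `|X (u n) w|)%R])%E.
      by rewrite probability_setC.
    apply: (@le_trans _ _ (1 - P 0 [set w | (1 < `|X (u n) w|)%R])%E); first by rewrite -FE.
    by rewrite EFinB leeB//; have [_ /ltW] := hu n.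
have -> : P 0 (S0 `\` M) = 1%E.
  have i0 : P 0 (S0 `&` M) = 0%E.
    apply/eqP; rewrite -measure_le0 -M0; apply: le_measure; rewrite ?inE//.
    exact: measurableI.
  rewrite measureD//; last by rewrite -ge0_fin_numE// fin_num_measure.
  rewrite [X in (_ - X)%E](_ : _ = 0%E) ?sube0//.
  exact: (levy_start (levy_family_process LF 0)).
by rewrite lee_fin lerBrDl gerDr leNgt c0.
Qed.

End levy_estimates.

Section shifted_path.
Context {R : realType}.
Variables (f g : R -> R) (t : R).
Hypotheses (t0 : 0 < t) (gf : forall u, 0 <= u -> g u = f (u + t)).

Lemma cvg_right_shift (s l : R) : 0 <= s -> f @ (s + t)^'+ --> l -> g @ s^'+ --> l.
Proof.
move=> s0 /cvgrPdist_lt fl; apply/cvgrPdist_lt => e e0.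
have [r /= r0 h] := fl _ e0; exists r => //= u /= ur su.
rewrite gf; last by rewrite (le_trans s0)// ltW.
apply: h => /=; last by rewrite ltrD2r.
by rewrite opprD addrACA subrr addr0.
Qed.

Lemma cvg_left_shift (s l : R) : 0 < s -> f @ (s + t)^'- --> l -> g @ s^'- --> l.
Proof.
move=> s0 /cvgrPdist_lt fl; apply/cvgrPdist_lt => e e0.
(* The minimum with [s] keeps [u] positive, where [gf] applies. *)
have [r /= r0 h] := fl _ e0; exists (Num.min r s); first by rewrite /= lt_min r0.
move=> u /=; rewrite lt_min => /andP[ur us] su.
rewrite gf; last first.
  by move: us; rewrite gtr0_norm ?subr_gt0// gtrDl oppr_lt0 => /ltW.
apply: h => /=; last by rewrite ltrD2r.
by rewrite opprD addrACA subrr addr0.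
Qed.

Lemma cadlag_shift : cadlag f -> cadlag g.
Proof.
move=> [fr fl]; split => s s0.
  rewrite gf//; apply: cvg_right_shift => //; apply: fr.
  by rewrite addr_ge0// ltW.
have /cvg_ex[l fll] := fl _ (addr_gt0 s0 t0).
by apply/cvg_ex; exists l; exact: cvg_left_shift.
Qed.

Lemma no_positive_jumps_shift : cadlag f -> no_positive_jumps f ->
  no_positive_jumps g.
Proof.
move=> [fr fl] fj s s0; have st0 := addr_gt0 s0 t0.
rewrite gf ?(ltW s0)//; apply: (le_trans (fj _ st0)).
rewrite /left_lim; have fll := fl _ st0.
by rewrite (cvg_lim _ (cvg_left_shift s0 fll)).
Qed.

End shifted_path.

Section gaussian_null_sets.
Context {R : realType}.

(** The Gaussian density vanishes nowhere. *)
Lemma gaussian_null (D : set R) : measurable D ->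
  normal_prob (0 : R) 1 D = 0%E -> lebesgue_measure D = 0%E.
Proof.
move=> mD; rewrite /normal_prob => D0.
have mD' : measurable (D : set (measurableTypeR R)) by [].
have mf : measurable_fun (D : set (measurableTypeR R))
    (fun x : measurableTypeR R => (normal_pdf 0 1 x)%:E).
  by apply: measurable_funTS; apply/measurable_EFinP; exact: measurable_normal_pdf.
have [+ _] := @ae_eq_integral_abs _ (measurableTypeR R) _ lebesgue_measure D mD' _ mf.
have e : (\int[lebesgue_measure]_(x in D) `|(normal_pdf (0 : R) 1 x)%:E| = 0)%E.
  rewrite -[RHS]D0; apply: eq_integral => x _.
  by rewrite gee0_abs// lee_fin normal_pdf_ge0.
move=> /(_ e) [N [mN N0 h]].
apply/eqP; rewrite -measure_le0 -N0; apply: le_measure; rewrite ?inE//.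
move=> x Dx; apply: h => /= /(_ Dx) [] /eqP; apply/negP.
by rewrite normal_pdfE ?oner_neq0// mulf_neq0// gt_eqF// ?normal_peak_gt0 ?oner_neq0// expR_gt0.
Qed.

(** The identity carries [normal_prob] from [measurableTypeR R] to [R], the type of the initial laws
    in [augmented_filtration]. *)
Definition gaussian_law : probability R R :=
  distribution (normal_prob (0 : R) 1)
    (HB.pack_for {mfun measurableTypeR R >-> R} (id : measurableTypeR R -> R)
      (isMeasurableFun.Build _ _ (measurableTypeR R) R id
         (@measurable_id _ R setT))).

Lemma gaussian_integral_null (f : R -> \bar R) : measurable_fun setT f ->
  (forall x, 0 <= f x)%E -> (\int[gaussian_law]_x f x = 0)%E ->
  (\int[lebesgue_measure]_x f x = 0)%E.
Proof.
move=> mf f0 If.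
have [+ _] := @ae_eq_integral_abs _ R _ gaussian_law setT measurableT f mf.
have e : (\int[gaussian_law]_x `|f x| = 0)%E.
  by rewrite -[RHS]If; apply: eq_integral => x _; rewrite gee0_abs.
move=> /(_ e) [N [mN N0 h]].
have [_ +] := @ae_eq_integral_abs _ (measurableTypeR R) _ lebesgue_measure setT measurableT f mf.
move=> H; transitivity (\int[lebesgue_measure]_x `|f x|)%E.
  by apply: eq_integral => x _; rewrite gee0_abs.
apply: H; exists N; split => //.
exact: gaussian_null.
Qed.

End gaussian_null_sets.

(** * The set of good paths *)

Section good_paths.
Context d {Omega : measurableType d} {R : realType}.
Variables (P : R -> probability Omega R) (X : R -> Omega -> R).
Variables (theta : R -> Omega -> Omega) (OmegaA : set Omega) (A : R -> Omega -> R).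
Hypothesis levyX : spectrally_negative_levy P X.
Hypothesis shiftX : shift_operators X theta.
Hypothesis pcnafA : pcnaf P X theta OmegaA A.

Local Notation LF := (snlp_levy levyX).

(** This set takes the place of [Om0]: it is full under every [P x] and stable under shifts, and on
    it the path properties hold surely. *)
Definition good : set Omega :=
  [set w | [/\ OmegaA w, cadlag (X ^~ w) & no_positive_jumps (X ^~ w)]].

Lemma good_OmegaA : good `<=` OmegaA. Proof. by move=> w []. Qed.

Lemma good_cadlag w : good w -> cadlag (X ^~ w). Proof. by case. Qed.

Lemma good_full x : (P x).-negligible (~` good).
Proof.
have [M1 [mM1 M10 h1]] := levy_cadlag (levy_family_process LF x).
have [M2 [mM2 M20 h2]] := snlp_jumps levyX x.
have : (P x).-negligible (~` OmegaA `|` (M1 `|` M2)).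
  apply: negligibleU; last by apply: negligibleU; exact/negligibleP.
  have mA := pcnaf_measurable pcnafA.
  apply/negligibleP; first exact: measurableC.
  transitivity (1 - P x OmegaA)%E; first exact: probability_setC.
  by rewrite (pcnaf_full pcnafA) subee.
apply: negligibleS => w wg; apply: contrapT => /not_orP[/contrapT wA /not_orP[w1 w2]].
by apply: wg; split => //; apply: contrapT => ?; [apply: w1; exact: h1|apply: w2; exact: h2].
Qed.

Lemma good_shift t w : 0 < t -> good w -> good (theta t w).
Proof.
move=> t0 [wA cw jw].
have gf u : 0 <= u -> X u (theta t w) = X (u + t) w by move=> u0; rewrite shiftX ?(ltW t0).
split.
- by apply: (pcnaf_shift pcnafA t0); exists w.
- exact: (cadlag_shift t0 gf cw).
- exact: (no_positive_jumps_shift t0 gf cw jw).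
Qed.

Lemma good_increasing w : good w -> increasing_path (A ^~ w).
Proof.
move=> [wA _ _]; split.
- by move=> s t; exact: (pcnaf_nondecreasing pcnafA wA).
- by move=> t; exact: (pcnaf_right_continuous pcnafA wA).
Qed.

Lemma good_A0 w : good w -> A 0 w = 0.
Proof. by move=> [wA _ _]; exact: (pcnaf0 pcnafA wA). Qed.

Lemma good_add w (s t : R) : good w -> 0 < s -> 0 < t ->
  A (s + t) w = A t w + A s (theta t w).
Proof. by move=> [wA _ _]; exact: (pcnaf_additive pcnafA wA). Qed.

(* Adaptedness for the initial law N(0, 1) provides exceptional sets that are
   null under P_x for Lebesgue-almost every x. *)
Lemma good_adapted t : 0 <= t ->
  measurable_fun setT (A t : past_aug_type LF good t -> R).
Proof.
move=> t0 _ B mB; rewrite setTI past_aug_measurableE.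
have [E aE AE] := pcnaf_adapted pcnafA t0 mB.
have [E' [N [FE' nN N0 EE']]] := aE gaussian_law.
exists E', N; split => //.
  split => //; rewrite path_measureE.
  exact: (gaussian_integral_null (measurable_law LF nN)).
move=> w [wA _ _] Nw.
have AEw : B (A t w) <-> E w.
  have : (OmegaA `&` A t @^-1` B) w <-> (OmegaA `&` E) w by rewrite AE.
  by rewrite /=; tauto.
rewrite /= AEw; split => [Ew|E'w]; apply: contrapT => h; apply: Nw; apply: EE'.
  by left.
by right.
Qed.

End good_paths.

(** * Bounds on the functional from one climb of the path *)

Section local_bounds.
Context d {Omega : measurableType d} {R : realType}.
Variables (P : R -> probability Omega R) (X : R -> Omega -> R).
Variables (theta : R -> Omega -> Omega) (OmegaA : set Omega) (A : R -> Omega -> R).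
Hypothesis levyX : spectrally_negative_levy P X.
Hypothesis shiftX : shift_operators X theta.
Hypothesis pcnafA : pcnaf P X theta OmegaA A.

Local Notation LF := (snlp_levy levyX).
Local Notation good := (good X OmegaA).

Let mX t : 0 <= t -> measurable_fun setT (X t).
Proof. exact: (levy_measurable (levy_family_process LF 0)). Qed.

(** Adaptedness for the Dirac mass at [x] gives exceptional sets that are null for this very
    starting point. *)
Lemma good_version (x t : R) (B : set R) : 0 <= t -> measurable B ->
  exists G N, [/\ natural_sigma_algebra X G, natural_sigma_algebra X N, P x N = 0%E &
    forall w, OmegaA w -> ~ N w -> (B (A t w) <-> G w)].
Proof.
move=> t0 mB.
have [E aE AE] := pcnaf_adapted pcnafA t0 mB.
have [E' [N [FE' nN N0 EE']]] := aE \d_x.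
exists E', N; split => //.
- exact: past_sub_path FE'.
- by move: N0; rewrite integral_dirac ?diracT ?mul1e//; exact: (measurable_law LF nN).
- move=> w wA Nw.
  have AEw : B (A t w) <-> E w.
    have : (OmegaA `&` A t @^-1` B) w <-> (OmegaA `&` E) w by rewrite AE.
    by rewrite /=; tauto.
  rewrite AEw; split => [Ew|E'w]; apply: contrapT => h; apply: Nw; apply: EE'.
    by left.
  by right.
Qed.

Lemma good_start a : exists Om1, [/\ measurable Om1, P a (~` Om1) = 0%E &
  forall w, Om1 w -> good w /\ X 0 w = a].
Proof.
have [M [mM M0 h]] := good_full levyX pcnafA a.
have m0 : measurable [set w | X 0 w = a].
  by rewrite -[X in measurable X]setTI; exact: (mX (lexx 0) measurableT (measurable_set1 a)).
have P0 : P a (~` [set w | X 0 w = a]) = 0%E.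
  transitivity (1 - P a [set w | X 0 w = a])%E; first exact: probability_setC.
  by rewrite (levy_start (levy_family_process LF a)) subee.
exists (~` (M `|` ~` [set w | X 0 w = a])); split.
- by apply: measurableC; apply: measurableU => //; exact: measurableC.
- rewrite setCK; apply: measure_negligible; first by apply: measurableU => //; exact: measurableC.
  by apply: negligibleU; apply/negligibleP => //; exact: measurableC.
- move=> w /not_orP[Mw /contrapT X0]; split => //.
  by apply: contrapT => /h.
Qed.

(** As [A (T + 1)] is finite on good paths, some integer bound keeps positive probability. The extra
    unit of time leaves room for a window of length at most 1 after a passage before [T]. The
    representatives [G n] and [N n] serve to make [W] measurable. *)
Lemma bounded_climb (a b : R) : exists T M W,
  [/\ 0 < T, 0 <= M, measurable W, (0 < P a W)%E & forall w, W w ->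
    [/\ good w, X 0 w = a, b < X T w & A (T + 1) w <= M]].
Proof.
have [T T0 PT] := reaches_high LF (b - a) (snlp_not_subordinator levyX).
have T10 : 0 <= T + 1 by rewrite addr_ge0// ltW.
have [Om1 [mOm1 Om10 Om1P]] := good_start a.
have mI (c : R) : measurable (`]-oo, c]%classic : set R) by exact: measurable_itv.
have [G /choice [N h]] := choice (fun n : nat => good_version a T10 (mI n%:R)).
have mN n : measurable (N n) by have [_ nN _ _] := h n; exact: (path_sub_measurable LF nN).
have mG n : measurable (G n) by have [nG _ _ _] := h n; exact: (path_sub_measurable LF nG).
have mgt : measurable [set w | b < X T w].
  rewrite (_ : [set _ | _] = X T @^-1` `]b, +oo[).
    by rewrite -[X in measurable X]setTI; apply: (mX (ltW T0)) => //; exact: measurable_itv.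
  by apply/seteqP; split => w /=; rewrite in_itv/= andbT.
have Pgt : (0 < P a [set w | (b < X T w)%R])%E.
  have -> : [set w | b < X T w] = X T @^-1` `]b, +oo[.
    by apply/seteqP; split => w /=; rewrite in_itv/= andbT.
  rewrite (levy_law1 LF); [|exact: ltW|exact: measurable_itv].
  rewrite (_ : [set _ | _] = [set w | b - a < X T w])//.
  by apply/seteqP; split => w /=; rewrite in_itv/= andbT ltrBlDl.
pose W n := (Om1 `&` [set w | b < X T w]) `&` (G n `\` N n).
have mW n : measurable (W n).
  by apply: measurableI; [exact: measurableI|exact: measurableD].
suff [n Wn] : exists n, (0 < P a (W n))%E.
  exists T, n%:R, (W n); split => // w [[w1 bw] [Gw Nw]].
  have [wg X0] := Om1P _ w1; split => //.
  have [_ _ _ /(_ w (good_OmegaA wg) Nw)[_ /(_ Gw)]] := h n.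
  by rewrite /= in_itv.
apply: contrapT => hn; move: Pgt; apply/negP; rewrite -leNgt measure_le0.
apply/eqP; apply: measure_negligible => //.
apply: (@negligibleS _ _ _ (P a) (~` Om1 `|` \bigcup_n (N n `|` W n))).
  move=> w /= bw; apply: contrapT => /not_orP[/contrapT w1 hw].
  have [wg X0] := Om1P _ w1.
  have Nw n : ~ N n w by move=> ?; apply: hw; exists n => //; left.
  pose n := (Num.truncn (A (T + 1) w)).+1.
  apply: hw; exists n => //; right; split => //; split => //.
  have [_ _ _ /(_ w (good_OmegaA wg) (Nw n))[+ _]] := h n; apply.
  by rewrite /= in_itv/= ltW// truncnS_gt.
apply: negligibleU; first by apply/negligibleP => //; exact: measurableC.
apply: negligible_bigcup => n; apply: negligibleU.
  by apply/negligibleP => //; have [] := h n.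
apply/negligibleP => //; apply/eqP; rewrite -measure_le0 leNgt.
by apply/negP => ?; apply: hn; exists n.
Qed.

Section climb.
Variables (a b T M : R) (W : set Omega).
Hypotheses (T0 : 0 < T) (mW : measurable W).
Hypothesis WP : forall w, W w ->
  [/\ good w, X 0 w = a, b < X T w & A (T + 1) w <= M].

(* The path passes through y continuously, so that A charges y on the way up. *)
Lemma jump_bound (fA : R -> R) y : (forall w (t : R), OmegaA w -> 0 < t ->
    A t w - left_lim (A ^~ w) t = fA (X t w)) ->
  W !=set0 -> a < y < b -> fA y <= M.
Proof.
move=> jA [w Ww] /andP[ay yb]; have [wg X0 bX AM] := WP Ww.
have [wA cf jf] := wg.
have f0 : X 0 w < y by rewrite X0.
have yX : y < X T w by exact: lt_trans bX.
have tau0 := passage_time_gt0 cf f0 (ltW T0) yX.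
have tauT := passage_time_lt cf jf f0 (ltW T0) (lexx T) yX.
have Xtau := passage_value cf jf f0 (ltW T0) yX.
have := jA w _ wA tau0; rewrite Xtau => <-.
have ia := good_increasing pcnafA wg.
have : 0 <= left_lim (A ^~ w) (passage_time (X ^~ w) y).
  rewrite -(good_A0 pcnafA wg); apply: left_lim_ge => //.
  by rewrite lexx.
have : A (passage_time (X ^~ w) y) w <= A (T + 1) w.
  apply: (ia.1); rewrite (ltW tau0)/= (le_trans (ltW tauT))// lerDl//.
by move: AM; lra.
Qed.

(** On [W] the path passes [y] before [T], and over a time [e <= 1] afterwards [A] grows by at most
    [A (T + 1) w <= M]. The strong Markov property at that passage turns this into a bound free of
    [y] and [e]. *)
Lemma climb_bound y e G N : a < y < b -> 0 < e <= 1 ->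
  natural_sigma_algebra X G -> natural_sigma_algebra X N -> P y N = 0%E ->
  (forall w, good w -> ~ N w -> A e w <= M -> G w) ->
  (P a W <= P y G)%E.
Proof.
move=> /andP[ay yb] /andP[e0 e1] nG nN N0 GN.
have [Om1 [mOm1 Om10 Om1P]] := good_start a.
have Om1P' w : Om1 w -> [/\ cadlag (X ^~ w), no_positive_jumps (X ^~ w) & X 0 w = a].
  by move=> /Om1P[[_ cf jf] X0].
(* Enlarging [G] by [N] spares the shifted path from having to avoid [N], and adds nothing to the
   probability under [P y]. *)
have nU : natural_sigma_algebra X (G `|` N) by exact: (@measurableU _ (path_type X)).
have SM := strong_markov LF shiftX ay T0 mOm1 Om10 Om1P' nU.
set D := passage_event X y T Om1 in SM.
set S := _ `&` _ in SM.
have mD : measurable D by exact: (measurable_passage_event LF y T0 mOm1).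
have mS : measurable S.
  exact: (measurable_after LF shiftX ay T0 mOm1 Om1P' mD nU).
have mG : measurable G := path_sub_measurable LF nG.
have mN : measurable N := path_sub_measurable LF nN.
apply: (@le_trans _ _ (P a (S `|` ~` Om1))).
  apply: le_measure; rewrite ?inE//.
    by apply: measurableU => //; exact: measurableC.
  move=> w Ww; have [wg X0 bX AM] := WP Ww.
  have [w1|w1] := pselect (Om1 w); last by right.
  left; have Dw : D w.
    (* The coarsest grid consists of the times 0 and [T], and the path is above [y] at [T]. *)
    split => //; exists 0%N => //=; rewrite /passage_index.
    rewrite -[X in (_ < X)%N](size_iota 0) -has_find; apply/hasP; exists 1%N => //.
    by rewrite divr1 mulr1 (lt_trans yb).
  split => //=.
  have [/andP[tau0 tauT] Xtau] := passage_eventP ay T0 Om1P' Dw.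
  have wt := good_shift shiftX pcnafA tau0 wg.
  have [|Nw] := pselect (N (theta (passage_time (X ^~ w) y) w)); first by right.
  left; apply: GN => //.
  have ia := good_increasing pcnafA wg.
  have := good_add pcnafA wg e0 tau0.
  have : 0 <= A (passage_time (X ^~ w) y) w.
    by rewrite -(good_A0 pcnafA wg); apply: (ia.1); rewrite lexx ltW.
  have : A (e + passage_time (X ^~ w) y) w <= A (T + 1) w.
    apply: (ia.1); move: e0 e1 tau0 tauT; lra.
  by move: AM; lra.
apply: (le_trans (measureU2 _ _ _)) => //; first exact: measurableC.
rewrite [X in (_ + X)%E](_ : _ = 0%E)// adde0 [X in (X <= _)%E](_ : _ = (P a D * P y (G `|` N))%E)//.
apply: (@le_trans _ _ (P y (G `|` N))).
  rewrite -[leRHS]mul1e; apply: lee_wpmul2r => //; exact: probability_le1.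
apply: (le_trans (measureU2 _ _ _)) => //.
by rewrite [X in (_ + X)%E](_ : _ = 0%E)// adde0.
Qed.

End climb.

End local_bounds.

(** Induction on the length of a final segment of the indices: if its first index satisfies [H], the
    two bounds conclude at once; otherwise this index contributes nothing. *)
Lemma sum_after_first_le (R : realDomainType) (z : nat -> R) (H : pred nat) (c d : R) n :
  (forall k, 0 <= z k) -> 0 <= c -> 0 <= d ->
  (forall k, (k < n)%N -> H k -> z k <= c) ->
  (forall k, (k < n)%N -> H k -> \sum_(k.+1 <= j < n) z j <= d) ->
  \sum_(0 <= k < n | H k) z k <= c + d.
Proof.
move=> z0 c0 d0 zc zd.
suff S m : (m <= n)%N -> \sum_(n - m <= k < n | H k) z k <= c + d.
  by have := S n (leqnn n); rewrite subnn.
elim: m => [_|m IH mn]; first by rewrite subn0 big_geq// addr_ge0.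
have kn : (n - m.+1 < n)%N by rewrite ltn_subrL (leq_ltn_trans _ mn).
rewrite big_ltn_cond// (subnSK mn); case: ifPn => [Hk|_]; last exact: IH (ltnW mn).
apply: lerD; first exact: zc.
apply: le_trans (zd _ kn Hk); rewrite (subnSK mn) [leRHS](bigID H)/= lerDl.
exact: sumr_ge0.
Qed.

(** * Discretisation of the functional along a grid *)

Section grid_estimate.
Context d {Omega : measurableType d} {R : realType}.
Variables (P : R -> probability Omega R) (X : R -> Omega -> R).
Variables (theta : R -> Omega -> Omega) (OmegaA : set Omega) (A : R -> Omega -> R).
Hypothesis levyX : spectrally_negative_levy P X.
Hypothesis shiftX : shift_operators X theta.
Hypothesis pcnafA : pcnaf P X theta OmegaA A.

Local Notation LF := (snlp_levy levyX).
Local Notation good := (good X OmegaA).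
Local Notation augT := (aug_type LF good).
Local Notation timeT := (measurableTypeR R).

Variable Q : {measure set augT -> \bar R}.
Hypothesis QE : forall (E G N : set Omega), natural_sigma_algebra X G ->
  null_event LF N -> agree good E G N -> Q E = path_measure LF G.

Let good_theta t w : 0 < t -> good w -> good (theta t w).
Proof. exact: (good_shift shiftX pcnafA). Qed.

Let mgood_past t : measurable (good : set (past_aug_type LF good t)).
Proof.
rewrite past_aug_measurableE; exists setT, set0; split => //.
- exact: (@measurableT _ (past_type X t)).
- exact: null_event0.
Qed.

Let mA_past s t : 0 <= s <= t ->
  measurable_fun setT (A s : past_aug_type LF good t -> R).
Proof.
move=> /andP[s0 st] _ B mB; have := @good_adapted _ _ _ _ _ _ _ _ levyX pcnafA _ s0 measurableT _ mB.
by rewrite !setTI; exact: past_aug_mono st.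
Qed.

Section grid_bound.
Variables (e c M : R) (K1 K2 : set R).
Hypotheses (e0 : 0 < e) (c0 : 0 < c) (M0 : 0 <= M).
Hypotheses (mK1 : measurable K1) (mK2 : measurable K2).

(** Read on the path shifted by a grid time [t], [X (e - t)] is the position at the fixed time [e],
    common to all grid times. *)
Definition stays t : set Omega := [set w | A e w <= M /\ K2 (X (e - t) w)].

Hypothesis stays_ge : forall t, 0 < t <= e -> exists G N,
  [/\ natural_sigma_algebra X G, null_event LF N, agree good (stays t) G N &
   forall y, K1 y -> P y N = 0%E -> (c%:E <= P y G)%E].

Let mstays t : 0 < t <= e -> measurable (stays t : set augT).
Proof.
by move=> /stays_ge[G [N [nG nN GN _]]]; rewrite aug_measurableE; exists G, N.
Qed.

Definition increment (h : R) k w : R := A (h * k.+1%:R) w - A (h * k%:R) w.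

Definition small_increment h k : set Omega :=
  good `&` [set w | increment h k w <= M + 1].

Definition truncated_increment h k : Omega -> \bar R :=
  ((EFin \o increment h k) \_ (small_increment h k))%E.

Local Notation z := increment.
Local Notation Z := truncated_increment.

Let z_ge0 h k w : 0 < h -> good w -> 0 <= z h k w.
Proof.
move=> h0 wg; rewrite subr_ge0; apply: (good_increasing pcnafA wg).1.
by rewrite mulr_ge0 ?(ltW h0)//= ler_pM2l// ler_nat.
Qed.

Lemma truncated_increment_ge0 h k w : 0 < h -> (0 <= Z h k w)%E.
Proof.
by move=> h0; apply: erestrict_ge0 => {}w [wg _]; rewrite lee_fin z_ge0.
Qed.

Lemma measurable_increment_past h k : 0 < h ->
  measurable_fun setT (z h k : past_aug_type LF good (h * k.+1%:R) -> R).
Proof.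
move=> h0; apply: measurable_funB; apply: mA_past.
  by rewrite lexx mulr_ge0// ltW.
by rewrite mulr_ge0 ?(ltW h0)//= ler_pM2l// ler_nat.
Qed.

Lemma measurable_small_increment h k : 0 < h ->
  measurable (small_increment h k : set (past_aug_type LF good (h * k.+1%:R))).
Proof.
move=> h0; apply: measurableI; first exact: mgood_past.
rewrite (_ : [set _ | _] = z h k @^-1` `]-oo, M + 1]); last first.
  by apply/seteqP; split => w /=; rewrite in_itv.
rewrite -[X in measurable X]setTI; apply: (measurable_increment_past h0); first exact: measurableT.
exact: measurable_itv.
Qed.

Lemma measurable_truncated_increment h k : 0 < h ->
  measurable_fun setT (Z h k : past_aug_type LF good (h * k.+1%:R) -> \bar R).
Proof.
move=> h0.
have [H _] := @measurable_restrictT _ _ (past_aug_type LF good (h * k.+1%:R)) _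
  (small_increment h k) (EFin \o z h k) (measurable_small_increment h0).
apply: H; apply: measurable_funTS; apply/measurable_EFinP.
exact: measurable_increment_past.
Qed.

Local Notation h n := (e / n.+1%:R).

Let h0 n : 0 < h n. Proof. by rewrite divr_gt0. Qed.

Let hn n : h n * n.+1%:R = e. Proof. by rewrite divfK. Qed.

Let hk n k : (k < n.+1)%N -> 0 < h n * k.+1%:R <= e.
Proof.
by move=> kn; rewrite mulr_gt0//= -[leRHS](hn n) ler_pM2l// ler_nat.
Qed.

(** A window of length [e] starting at any grid time reaches past [e], so after the first retained
    increment all remaining ones fit in a growth of at most [M]. The position constraint concerns
    time [e] alone and factors out. *)
Lemma truncated_sum_le n w :
  (\sum_(0 <= k < n.+1) (Z (h n) k \_ (theta (h n * k.+1%:R) @^-1` stays (h n * k.+1%:R))) w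
   <= ((2 * M + 1) * \1_(X e @^-1` K2) w)%:E)%E.
Proof.
have [wg|wg] := pselect (good w); last first.
  rewrite big1 ?lee_fin ?mulr_ge0 ?addr_ge0// ?mulr_ge0// => k _.
  rewrite patchE; case: ifPn => // _; rewrite /Z patchE memNset//.
  by move=> -[].
pose H k := (w \in theta (h n * k.+1%:R) @^-1` stays (h n * k.+1%:R)) && (z (h n) k w <= M + 1).
have EH k : ((Z (h n) k \_ (theta (h n * k.+1%:R) @^-1` stays (h n * k.+1%:R))) w =
    (if H k then z (h n) k w else 0)%:E)%E.
  rewrite patchE /H; case: ifPn => //= _; rewrite /Z patchE.
  have [hz|hz] := boolP (z (h n) k w <= M + 1); first by rewrite mem_set.
  by rewrite memNset// => -[_]; apply/negP.
have HP k : (k < n.+1)%N -> H k ->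
    A (e + h n * k.+1%:R) w - A (h n * k.+1%:R) w <= M /\ K2 (X e w).
  move=> kn /andP[/set_mem[]]; have /andP[k0 ke] := hk kn.
  rewrite shiftX ?subr_ge0 ?(ltW k0)// subrK => AM Xe _; split => //.
  by rewrite (good_add pcnafA)// addrAC subrr add0r.
under eq_bigr do rewrite EH.
rewrite sumEFin lee_fin -big_mkcond/=.
have [Xe|Xe] := pselect (K2 (X e w)); last first.
  rewrite big_nat_cond big1 ?mulr_ge0 ?addr_ge0 ?mulr_ge0//.
  by move=> k /andP[/andP[_ kn]] /HP[].
rewrite indicE mem_set// mulr1 (_ : 2 * M + 1 = (M + 1) + M); last by ring.
apply: sum_after_first_le => //.
- by move=> k; exact: z_ge0.
- by rewrite addr_ge0.
- by move=> k kn /andP[].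
- move=> k kn /(HP _ kn)[AM _]; apply: le_trans AM.
  rewrite (@telescope_sumr _ _ _ (fun k => A (h n * k%:R) w))// hn lerD2r.
  apply: (good_increasing pcnafA wg).1; rewrite (ltW e0)/= lerDl.
  by have /andP[/ltW] := hk kn.
Qed.

(** Each truncated increment is measurable for the past of the right end of its cell, so the Markov
    lower bound applies there term by term; the pathwise bound is then integrated, [X e] having
    Lebesgue law under [Q]. *)
Lemma truncated_grid_bound n :
  (c%:E * \sum_(0 <= k < n.+1)
     \int[Q]_(w in X (h n * k.+1%:R) @^-1` K1) Z (h n) k w
   <= (2 * M + 1)%:E * lebesgue_measure K2)%E.
Proof.
have mH k : (k < n.+1)%N ->
    measurable (theta (h n * k.+1%:R) @^-1` stays (h n * k.+1%:R) : set augT).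
  move=> kn; have /andP[k0 _] := hk kn.
  have := @measurable_theta_aug _ _ _ _ _ LF _ shiftX _ good_theta _ k0 measurableT _ (mstays (hk kn)).
  by rewrite setTI.
rewrite ge0_sume_distrr; last first.
  by move=> k _; apply: integral_ge0 => w _; exact: truncated_increment_ge0.
apply: (@le_trans _ _ (\sum_(0 <= k < n.+1)
    \int[Q]_(w in theta (h n * k.+1%:R) @^-1` stays (h n * k.+1%:R)) Z (h n) k w)%E).
  rewrite big_nat [leRHS]big_nat; apply: lee_sum => k kn.
  have := hk kn => /andP[k0 ke].
  apply: (markov_lower_bound_fun shiftX good_theta QE) => //.
  - exact: ltW.
  - by apply: mstays; rewrite k0.
  - by apply: stays_ge; rewrite k0.
  - exact: measurable_truncated_increment.
  - by move=> w; exact: truncated_increment_ge0.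
rewrite big_nat; under eq_bigr do rewrite integral_mkcond.
rewrite -big_nat big_mkord -(@ge0_integral_sum _ augT R Q setT measurableT); last 2 first.
- move=> k; have [H _] := @measurable_restrictT _ _ augT _ _ (Z (h n) k) (mH k (ltn_ord k)).
  apply: H; apply: measurable_funTS.
  exact: (measurable_past_aug (measurable_truncated_increment (h0 n))).
- move=> k w _; apply: erestrict_ge0 => {}w _; exact: truncated_increment_ge0.
have mX : measurable (X e @^-1` K2 : set augT).
  by apply: path_aug; apply: sub_sigma_algebra; exists e, K2; rewrite (ltW e0).
rewrite -(Q_X QE (ltW e0) mK2).
rewrite -[X in (_ * Q X)%E]setIT -(@integral_indic _ augT R Q setT measurableT _ mX).
rewrite -ge0_integralZl_EFin//; last 2 first.
- by apply/measurable_EFinP; exact: measurable_indic.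
- by rewrite addr_ge0// mulr_ge0.
apply: ge0_le_integral => //.
- move=> w _; apply: sume_ge0 => k _; apply: erestrict_ge0 => {}w _; exact: truncated_increment_ge0.
- apply: emeasurable_sum => k.
  have [H _] := @measurable_restrictT _ _ augT _ _ (Z (h n) k) (mH k (ltn_ord k)).
  apply: H; apply: measurable_funTS.
  exact: (measurable_past_aug (measurable_truncated_increment (h0 n))).
- apply: measurable_funeM; apply/measurable_EFinP; exact: measurable_indic.
- by move=> w _; have := truncated_sum_le n w; rewrite big_mkord.
Qed.

(** The product measure of the cell is the corresponding term of the truncated sum, which turns the
    passage to the limit over grids into Fatou's lemma for sets. *)
Definition cell n k : set (timeT * augT) :=
  `]h n * k%:R, h n * k.+1%:R]%classic `*`
  (small_increment (h n) k `&` X (h n * k.+1%:R) @^-1` K1).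

Let mXK t : 0 <= t -> measurable (X t @^-1` K1 : set augT).
Proof. by move=> t0; apply: path_aug; apply: sub_sigma_algebra; exists t, K1. Qed.

Let msmall n k : measurable (small_increment (h n) k : set augT).
Proof. exact: (past_aug_aug (measurable_small_increment (h0 n))). Qed.

Lemma measurable_cell n k : measurable (cell n k).
Proof.
apply: measurableX; first exact: (measurable_itv `]h n * k%:R, h n * k.+1%:R]).
by apply: measurableI; [exact: msmall|apply: mXK; rewrite mulr_ge0// ltW].
Qed.

Lemma cell_mass (mu : {measure set (timeT * augT) -> \bar R}) n k : (k < n.+1)%N ->
  (forall U, mu U = \int[Q]_(w in good) mass A e [set s | U (s, w)] w)%E ->
  mu (cell n k) = (\int[Q]_(w in X (h n * k.+1%:R) @^-1` K1) Z (h n) k w)%E.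
Proof.
move=> kn muE; rewrite muE integral_mkcond [RHS]integral_mkcond.
have hk0 : 0 <= h n * k%:R by rewrite mulr_ge0// ltW.
have hkS : h n * k%:R <= h n * k.+1%:R by rewrite ler_pM2l// ler_nat.
apply: eq_integral => w _; rewrite !patchE.
have [/set_mem wg|] := boolP (w \in good); last first.
  by move=> /negP wg; case: ifPn => // _; rewrite /Z patchE memNset// => -[/mem_set].
have [wS|wS] := pselect ((small_increment (h n) k `&` X (h n * k.+1%:R) @^-1` K1) w).
  have [wS1 wS2] := wS; rewrite mem_set// /Z patchE mem_set//= /mass.
  rewrite (_ : _ `&` _ = `]h n * k%:R, h n * k.+1%:R]%classic); last first.
    apply/seteqP; split => s /=; first by case=> -[].
    move=> sk; split => //; move: sk; rewrite !in_itv/= => /andP[ks sk].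
    rewrite (le_lt_trans hk0 ks)/= (le_trans sk)//.
    by have /andP[] := hk kn.
  exact: (stieltjes_itv (good_increasing pcnafA wg)).
rewrite /mass (_ : _ `&` _ = set0) ?measure0; last first.
  by apply/seteqP; split => // s [[]].
case: ifPn => // /set_mem wK; rewrite /Z patchE; case: ifPn => // /set_mem wS'.
by exfalso; apply: wS.
Qed.

Lemma revuz_mass_le (K : set R) : measurable K -> K `<=` K1^° ->
  (forall w (t : R), good w -> 0 < t -> K (X t w) ->
    A t w - left_lim (A ^~ w) t <= M) ->
  (revuz_mass Q A K e <= (c^-1 * (2 * M + 1))%:E * lebesgue_measure K2)%E.
Proof.
move=> mK KK1 jA.
have good_inc w : good w -> increasing_path (A ^~ w) by exact: (good_increasing pcnafA).
have mA t : 0 <= t -> measurable_fun setT (A t : past_aug_type LF good t -> R).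
  exact: (@good_adapted _ _ _ _ _ _ _ _ levyX pcnafA).
have [mu muE] := product_measure_exists good_inc mA Q (ltW e0).
pose U : set (timeT * augT) := visits_graph K `&` (`]0, e]%classic `*` setT).
have mU : measurable U.
  apply: measurableI; first exact: (measurable_visits_graph (@good_cadlag _ _ _ X OmegaA) mK).
  by apply: measurableX => //; exact: (measurable_itv `]0, e]).
have -> : revuz_mass Q A K e = mu U.
  rewrite muE; apply: eq_integral => w /set_mem wg.
  rewrite /occupation /mass; congr lebesgue_stieltjes_measure.
  apply/seteqP; split => s /=.
    by move=> [[s0 Ks] se]; split.
  by move=> [[[[s0 _] Ks] _] se]; split.
apply: (@measure_liminf_le _ _ _ mu _ (fun n => \big[setU/set0]_(k < n.+1) cell n k)) => //.
- by move=> n; apply: bigsetU_measurable => k _; exact: measurable_cell.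
- move=> [s w] [[[/= s0 wg] Ks] [/= + _]]; rewrite in_itv/= => /andP[_ se].
  have [Xr _] := good_cadlag wg.
  have ia := good_inc _ wg.
  pose r n := h n * (grid_index (h n) s)%:R.
  pose l n := h n * (grid_index (h n) s).-1%:R.
  have lr n : l n < s <= r n.
    by rewrite /l /r; have [k [-> //]] := grid_indexP (h0 n) s0.
  have rs : r n @[n --> \oo] --> s := grid_cvg e0 s0.
  have ls : l n @[n --> \oo] --> s := grid_cvg_left e0 s0.
  have sr n : s <= r n by have /andP[] := lr n.
  have ltls n : l n < s by have /andP[] := lr n.
  have Xrs := cvg_seq_right (Xr _ (ltW s0)) sr rs.
  have Ars := cvg_seq_right (ia.2 _ (ltW s0)) sr rs.
  have Als := cvg_seq_left (increasing_left_lim ia s0) ltls ls.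
  (* The increment over the cell containing [s] converges to the jump of [A] at [s], at most [M] by
     [jA]; it therefore eventually passes the truncation at [M + 1]. *)
  have AB : A (r n) w - A (l n) w @[n --> \oo] --> A s w - left_lim (A ^~ w) s.
    exact: cvgB Ars Als.
  (* The cell tests [X] at its right end instead of at [s]; the interior of [K1] absorbs the
     difference for fine grids. *)
  have nK : nbhs (X s w) K1 := KK1 _ Ks.
  have small : \forall n \near \oo, A (r n) w - A (l n) w < M + 1.
    have lM : A s w - left_lim (A ^~ w) s < M + 1.
      by apply: (@le_lt_trans _ _ M); [exact: jA|rewrite ltrDl].
    exact: (cvgr_lt _ AB _ lM).
  near=> n.
  have [k [gk /andP[ks sk]]] := grid_indexP (h0 n) s0.
  have kn : (k < n.+1)%N.
    by rewrite -(@ltr_nat R) -(ltr_pM2l (h0 n)) hn (lt_le_trans ks).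
  rewrite -(bigcup_mkord n.+1 (cell n)); exists k => //=.
  have En : r n = h n * k.+1%:R by rewrite /r gk.
  split; first by rewrite /= in_itv/= ks.
  split; last by rewrite /= -En; near: n; exact: Xrs.
  split => //=; have -> : increment (h n) k w = A (r n) w - A (l n) w.
    by rewrite /increment -En /l gk.
  by apply: ltW; near: n.
- move=> n; rewrite EFinM -muleA lee_pdivlMl; last exact: c0.
  apply: le_trans (truncated_grid_bound n); rewrite lee_wpmul2l ?lee_fin ?(ltW c0)//.
  apply: (@le_trans _ _ (\sum_(k < n.+1) mu (cell n k))%E).
    by apply: Boole_inequality => k _; exact: measurable_cell.
  rewrite big_mkord; apply: lee_sum => k _.
  by rewrite (cell_mass (ltn_ord k)).
Unshelve. all: by end_near. Qed.

End grid_bound.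

End grid_estimate.

Section finiteness.
Context d {Omega : measurableType d} {R : realType}.
Variables (P : R -> probability Omega R) (X : R -> Omega -> R).
Variables (theta : R -> Omega -> Omega) (OmegaA : set Omega) (A : R -> Omega -> R).
Hypothesis levyX : spectrally_negative_levy P X.
Hypothesis shiftX : shift_operators X theta.
Hypothesis pcnafA : pcnaf P X theta OmegaA A.

Local Notation LF := (snlp_levy levyX).
Local Notation good := (good X OmegaA).
Local Notation augT := (aug_type LF good).

Variable Q : {measure set augT -> \bar R}.
Hypothesis QE : forall (E G N : set Omega), natural_sigma_algebra X G ->
  null_event LF N -> agree good E G N -> Q E = path_measure LF G.

Lemma small_move_itv (r c y u : R) : 0 <= u -> `|y| <= r ->
  (P 0 [set w | (1 < `|X u w|)%R] <= c%:E)%E ->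
  (P y (~` (X u @^-1` `[(- (r + 1))%R, (r + 1)%R]%classic)) <= c%:E)%E.
Proof.
move=> u0 yr; apply: le_trans.
have mI : measurable (`[- (r + 1), r + 1]%classic : set R) by exact: measurable_itv.
rewrite (preimage_setC (X u)) (levy_law1 LF)//; last exact: measurableC.
have mX := levy_measurable (levy_family_process LF 0) u0.
apply: le_measure; rewrite ?inE.
- have mD : measurable_fun setT (fun w => y + X u w) by exact: measurable_funD.
  by have := mD measurableT _ (measurableC mI); rewrite setTI.
- rewrite (_ : [set _ | _] = (fun w => `|X u w|) @^-1` `]1, +oo[%classic).
    rewrite -[X in measurable X]setTI.
    by apply: (measurableT_comp (@normr_measurable R setT) mX) => //; exact: measurable_itv.
  by apply/seteqP; split => w /=; rewrite in_itv/= andbT.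
- move=> w /=; rewrite in_itv/= => h; rewrite ltNge; apply/negP => Xu; apply: h.
  move: yr Xu; rewrite !ler_norml => /andP[? ?] /andP[? ?].
  by apply/andP; split; lra.
Qed.


Lemma revuz_mass_bounded (K : set R) (r : R) : measurable K ->
  (forall x, K x -> `|x| <= r) ->
  exists2 e, 0 < e & (revuz_mass Q A K e < +oo)%E.
Proof.
(* Each unit added to [r] has a use: [K1] of radius [r + 1] contains [K] in its interior and lies
   strictly between [a] and [b], while [K2], one unit wider than [K1], allows for a move of at most
   1. *)
move=> mK Kr; pose a := - (r + 2); pose b := r + 2.
have [T [M [W [T0 M0 mW PW WP]]]] := bounded_climb levyX pcnafA a b.
have PWfin : P a W \is a fin_num by exact: fin_num_measure.
(* Half of the probability of the climb is set aside for the paths that leave [K2]. *)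
pose c := fine (P a W) / 2.
have PWc : P a W = (c + c)%:E by rewrite -splitr fineK.
have c0 : 0 < c by rewrite divr_gt0// fine_gt0// PW ltey_eq PWfin.
have [e [e0 e1 he]] := small_time_small_move LF c0.
have e01 : 0 < e <= 1 by rewrite e0.
have [fA [_ _ jA]] := pcnaf_jump pcnafA.
have W0 : W !=set0.
  apply/set0P; apply/negP => /eqP W0; by move: PW; rewrite W0 measure0 ltxx.
exists e => //.
pose K1 : set R := `[- (r + 1), r + 1]%classic.
pose K2 : set R := `[- (r + 1 + 1), r + 1 + 1]%classic.
have mK1 : measurable K1 by exact: measurable_itv.
have mK2 : measurable K2 by exact: measurable_itv.
have K1ab y : K1 y -> a < y < b.
  by rewrite /K1/= in_itv/= /a /b; lra.
apply: (@le_lt_trans _ _ ((c^-1 * (2 * M + 1))%:E * lebesgue_measure K2)%E).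
  apply: (revuz_mass_le shiftX pcnafA QE e0 c0 M0 mK1 mK2) => //.
  - move=> t /andP[t0 te].
    have et : 0 <= e - t <= e by rewrite subr_ge0 te lerBlDr lerDl ltW.
    have et0 : 0 <= e - t by case/andP: et.
    have := measurable_past_aug (@good_adapted _ _ _ _ _ _ _ _ levyX pcnafA _ (ltW e0)).
    move=> /(_ measurableT `]-oo, M]%classic (measurable_itv _)).
    rewrite setTI aug_measurableE => -[G [N [nG nN GN]]].
    have nX : natural_sigma_algebra X (X (e - t) @^-1` K2).
      by apply: sub_sigma_algebra; exists (e - t), K2.
    exists (G `&` X (e - t) @^-1` K2), N; split => //.
    + exact: (@measurableI _ (path_type X)).
    + move=> w wg Nw; have := GN w wg Nw.
      by rewrite /stays/= in_itv/=; tauto.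
    + move=> y Ky PN.
      have mG := path_sub_measurable LF nG.
      have mX := path_sub_measurable LF nX.
      have WG : (P a W <= P y G)%E.
        apply: (climb_bound levyX shiftX pcnafA T0 mW WP (K1ab _ Ky) e01 nG nN.1 PN).
        by move=> w wg Nw AM; apply/(GN w wg Nw); rewrite /= in_itv.
      have yr : `|y| <= r + 1 by move: Ky; rewrite /K1/= in_itv/= ler_norml.
      have := small_move_itv et0 yr (he _ et).
      have : (P y G <= P y (G `&` X (e - t) @^-1` K2) +
          P y (~` (X (e - t) @^-1` K2)))%E.
        apply: le_trans (measureU2 _ _ _); last 2 first.
        * exact: measurableI.
        * exact: measurableC.
        apply: le_measure; rewrite ?inE//.
          by apply: measurableU; [exact: measurableI|exact: measurableC].
        move=> w Gw; have [|] := pselect ((X (e - t) @^-1` K2) w); [left|right] => //.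
      (* Of the probability [c + c] granted by the climb, at most [c] is lost to paths outside [K2]
         at time [e - t]. *)
      move=> PG /(leeD2l (P y (G `&` X (e - t) @^-1` K2))) PG2.
      have := le_trans WG (le_trans PG PG2).
      by rewrite PWc EFinD => h; rewrite -(@leeD2rE _ c%:E).
  - move=> x Kx; apply: (@filterS _ _ _ `]- (r + 1), r + 1[%classic).
      by move=> u; rewrite /K1/= !in_itv/= => /andP[/ltW h1 /ltW h2]; rewrite h1 h2.
    apply: near_in_itvoo; rewrite in_itv/=.
    by have := Kr _ Kx; rewrite ler_norml; lra.
  - move=> w t wg t0 Kt; rewrite jA//; last exact: good_OmegaA wg.
    apply: (jump_bound pcnafA T0 WP jA W0); apply: K1ab; rewrite /K1/= in_itv/=.
    by have := Kr _ Kt; rewrite ler_norml; lra.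
rewrite lte_mul_pinfty//.
- by rewrite lee_fin mulr_ge0 ?invr_ge0 ?(ltW c0)// addr_ge0// mulr_ge0.
- by rewrite /K2 lebesgue_measure_itv/=; case: ifPn => // _; rewrite -EFinB ltry.
Qed.

End finiteness.

Theorem proposition3p1 (d : measure_display) (Omega : measurableType d)
    (R : realType) (P : R -> probability Omega R) (X : R -> Omega -> R)
    (theta : R -> Omega -> Omega) (OmegaA : set Omega) (A : R -> Omega -> R)
    (levyX : spectrally_negative_levy P X)
    (shiftX : shift_operators X theta)
    (pcnafA : pcnaf P X theta OmegaA A) :
  revuz_limit_exists P X OmegaA A /\
  radon_measure (revuz_measure P X OmegaA A).
Proof.
pose LF := snlp_levy levyX.
have g_full := good_full levyX pcnafA.
have g_shift := fun t w => @good_shift _ _ _ _ _ _ _ _ shiftX pcnafA t w.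
have g_cadlag := @good_cadlag _ _ _ X OmegaA.
have g_inc := fun w => @good_increasing _ _ _ _ _ _ _ _ pcnafA w.
have mA := fun t => @good_adapted _ _ _ _ _ _ _ _ levyX pcnafA t.
have g_A0 := fun w => @good_A0 _ _ _ _ _ _ _ _ pcnafA w.
have g_add := fun w s t => @good_add _ _ _ _ _ _ _ _ pcnafA w s t.
have [Q QE] := aug_measure_exists LF g_full.
have approx B : measurable B -> revuz_approx P X OmegaA A B t @[t --> 0^'+] -->
    revuz_mass Q A B 1.
  move=> mB; apply: cvg_near_cst; near=> t.
  apply: (revuz_approx_eq shiftX g_full g_shift g_cadlag QE g_inc mA g_A0 g_add) => //.
  exact: good_OmegaA.
have [nu nuE] := revuz_measure_exists g_cadlag Q g_inc mA.
split.
  by move=> B mB; apply/cvg_ex; exists (revuz_mass Q A B 1); exact: approx.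
exists nu; split.
  by move=> B mB; rewrite nuE//; apply: cvg_lim => //; exact: approx.
move=> K cK.
have mK : measurable K.
  by apply: closed_measurable; apply: compact_closed => //; exact: norm_hausdorff.
have [r [_ Kr]] := compact_bounded cK.
have r1 : r < r + 1 by rewrite ltrDl.
have [e e0] := revuz_mass_bounded shiftX pcnafA QE mK (Kr _ r1).
(* Finiteness is known at the small time [e]; by linearity in time an infinite value at time 1 would
   be infinite at [e] as well. *)
rewrite nuE// (revuz_mass_linear shiftX g_shift g_cadlag QE g_inc mA g_A0 g_add mK e0).
have : (0 <= revuz_mass Q A K 1)%E by apply: integral_ge0 => w _; exact: measure_ge0.
case: (revuz_mass Q A K 1) => [x||]//; first by rewrite !ltry.
by rewrite gt0_muley ?lte_fin.
Unshelve. all: by end_near. Qed.
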